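(* Let $\mathcal P$ be a $(\lambda_1,\lambda_2)$-good grid of a finite measure space $(I,\mathbb A,m)$, and let $s>0$, $p\in[1,\infty)$, $q\in[1,\infty]$. For $f\in L^\beta$ with some $\beta>1$, each one of the quantities $|f|_{\mathcal B^s_{p,q}}$, $N_{st}(f)$, $N_{haar}(f)$, $N_{osc}(f)$ is finite if and only if $f\in\mathcal B^s_{p,q}$. Furthermore these norms are equivalent on $\mathcal B^s_{p,q}$. Indeed $$|f|_{\mathcal B^s_{p,q}}\le N_{st}(f),\qquad N_{st}(f)\le C_e\,N_{haar}(f),\qquad N_{haar}(f)\le C_H\,N_{osc}(f),\qquad N_{osc}(f)\le C_{o}\,|f|_{\mathcal B^s_{p,q}},$$ where $$C_H=\frac{\lambda_2^{1/2}}{\sqrt2\,\lambda_1^{3/2}}+1,\qquad C_e=1+C_H\max\{\lambda_2^{1/p-s},\lambda_1^{1/p-s}\}\,\lambda_1^{-2-1/p},$$ $$C_o=\Gamma\,|I|^{-s}+\frac1{1-\lambda_2^s},\qquad \Gamma=\Big(\sum_k|\mathcal P^k|^{sq'}\Big)^{1/q'}\ (q>1),\quad \Gamma=\sup_k|\mathcal P^k|^{s}\ (q=1).$$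
   Context: $|J|=m(J)$; $|\cdot|_p$ is the norm of $L^p=L^p(I,\mathbb A,m)$; $q'$ is the conjugate exponent ($\infty'=1$); $\mathbb N=\{0,1,\dots\}$; for $q=\infty$ the outer $\ell^q$ sums are suprema. $|\mathcal P^k|=\max\{|Q|:Q\in\mathcal P^k\}$. Norms of $f$ are given the value $+\infty$ when not finite (in particular $|f|_{\mathcal B^s_{p,q}}=\infty$ if $f\notin\mathcal B^s_{p,q}$). Good grid ($0<\lambda_1<\lambda_2<1$): a sequence $\mathcal P=(\mathcal P^k)_{k\in\mathbb N}$ of finite families of measurable sets of positive measure with: $\mathcal P^0=\{I\}$; $I=\bigcup_{Q\in\mathcal P^k}Q$ up to a null set; the elements of $\mathcal P^k$ are pairwise disjoint; every $Q\in\mathcal P^k$, $k>0$, is contained in some $P\in\mathcal P^{k-1}$; $\lambda_1\le|Q|/|P|\le\lambda_2$ whenever $Q\subset P$, $Q\in\mathcal P^{k+1}$, $P\in\mathcal P^k$; $\bigcup_k\mathcal P^k$ generates $\mathbb A$. Also $\mathcal P$ denotes $\bigcup_k\mathcal P^k$. Souza's atoms: an $(s,p)$-Souza's atom on $Q\in\mathcal P$ is a function $a$ that is constant on $Q$, zero outside $Q$, with $|a|_\infty\le|Q|^{s-1/p}$; the canonical one is $|Q|^{s-1/p}1_Q$. $\mathcal B^s_{p,q}$ is the set of complex $g\in L^p$ that can be written $g=\sum_k\sum_{Q\in\mathcal P^k}s_Qa_Q$, with $a_Q$ an $(s,p)$-Souza's atom on $Q$, $s_Q\in\mathbb C$, $\sum_k|\sum_{Q\in\mathcal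 P^k}s_Qa_Q|_p<\infty$ and finite cost $(\sum_k(\sum_{Q\in\mathcal P^k}|s_Q|^p)^{q/p})^{1/q}$; $|g|_{\mathcal B^s_{p,q}}$ is the infimum of costs over all such representations. Unbalanced Haar system. For $Q\in\mathcal P^k$ let $\Omega_Q=\{P^Q_1,\dots,P^Q_{n_Q}\}$ ($n_Q\ge2$) be its children (elements of $\mathcal P^{k+1}$ contained in $Q$), ordered arbitrarily. $\mathcal H_Q=\bigcup_j\mathcal H_{Q,j}$ is a family of pairs of disjoint subsets of $\Omega_Q$ constructed as follows: $\mathcal H_{Q,0}=\{(A,B)\}$ with $A=\{P^Q_1,\dots,P^Q_{[n_Q/2]}\}$, $B=\{P^Q_{[n_Q/2]+1},\dots,P^Q_{n_Q}\}$; given $(S_1,S_2)\in\mathcal H_{Q,j}$, for each $i\in\{1,2\}$ with $\#S_i=n_i\ge2$, fix an ordering $S_i=\{R^i_1,\dots,R^i_{n_i}\}$ and add to $\mathcal H_{Q,j+1}$ the pair $(\{R^i_1,\dots,R^i_{[n_i/2]}\},\{R^i_{[n_i/2]+1},\dots,R^i_{n_i}\})$. For $S=(S_1,S_2)\in\mathcal H_Q$, $$\phi_S=\frac1{m_S}\Big(\frac{\sum_{P\in S_1}1_P}{\sum_{P\in S_1}|P|}-\frac{\sum_{R\in S_2}1_R}{\sum_{R\in S_2}|R|}\Big),\qquad m_S=\Big(\frac1{\sum_{P\in S_1}|P|}+\frac1{\sum_{R\in S_2}|R|}\Big)^{1/2},$$ and $\phi_I=1_I/|I|^{1/2}$. Put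 $d^f_S=\int f\phi_S\,dm$ for $S\in\bigcup_Q\mathcal H_Q$ and $d_I^f=\int f\phi_I\,dm$ (the $\phi$'s form an unconditional basis of $L^\beta$ for $1<\beta<\infty$). The norms: $$N_{haar}(f)=|I|^{1/p-s-1/2}|d_I^f|+\Big(\sum_k\big(\sum_{Q\in\mathcal P^k}|Q|^{1-sp-\frac p2}\sum_{S\in\mathcal H_Q}|d_S^f|^p\big)^{q/p}\Big)^{1/q}.$$ Let $k_I^f=|I|^{1/p-s-1/2}d_I^f$ and, for $P\in\mathcal P^{k+1}$ a child of $Q\in\mathcal P^k$, $k_P^f=|P|^{1/p-s}\sum_{S\in\mathcal H_Q}d_S^f\,\phi_S(x_P)$, where $x_P\in P$ is any point ($\phi_S$ is constant on $P$). Then $$N_{st}(f)=|k_I^f|+\Big(\sum_{k\ge1}\big(\sum_{Q\in\mathcal P^k}|k_Q^f|^p\big)^{q/p}\Big)^{1/q}.$$ With $osc_p(f,Q)=\inf_{c\in\mathbb C}(\int_Q|f-c|^p\,dm)^{1/p}$, $$N_{osc}(f)=|I|^{-s}|f|_p+\Big(\sum_k\big(\sum_{Q\in\mathcal P^k}|Q|^{-sp}osc_p(f,Q)^p\big)^{q/p}\Big)^{1/q}.$$ *)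

(* Defs.v *)
From HB Require Import structures.
From mathcomp Require Import all_boot all_order all_algebra.
From mathcomp Require Import all_classical all_reals all_analysis.
From mathcomp Require Import complex.

Set Implicit Arguments.
Unset Strict Implicit.
Unset Printing Implicit Defensive.

Import Order.TTheory GRing.Theory Num.Theory.
Import numFieldNormedType.Exports.

Local Open Scope classical_set_scope.
Local Open Scope ring_scope.

(* The library has no measurable or integrable functions with values in R[i];
   they are handled through real and imaginary parts. *)
Section complex_functions.
Context {d : measure_display} {T : measurableType d} {R : realType}.
Variable m : {measure set T -> \bar R}.

Definition cmeasurable (g : T -> R[i]) : Prop :=
  measurable_fun [set: T] (fun x => complex.Re (g x)) /\
  measurable_fun [set: T] (fun x => complex.Im (g x)).

Definition cLnorm (r : \bar R) (g : T -> R[i]) : \bar R :=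
  Lnorm m r (fun x => (Normc.normc (g x))%:E).

Definition cLp (r : \bar R) (g : T -> R[i]) : Prop :=
  cmeasurable g /\ (cLnorm r g < +oo)%E.

Definition cintegral (g : T -> R[i]) : R[i] :=
  Complex (\int[m]_x (complex.Re (g x))) (\int[m]_x (complex.Im (g x))).

End complex_functions.

(* (sum_k a_k^(q/p))^(1/q), read as sup_k a_k^(1/p) when q = +oo;
   only used with 1 <= p and 1 <= q. *)
Definition mixed_norm {R : realType} (p : R) (q : \bar R) (a : nat -> \bar R) :
    \bar R :=
  match q with
  | r%:E => ((\sum_(0 <= k <oo) (a k) `^ (r / p)) `^ r^-1)%E
  | _ => ereal_sup (range (fun k => (a k `^ p^-1)%E))
  end.

Section grid.
Context {d : measure_display} {T : measurableType d} {R : realType}.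
Variable m : {finite_measure set T -> \bar R}.

Definition vol (Q : set T) : R := fine (m Q).

(* The underlying space I is the whole type T. *)
Record good_grid (lam1 lam2 : R) (G : nat -> set (set T)) : Prop := GoodGrid {
  grid_finite : forall k, finite_set (G k) ;
  grid_measurable : forall k Q, G k Q -> measurable Q ;
  grid_pos : forall k Q, G k Q -> (0 < m Q)%E ;
  grid0 : G 0%N = [set [set: T]] ;
  grid_cover : forall k, m (~` \bigcup_(Q in G k) Q) = 0%E ;
  grid_disj : forall k, trivIset (G k) id ;
  grid_nested : forall k Q, G k.+1 Q -> exists2 P, G k P & Q `<=` P ;
  grid_ratio : forall k P Q, G k P -> G k.+1 Q -> Q `<=` P ->
    lam1 <= vol Q / vol P <= lam2 ;
  grid_generates : <<s \bigcup_k G k >> = @measurable d T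
}.

Variable G : nat -> set (set T).

Definition children (k : nat) (Q : set T) : set (set T) :=
  [set P | G k.+1 P /\ P `<=` Q].

(* The element of G k containing P, for P in G k.+1. *)
Definition parent (k : nat) (P : set T) : set T :=
  xget [set: T] [set Q | G k Q /\ P `<=` Q].

Section besov.
Variables (s p : R) (q : \bar R).

Definition souza_atom (Q : set T) (a : T -> R[i]) : Prop :=
  [/\ exists c : R[i], forall x, Q x -> a x = c,
      forall x, ~ Q x -> a x = 0 &
      (cLnorm m +oo a <= (vol Q `^ (s - p^-1))%:E)%E].

Definition level_sum (c : set T -> R[i]) (a : set T -> T -> R[i]) (k : nat)
    (x : T) : R[i] :=
  \sum_(Q \in G k) c Q * a Q x.

Definition besov_cost (c : set T -> R[i]) : \bar R :=
  mixed_norm p q (fun k => (\sum_(Q \in G k) Normc.normc (c Q) `^ p)%:E).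

(* The equality g = sum_k level_sum c a k is an equality in L^p, the series
   being absolutely convergent there. *)
Record besov_rep (g : T -> R[i]) (c : set T -> R[i]) (a : set T -> T -> R[i]) :
    Prop := BesovRep {
  rep_Lp : cLp m p%:E g ;
  rep_atom : forall k Q, G k Q -> souza_atom Q (a Q) ;
  rep_abs : (\sum_(0 <= k <oo) cLnorm m p%:E (level_sum c a k) < +oo)%E ;
  rep_sum : (fun n => cLnorm m p%:E
      (fun x => g x - \sum_(k < n) level_sum c a k x)) @ \oo --> 0%E ;
  rep_cost : (besov_cost c < +oo)%E
}.

Definition besov (g : T -> R[i]) : Prop := exists c a, besov_rep g c a.

(* +oo outside besov, as the infimum of the empty set. *)
Definition besov_norm (g : T -> R[i]) : \bar R :=
  ereal_inf [set C | exists c a, besov_rep g c a /\ C = besov_cost c].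

End besov.

Section haar.

(* [ord S] is the chosen enumeration of the family S.  A family occurs at most
   once in the construction of all the H_Q, so a single function accounts for
   every choice of orderings. *)
Definition orderings (ord : set (set T) -> seq (set T)) : Prop :=
  forall k Q S, G k Q -> S `<=` children k Q ->
    uniq (ord S) /\ [set` ord S] = S.

Variable ord : set (set T) -> seq (set T).

Definition halves (S : set (set T)) : set (set T) * set (set T) :=
  let l := ord S in
  ([set` take (size l)./2 l], [set` drop (size l)./2 l]).

Fixpoint haar_level (Om : set (set T)) (j : nat) :
    set (set (set T) * set (set T)) :=
  match j with
  | 0%N => [set halves Om]
  | j'.+1 => [set S' | exists2 S, haar_level Om j' S &
               (2 <= size (ord S.1))%N /\ S' = halves S.1 \/
               (2 <= size (ord S.2))%N /\ S' = halves S.2]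
  end.

Definition haar_pairs (k : nat) (Q : set T) : set (set (set T) * set (set T)) :=
  \bigcup_j haar_level (children k Q) j.

Definition mass (A : set (set T)) : R := \sum_(P \in A) vol P.

Definition haar_fun (S : set (set T) * set (set T)) (x : T) : R :=
  (Num.sqrt ((mass S.1)^-1 + (mass S.2)^-1))^-1 *
  ((\sum_(P \in S.1) (\1_P x : R)) / mass S.1 - (\sum_(P \in S.2) (\1_P x : R)) / mass S.2).

Definition haar_fun0 (x : T) : R := (\1_[set: T] x : R) / Num.sqrt (vol [set: T]).

Definition haar_coef (f : T -> R[i]) (S : set (set T) * set (set T)) : R[i] :=
  cintegral m (fun x => f x * real_complex R (haar_fun S x)).

Definition haar_coef0 (f : T -> R[i]) : R[i] :=
  cintegral m (fun x => f x * real_complex R (haar_fun0 x)).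

Variables (s p : R) (q : \bar R).

Definition N_haar (f : T -> R[i]) : \bar R :=
  ((vol [set: T] `^ (p^-1 - s - 2^-1) * Normc.normc (haar_coef0 f))%:E +
   mixed_norm p q (fun k =>
     (\sum_(Q \in G k) vol Q `^ (1 - s * p - p / 2) *
        \sum_(S \in haar_pairs k Q) Normc.normc (haar_coef f S) `^ p)%:E))%E.

(* [pt P] is the point of P at which the Haar functions are evaluated. *)
Variable pt : set T -> T.

Definition st_coef0 (f : T -> R[i]) : R[i] :=
  real_complex R (vol [set: T] `^ (p^-1 - s - 2^-1)) * haar_coef0 f.

(* The coefficient k_P of P in G k.+1. *)
Definition st_coef (f : T -> R[i]) (k : nat) (P : set T) : R[i] :=
  real_complex R (vol P `^ (p^-1 - s)) *
  \sum_(S \in haar_pairs k (parent k P))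
     haar_coef f S * real_complex R (haar_fun S (pt P)).

Definition N_st (f : T -> R[i]) : \bar R :=
  ((Normc.normc (st_coef0 f))%:E +
   mixed_norm p q (fun k =>
     (\sum_(P \in G k.+1) Normc.normc (st_coef f k P) `^ p)%:E))%E.

Definition osc (f : T -> R[i]) (Q : set T) : \bar R :=
  ereal_inf (range (fun c : R[i] =>
    ((\int[m]_(x in Q) (Normc.normc (f x - c) `^ p)%:E) `^ p^-1)%E)).

Definition N_osc (f : T -> R[i]) : \bar R :=
  ((vol [set: T] `^ (- s))%:E * cLnorm m p%:E f +
   mixed_norm p q (fun k =>
     \sum_(Q \in G k) (vol Q `^ (- (s * p)))%:E * (osc f Q) `^ p))%E.

End haar.

(* max of |Q| over the finite nonempty family G k *)
Definition mesh (k : nat) : R := sup (vol @` G k).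

Definition Gamma (s : R) (q : \bar R) : \bar R :=
  match hoelder_conjugate q with
  | r%:E => ((\sum_(0 <= k <oo) (mesh k `^ (s * r))%:E) `^ r^-1)%E
  | _ => ereal_sup (range (fun k => (mesh k `^ s)%:E))
  end.

Definition C_o (lam2 s : R) (q : \bar R) : \bar R :=
  (Gamma s q * (vol [set: T] `^ (- s))%:E + ((1 - lam2 `^ s)^-1)%:E)%E.

End grid.

Definition C_H {R : realType} (lam1 lam2 : R) : R :=
  lam2 `^ 2^-1 / (Num.sqrt 2 * lam1 `^ (3 / 2)) + 1.

Definition C_e {R : realType} (lam1 lam2 s p : R) : R :=
  1 + C_H lam1 lam2 *
      Num.max (lam2 `^ (p^-1 - s)) (lam1 `^ (p^-1 - s)) *
      lam1 `^ (- 2 - p^-1).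

Definition equivalent_norms {R : realType} {X : Type} (B : X -> Prop)
    (N N' : X -> \bar R) : Prop :=
  exists2 C : R, 0 < C &
    forall f, B f -> (N f <= C%:E * N' f)%E /\ (N' f <= C%:E * N f)%E.

(* Main.v *)
Require Import Defs.
From mathcomp Require Import all_boot all_order all_algebra.
From mathcomp Require Import all_classical all_reals all_analysis.
From mathcomp Require Import complex.
From mathcomp Require Import ring lra zify.
From mathcomp Require Import finmap ess_sup_inf measurable_realfun.

Set Implicit Arguments.
Unset Strict Implicit.
Unset Printing Implicit Defensive.

Import Order.TTheory GRing.Theory Num.Theory.
Import numFieldNormedType.Exports.

Local Open Scope classical_set_scope.
Local Open Scope ring_scope.

(* All four comparisons hold for integrable f, which covers both f in L^beta and
   f in B^s_{p,q}.
   |f|_B <= N_st: take as coefficients the k_Q.  The partial sums of the resulting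
   series telescope to the averages of f over the cells, because the Haar functions
   of H_Q rebuild the differences of the averages over the children of Q and over Q.
   As |P^k|^s decays geometrically, the series converges absolutely in L^p and in L^1;
   its limit has the same integral as f over every cell, hence equals f, and Fatou's
   lemma turns the a.e. convergence into convergence in L^p.
   N_st <= C_e N_haar and N_haar <= C_H N_osc: two applications of Jensen's inequality
   with the weights |phi_S|, together with the bounds sum_S |phi_S| <= C_H |Q|^{-1/2}
   on Q and int |phi_S| <= |Q|^{1/2}.
   N_osc <= C_o |f|_B: on a cell Q of level k the levels up to k of a representation
   are constant, so the oscillation only sees the levels k+1+i, whose contribution is
   damped by lambda_2^{s(i+1)}; Young's inequality for this geometric kernel concludes. *)

(** * Convexity of powers and the mixed norm *)

(** The weights |phi_S| can be summed in both variables: over the pairs S at a fixed child of Q, and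
    over the children for a fixed S. Jensen's inequality therefore works in either direction between
    the coefficients of a cell and the values on its children, at the cost of powers of these two
    sums. [C_H] comes from the sum over S: along the nested families containing one child,
    reciprocal masses telescope, and this is balanced against the number of splittings by AM-GM with
    the parameter (|Q|/2)^(1/2). A Besov representation converges in L^p without any rate, while the
    mixed norm involves all levels. Remainders are therefore discarded only for finitely many levels
    at a time, and the full norm is recovered as a limit of truncations. The two summands of [C_o]
    have different origins: Hölder's inequality across the levels gives [Gamma], which controls
    |f|_p, and the geometric kernel gives 1/(1 - lam2^s), which controls the oscillations. For |f|_B
    <= N_st the function is only known to be integrable. Dominated convergence takes place in L^1,
    with the sum of the moduli of all levels as majorant, and f in L^p is a conclusion. *)

Section powR_convexity.
Context {R : realType}.
Implicit Types (p x y : R).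

(** The graph of t^p lies above its tangent at y. Multiplied out, this is Young's inequality with
    exponents p and p/(p-1), and no division by y occurs. *)
Lemma powR_tangent p x y : 1 <= p -> 0 <= x -> 0 <= y ->
  p * (x * y `^ (p - 1)) <= x `^ p + (p - 1) * y `^ p.
Proof.
rewrite le_eqVlt => /predU1P[<-|p1] x0 y0.
  by rewrite subrr powRr0 powRr1// mul0r addr0 mulr1 mul1r.
have p0 : 0 < p by apply: lt_trans p1.
have q0 : 0 < p / (p - 1) by rewrite divr_gt0// subr_gt0.
have p10 : p - 1 != 0 by rewrite subr_eq0 gt_eqF.
have pq : p^-1 + (p / (p - 1))^-1 = 1.
  rewrite invf_div; field.
  by rewrite (gt_eqF p0).
have := @conjugate_powR R x (y `^ (p - 1)) p (p / (p - 1)) x0 (powR_ge0 _ _) p0 q0 pq.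
rewrite -powRrM (mulrC (p - 1)) divfK// => h.
rewrite -(ler_pM2l p0) in h; apply: (le_trans h).
rewrite mulrDr mulrCA divff ?gt_eqF// mulr1 lerD2l invf_div.
by rewrite mulrCA [p * _]mulrC divfK ?gt_eqF// mulrC.
Qed.

(** Jensen's inequality with weights of arbitrary total mass W: the tangent inequality at the mean X
    / W is summed with the weights. When W = 0 all terms vanish. *)
Lemma powR_sum_le (I : eqType) (r : seq I) (w x : I -> R) p : 1 <= p ->
  (forall i, i \in r -> 0 <= w i) -> (forall i, i \in r -> 0 <= x i) ->
  (\sum_(i <- r) w i * x i) `^ p <=
  (\sum_(i <- r) w i) `^ (p - 1) * \sum_(i <- r) w i * x i `^ p.
Proof.
move=> p1 w0 x0; have p0 : 0 < p by apply: lt_le_trans p1.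
set W := \sum_(i <- r) w i; set X := \sum_(i <- r) w i * x i.
have W0 : 0 <= W by rewrite /W big_seq; apply: sumr_ge0.
have X0 : 0 <= X.
  by rewrite /X big_seq; apply: sumr_ge0 => i ri; rewrite mulr_ge0 ?w0 ?x0.
have [W_eq0|Wneq0] := eqVneq W 0.
  suff -> : X = 0.
    rewrite powR0 ?gt_eqF// mulr_ge0 ?powR_ge0// big_seq sumr_ge0// => i ri.
    by rewrite mulr_ge0 ?w0 ?powR_ge0.
  rewrite /X big_seq big1// => i ri.
  suff -> : w i = 0 by rewrite mul0r.
  apply/eqP; rewrite eq_le w0// andbT -W_eq0 /W (big_rem i)//= lerDl big_seq.
  by apply: sumr_ge0 => j /mem_rem; apply: w0.
have {}W0 : 0 < W by rewrite lt_neqAle eq_sym Wneq0.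
set mu := X / W.
have mu0 : 0 <= mu by rewrite divr_ge0// ltW.
have Xmu : X = W * mu by rewrite mulrC divfK.
have : \sum_(i <- r) w i * (p * (x i * mu `^ (p - 1))) <=
       \sum_(i <- r) w i * (x i `^ p + (p - 1) * mu `^ p).
  rewrite big_seq [leRHS]big_seq; apply: ler_sum => i ri.
  by rewrite ler_wpM2l ?w0// powR_tangent// x0.
rewrite (_ : \sum_(i <- r) w i * (p * _) = p * (mu `^ (p - 1) * X)); last first.
  by rewrite /X !mulr_sumr; apply: eq_bigr => i _; ring.
rewrite (_ : \sum_(i <- r) w i * (_ + _) = \sum_(i <- r) w i * x i `^ p + (p - 1) * (mu `^ p * W)); last first.
  rewrite /W !mulr_sumr -big_split/=; apply: eq_bigr => i _; ring.
rewrite {1}Xmu (_ : mu `^ (p - 1) * (W * mu) = mu `^ p * W); last first.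
  by rewrite mulrC -mulrA mulr_powRB1// mulrC.
rewrite -lerBlDr (_ : _ - _ = mu `^ p * W); last by ring.
rewrite Xmu powRM//; last exact: ltW.
rewrite (_ : W `^ p * _ = W `^ (p - 1) * (mu `^ p * W)).
  by move=> h; rewrite ler_wpM2l// powR_ge0.
by rewrite -(mulr_powRB1 (ltW W0) p0); ring.
Qed.

(** At a positive limit the power is differentiable, hence continuous; the limit 0 is treated
    directly. *)
Lemma cvg_powR p (u : nat -> R) (l : R) : 0 < p -> (forall n, 0 <= u n) ->
  0 <= l -> u @ \oo --> l -> (fun n => u n `^ p) @ \oo --> l `^ p.
Proof.
move=> p0 u0; rewrite le_eqVlt => /predU1P[<- ul|l0 ul].
  rewrite powR0 ?gt_eqF//; apply/cvgrPdist_lt => e e0.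
  move/cvgrPdist_lt : ul => /(_ (e `^ p^-1)); rewrite powR_gt0// => /(_ isT).
  apply: filterS => n; rewrite !sub0r !normrN !ger0_norm ?powR_ge0// => une.
  have -> : e = (e `^ p^-1) `^ p by rewrite -powRrM mulVf ?gt_eqF// powRr1// ltW.
  by rewrite gt0_ltr_powR// nnegrE ?powR_ge0.
have : {for l, continuous (fun x : R => x `^ p)}.
  apply: differentiable_continuous; apply/derivable1_diffP.
  by apply: derivable_powR; rewrite in_itv/= l0.
by move=> /continuous_cvg; apply.
Qed.
End powR_convexity.

Lemma le_poweR {R : realType} (x y : \bar R) (r : R) : 0 <= r -> (0 <= x)%E ->
  (x <= y)%E -> (x `^ r <= y `^ r)%E.
Proof.
move=> r0 x0 xy; apply: gt0_ler_poweR => //; rewrite in_itv/= ?leey ?andbT//.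
exact: le_trans xy.
Qed.

(** * Mixed norms as norms of sequence spaces *)

Section mixed_norms.
Context {R : realType}.
Local Open Scope ereal_scope.
Implicit Types (p : R) (q : \bar R) (a : nat -> \bar R) (b : nat -> R).

Lemma mixed_norm_ge0 p q a : 1 <= q -> 0 <= mixed_norm p q a.
Proof.
case: q => [r _|_|//]; first exact: poweR_ge0.
by apply: le_trans (ereal_sup_ubound _); [|exists 0%N => //]; exact: poweR_ge0.
Qed.

Lemma le_mixed_norm p q a a' : (1 <= p)%R -> 1 <= q -> (forall k, 0 <= a k) ->
  (forall k, a k <= a' k) -> mixed_norm p q a <= mixed_norm p q a'.
Proof.
move=> p1 q1 a0 aa'; have p0 : (0 < p)%R by apply: lt_le_trans p1.
have a'0 k : 0 <= a' k by apply: le_trans (aa' k).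
case: q q1 => [r| |//].
- rewrite lee_fin => r1 /=; have r0 : (0 < r)%R by apply: lt_le_trans r1.
  apply: le_poweR; first by rewrite invr_ge0 ltW.
    by apply: nneseries_ge0 => *; rewrite poweR_ge0.
  apply: lee_nneseries => [k _ _|k _]; first by rewrite poweR_ge0.
  by apply: le_poweR => //; rewrite divr_ge0// ltW.
- move=> _ /=; apply: ge_ereal_sup => _ [k _ <-].
  apply: ereal_sup_ge; exists (a' k `^ p^-1); first by exists k.
  by apply: le_poweR => //; rewrite invr_ge0 ltW.
Qed.

(** The entries of [a] play the role of p-th powers of level norms, so a factor C on the norms
    appears as [C ^ p] on the entries. *)
Lemma mixed_normZ p q a (C : R) : (1 <= p)%R -> 1 <= q -> (0 <= C)%R ->
  (forall k, 0 <= a k) ->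
  mixed_norm p q (fun k => (C `^ p)%:E * a k) = C%:E * mixed_norm p q a.
Proof.
move=> p1 q1 C0 a0; have p0 : (0 < p)%R by apply: lt_le_trans p1.
case: q q1 => [r| |//].
- rewrite lee_fin => r1 /=; have r0 : (0 < r)%R by apply: lt_le_trans r1.
  under eq_eseriesr do rewrite poweRM ?lee_fin ?powR_ge0// poweR_EFin -powRrM mulrCA divff ?gt_eqF// mulr1.
  rewrite nneseriesZl; last by move=> *; rewrite poweR_ge0.
  rewrite poweRM ?lee_fin ?powR_ge0//; last by apply: nneseries_ge0 => *; rewrite poweR_ge0.
  by rewrite poweR_EFin -powRrM divff ?gt_eqF// powRr1.
- move=> _ /=.
  rewrite -ereal_supZl//; last by apply/set0P; exists (a 0%N `^ p^-1), 0%N.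
  congr ereal_sup; rewrite image_comp; apply/eq_imagel => k _ /=.
  by rewrite poweRM ?lee_fin ?powR_ge0// poweR_EFin -powRrM divff ?gt_eqF// powRr1.
Qed.

(** Only the empty set is null for the counting measure, so the essential supremum is the
    supremum. *)
Lemma Lnorm_countingy b : (forall k, 0 <= b k)%R ->
  Lnorm counting +oo (EFin \o b) = ereal_sup (range (EFin \o b)).
Proof.
move=> b0; have c0 : 0 < counting [set: nat] :> \bar R.
  rewrite /counting; case: asboolP => [/finite_setPn|_]; last exact: ltry.
  by move=> h; exfalso; apply: h; exact: card_lexx.
rewrite unlock /= c0; apply/eqP; rewrite eq_le; apply/andP; split.
  apply/ess_supP; apply: nearW => k /=; rewrite ger0_norm//.
  by apply: ereal_sup_ubound; exists k.
apply: ge_ereal_sup => _ [k _ <-] /=.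
have /ess_supP[N [_ N0 subN]] := lexx (ess_sup counting (abse \o (EFin \o b))).
rewrite leNgt; apply/negP => klt.
have Nk : N k by apply: subN => /=; rewrite ger0_norm// => /(lt_le_trans klt); rewrite ltxx.
have [finN|infN] := pselect (finite_set N); last first.
  by move: N0; rewrite /= /counting asboolF.
move: N0; rewrite /= /counting asboolT//.
move=> /eqP; rewrite eqe pnatr_eq0 finmap.cardfs_eq0 => /eqP N0.
by move: Nk; rewrite (fset_set_set0 finN N0).
Qed.

(** This identification transfers the Minkowski and Hölder inequalities of measure theory to mixed
    norms. *)
Lemma mixed_norm_Lnorm p q b : (1 <= p)%R -> 1 <= q -> (forall k, 0 <= b k)%R ->
  mixed_norm p q (fun k => (b k `^ p)%:E) = Lnorm counting q (EFin \o b).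
Proof.
move=> p1 q1 b0; have p0 : (0 < p)%R by apply: lt_le_trans p1.
case: q q1 => [r| |//].
- rewrite lee_fin => r1; have r0 : (0 < r)%R by apply: lt_le_trans r1.
  rewrite Lnorm_counting//=; congr (_ `^ _); apply: eq_eseriesr => k _.
  by rewrite /= -powRrM mulrCA divff ?gt_eqF// mulr1 ger0_norm.
- move=> _; rewrite Lnorm_countingy//=; congr ereal_sup; apply: eq_imagel => k _ /=.
  by rewrite -powRrM divff ?gt_eqF// powRr1.
Qed.

Lemma mixed_normD p q b b' : (1 <= p)%R -> 1 <= q ->
  (forall k, 0 <= b k)%R -> (forall k, 0 <= b' k)%R ->
  mixed_norm p q (fun k => ((b k + b' k) `^ p)%:E) <=
  mixed_norm p q (fun k => (b k `^ p)%:E) + mixed_norm p q (fun k => (b' k `^ p)%:E).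
Proof.
move=> p1 q1 b0 b'0; rewrite !mixed_norm_Lnorm//; last by move=> k; rewrite addr_ge0.
exact: (@eminkowski _ _ _ counting b b' q).
Qed.

Lemma mixed_norm_sum p q n (h : nat -> nat -> R) : (1 <= p)%R -> 1 <= q ->
  (forall i k, 0 <= h i k)%R ->
  mixed_norm p q (fun k => ((\sum_(i < n) h i k) `^ p)%:E) <=
  \sum_(i < n) mixed_norm p q (fun k => (h i k `^ p)%:E).
Proof.
move=> p1 q1 h0; have p0 : (0 < p)%R by apply: lt_le_trans p1.
elim: n => [|n ih].
  rewrite big_ord0 mixed_norm_Lnorm//; last by move=> k; rewrite big_ord0.
  rewrite (_ : EFin \o _ = cst 0); last by apply/funext => k /=; rewrite big_ord0.
  by rewrite Lnorm0// gt_eqF// (lt_le_trans _ q1).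
rewrite big_ord_recr/= (_ : (fun k => _) = (fun k => ((\sum_(i < n) h i k + h n k) `^ p)%:E)); last first.
  by apply/funext => k; rewrite big_ord_recr.
apply: le_trans (mixed_normD _ _ _ _) _ => //; first by move=> k; rewrite sumr_ge0.
by rewrite leeD2r.
Qed.

Lemma mixed_norm_shift p q a n : (1 <= p)%R -> 1 <= q -> (forall k, 0 <= a k) ->
  mixed_norm p q (fun k => a (k + n)%N) <= mixed_norm p q a.
Proof.
move=> p1 q1 a0; have p0 : (0 < p)%R by apply: lt_le_trans p1.
case: q q1 => [r| |//].
- rewrite lee_fin => r1; have r0 : (0 < r)%R by apply: lt_le_trans r1.
  apply: le_poweR; first by rewrite invr_ge0 ltW.
    by apply: nneseries_ge0 => *; rewrite poweR_ge0.
  rewrite [leRHS](nneseries_split 0 n)/=; last by move=> *; rewrite poweR_ge0.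
  rewrite add0n (@nneseries_addn _ (fun k => a k `^ (r / p))); last first.
    by move=> *; rewrite poweR_ge0.
  by rewrite leeDr// sume_ge0// => *; rewrite poweR_ge0.
- by move=> _ /=; apply: ge_ereal_sup => _ [k _ <-]; apply: ereal_sup_ubound; exists (k + n)%N.
Qed.

Lemma nneseries_recl0 (u : nat -> \bar R) : (forall k, 0 <= u k) ->
  \sum_(0 <= k <oo) u k = u 0%N + \sum_(0 <= k <oo) u k.+1.
Proof.
move=> u0; rewrite nneseries_recl// -(@nneseries_addn _ _ 1)//.
by congr (_ + _); apply: eq_eseriesr => k _; rewrite addn1.
Qed.

(** Triangle inequality for the splitting of the sequence into its entry 0 and its tail. [N_st]
    separates the root cell from the other levels in the same way. *)
Lemma mixed_norm_recl p q b : (1 <= p)%R -> 1 <= q -> (forall k, 0 <= b k)%R ->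
  mixed_norm p q (fun k => (b k `^ p)%:E) <=
  (b 0%N)%:E + mixed_norm p q (fun k => (b k.+1 `^ p)%:E).
Proof.
move=> p1 q1 b0; have p0 : (0 < p)%R by apply: lt_le_trans p1.
pose u k := if k is 0%N then b 0%N else 0%R.
pose v k := if k is k'.+1 then b k else 0%R.
have -> : (fun k => (b k `^ p)%:E) = (fun k => ((u k + v k) `^ p)%:E).
  by apply/funext => -[|k] /=; rewrite ?addr0 ?add0r.
apply: (le_trans (mixed_normD p1 q1 _ _)); [by case=> /=|by case=> /=|apply: leeD].
- case: q q1 => [r| |//].
  + rewrite lee_fin => r1; have r0 : (0 < r)%R by apply: lt_le_trans r1.
    have uE : \sum_(0 <= k <oo) (u k `^ p)%:E `^ (r / p) = (b 0%N `^ p)%:E `^ (r / p).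
      apply: (eq_trans (nneseries_recl0 _)); first by move=> k; exact: poweR_ge0.
      rewrite eseries0 ?adde0// => k _ _.
      by rewrite /u powR0 ?gt_eqF// poweR0r// gt_eqF// divr_gt0.
    rewrite /mixed_norm uE !poweR_EFin -!powRrM (_ : p * (r / p / r) = 1)%R ?powRr1//.
    by field; rewrite !gt_eqF.
  + move=> _; apply: ge_ereal_sup => _ [k _ <-].
    rewrite poweR_EFin -powRrM divff ?gt_eqF// powRr1; last by rewrite /u; case: k.
    by rewrite lee_fin /u; case: k.
- case: q q1 => [r r1|_|h]; last by exfalso; have : false by exact: h.
  + rewrite lee_fin in r1; have r0 : (0 < r)%R by apply: lt_le_trans r1.
    have vE : \sum_(0 <= k <oo) (v k `^ p)%:E `^ (r / p) =
        \sum_(0 <= k <oo) (b k.+1 `^ p)%:E `^ (r / p).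
      apply: (eq_trans (nneseries_recl0 _)); first by move=> k; exact: poweR_ge0.
      rewrite (_ : (v 0%N `^ p)%:E `^ (r / p) = 0); first exact: add0e.
      by rewrite /v powR0 ?gt_eqF// poweR0r ?gt_eqF ?divr_gt0.
    rewrite le_eqVlt; apply/orP; left; apply/eqP.
    exact: (f_equal (fun z => z `^ r^-1) vE).
  + apply: ge_ereal_sup => _ [[|k] _ <-].
      rewrite poweR_EFin -powRrM divff ?gt_eqF// powRr1//.
      apply: (@le_trans _ _ (b 1%N)%:E); first by rewrite lee_fin /v.
      apply: ereal_sup_ubound; exists 0%N; first by [].
      by rewrite poweR_EFin -powRrM divff ?gt_eqF// powRr1.
    by apply: ereal_sup_ubound; exists k.
Qed.

(** The norm of [w] in the sequence space dual to l^q, written with the same case distinction as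
    [Gamma]. *)
Definition conj_norm q (w : nat -> R) : \bar R :=
  match hoelder_conjugate q with
  | r%:E => (\sum_(0 <= k <oo) (w k `^ r)%:E) `^ r^-1
  | _ => ereal_sup (range (EFin \o w))
  end.

(** Endpoint case of Hölder's inequality. If the supremum is infinite, the right side is infinite as
    soon as one [w k] is positive; if all vanish, both sides are 0. *)
Lemma nneseries_supl (w b : nat -> R) : (forall k, 0 <= w k)%R -> (forall k, 0 <= b k)%R ->
  \sum_(0 <= k <oo) (w k * b k)%:E <=
  ereal_sup (range (EFin \o b)) * \sum_(0 <= k <oo) (w k)%:E.
Proof.
move=> w0 b0; set y := ereal_sup _.
have by_ k : (b k)%:E <= y by apply: ereal_sup_ubound; exists k.
have y0 : 0 <= y by apply: le_trans (by_ 0%N); rewrite lee_fin.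
case: y y0 by_ => [y| |//] y0 by_.
  rewrite -nneseriesZl; last by move=> *; rewrite lee_fin.
  apply: lee_nneseries => [k _ _|k _]; first by rewrite lee_fin mulr_ge0.
  by rewrite mulrC -EFinM lee_fin ler_wpM2r// -lee_fin.
have [w_eq0|/existsNP[k wk]] := pselect (forall k, w k = 0%R).
  by rewrite !eseries0 ?mule0// => k _ _; rewrite w_eq0 ?mul0r.
rewrite gt0_mulye ?leey//; apply: (@lt_le_trans _ _ (w k)%:E).
  by rewrite lte_fin lt_neqAle eq_sym w0 andbT; apply/eqP.
apply: (le_trans _ (@nneseries_lim_ge _ _ xpredT _ k.+1 _)); last by move=> *; rewrite lee_fin.
by rewrite big_nat_recr//= leeDr// sume_ge0// => *; rewrite lee_fin.
Qed.

Lemma mixed_norm_hoelder p q (w b : nat -> R) : (1 <= p)%R -> 1 <= q ->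
  (forall k, 0 <= w k)%R -> (forall k, 0 <= b k)%R ->
  \sum_(0 <= k <oo) (w k * b k)%:E <=
  conj_norm q w * mixed_norm p q (fun k => (b k `^ p)%:E).
Proof.
move=> p1 q1 w0 b0; rewrite mixed_norm_Lnorm//.
have [qoo|qoo] := eqVneq q +oo.
  rewrite qoo /conj_norm hoelder_conjugatey invr1 poweRe1; last first.
    by apply: nneseries_ge0 => *; rewrite lee_fin powR_ge0.
  under [X in _ <= X * _]eq_eseriesr do rewrite powRr1//.
  rewrite muleC Lnorm_countingy//; exact: nneseries_supl.
have [q_eq1|qneq1] := eqVneq q 1.
  rewrite q_eq1 /conj_norm hoelder_conjugate1 Lnorm1 ge0_integral_count//.
  under [X in _ <= _ * X]eq_eseriesr do rewrite gee0_abs ?lee_fin//.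
  (* For q = 1 the supremum falls on [w], so [w] and [b] exchange roles. *)
  rewrite (_ : \sum_(0 <= k <oo) (w k * b k)%:E = \sum_(0 <= k <oo) (b k * w k)%:E).
    exact: nneseries_supl.
  by apply: eq_eseriesr => k _; rewrite mulrC.
case: q q1 qoo qneq1 => [r| |//]; last by rewrite eqxx.
rewrite lee_fin eqe => r1 _ rneq1.
have {}r1 : (1 < r)%R by rewrite lt_neqAle eq_sym rneq1.
have r0 : (0 < r)%R by apply: lt_trans r1.
have hc : hoelder_conjugate r%:E = (r / (r - 1))%:E.
  by rewrite /hoelder_conjugate/= eqe gt_eqF//= -EFinD inver subr_eq0 (negbTE rneq1).
rewrite /conj_norm hc.
have rr0 : (0 < r / (r - 1))%R by rewrite divr_gt0// subr_gt0.
have pq : ((r / (r - 1))^-1 + r^-1 = 1)%R.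
  by rewrite invf_div -[X in (_ + X)%R]div1r -mulrDl subrK divff// gt_eqF.
have := @hoelder _ _ _ counting w b (r / (r - 1)) r _ _ rr0 r0 pq.
rewrite Lnorm1 ge0_integral_count// !Lnorm_counting// => h.
rewrite (eq_eseriesr (g := fun k => `|(w k * b k)%:E|)); last first.
  by move=> k _; rewrite gee0_abs// lee_fin mulr_ge0.
apply: le_trans (h _ _) _ => //.
rewrite le_eqVlt; apply/orP; left; apply/eqP; congr (_ `^ _ * _).
by apply: eq_eseriesr => k _ /=; rewrite ger0_norm.
Qed.

End mixed_norms.

(** * Complex-valued functions *)

Section complex_facts.
Context {R : realType}.
Local Notation normc := Normc.normc.
Implicit Types z w : R[i].

Lemma normc_ge0 z : 0 <= normc z.
Proof. by case: z => a b; rewrite /Normc.normc sqrtr_ge0. Qed.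

Lemma normc_real (x : R) : normc (real_complex R x) = `|x|.
Proof. by rewrite /Normc.normc/= expr0n/= addr0 sqrtr_sqr. Qed.

Lemma normc_Re z : `|complex.Re z| <= normc z.
Proof.
case: z => a b; rewrite /Normc.normc/= -sqrtr_sqr ler_wsqrtr// lerDl.
exact: sqr_ge0.
Qed.

Lemma normc_Im z : `|complex.Im z| <= normc z.
Proof.
case: z => a b; rewrite /Normc.normc/= -sqrtr_sqr ler_wsqrtr// lerDr.
exact: sqr_ge0.
Qed.

Lemma ler_normc_sum (I : Type) (r : seq I) (F : I -> R[i]) :
  normc (\sum_(i <- r) F i) <= \sum_(i <- r) normc (F i).
Proof.
elim: r => [|i r ih]; first by rewrite !big_nil Normc.normc0.
by rewrite !big_cons (le_trans (le_normcD _ _))// lerD2l.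
Qed.

Lemma Re_realM (x : R) z : complex.Re (z * real_complex R x) = complex.Re z * x.
Proof. by case: z => a b /=; rewrite mulr0 subr0. Qed.

Lemma Im_realM (x : R) z : complex.Im (z * real_complex R x) = complex.Im z * x.
Proof. by case: z => a b /=; rewrite mulr0 add0r. Qed.

Lemma Re_sum (I : Type) (r : seq I) (F : I -> R[i]) :
  complex.Re (\sum_(i <- r) F i) = \sum_(i <- r) complex.Re (F i).
Proof. exact: raddf_sum. Qed.

Lemma Im_sum (I : Type) (r : seq I) (F : I -> R[i]) :
  complex.Im (\sum_(i <- r) F i) = \sum_(i <- r) complex.Im (F i).
Proof. exact: raddf_sum. Qed.

Lemma real_complexM (x y : R) :
  real_complex R (x * y) = real_complex R x * real_complex R y.
Proof. exact: (rmorphM (real_complex R)). Qed.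

Lemma real_complex_sum (I : Type) (r : seq I) (F : I -> R) :
  real_complex R (\sum_(i <- r) F i) = \sum_(i <- r) real_complex R (F i).
Proof. exact: (rmorph_sum (real_complex R)). Qed.

Lemma complexP z w :
  complex.Re z = complex.Re w -> complex.Im z = complex.Im w -> z = w.
Proof. by case: z => a b; case: w => u v /= -> ->. Qed.

Lemma ReB z w : complex.Re (z - w) = complex.Re z - complex.Re w.
Proof. exact: raddfB. Qed.

Lemma ImB z w : complex.Im (z - w) = complex.Im z - complex.Im w.
Proof. exact: raddfB. Qed.

Lemma cvg_normc (z : nat -> R[i]) w :
  (fun n => complex.Re (z n)) @ \oo --> complex.Re w ->
  (fun n => complex.Im (z n)) @ \oo --> complex.Im w ->
  (fun n => normc (z n)) @ \oo --> normc w.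
Proof.
move=> cRe cIm.
have E v : normc v = Num.sqrt (complex.Re v * complex.Re v + complex.Im v * complex.Im v).
  by case: v => a b; rewrite -!expr2.
rewrite E; under eq_fun do rewrite E.
apply: continuous_cvg; first exact: sqrt_continuous.
by apply: cvgD; apply: cvgM.
Qed.

End complex_facts.

Section complex_measurability.
Context d (T : measurableType d) (R : realType).
Variable m : {measure set T -> \bar R}.
Local Notation normc := Normc.normc.
Implicit Types (f g : T -> R[i]) (D : set T).

Lemma measurable_normc f : cmeasurable f -> measurable_fun [set: T] (fun x => normc (f x)).
Proof.
move=> [mRe mIm].
have -> : (fun x => normc (f x)) =
    Num.sqrt \o (fun x => complex.Re (f x) ^+ 2 + complex.Im (f x) ^+ 2).
  by apply/funext => x /=; case: (f x).
apply: measurableT_comp; first by apply: continuous_measurable_fun; exact: sqrt_continuous.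
by apply: measurable_funD; apply: measurable_funX.
Qed.

Lemma cmeasurableD f g : cmeasurable f -> cmeasurable g -> cmeasurable (fun x => f x + g x).
Proof.
move=> [fr fi] [gr gi]; split.
  under eq_fun do rewrite raddfD; exact: measurable_funD.
under eq_fun do rewrite raddfD; exact: measurable_funD.
Qed.

Lemma cmeasurableB f g : cmeasurable f -> cmeasurable g -> cmeasurable (fun x => f x - g x).
Proof.
move=> [fr fi] [gr gi]; split.
  under eq_fun do rewrite raddfB; exact: measurable_funB.
under eq_fun do rewrite raddfB; exact: measurable_funB.
Qed.

Lemma cmeasurable_cst (c : R[i]) : cmeasurable (fun _ : T => c).
Proof. by split; exact: measurable_cst. Qed.

Lemma cmeasurable_sum (I : Type) (r : seq I) (F : I -> T -> R[i]) :
  (forall i, cmeasurable (F i)) -> cmeasurable (fun x => \sum_(i <- r) F i x).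
Proof.
move=> mF; split.
  by under eq_fun do rewrite Re_sum; apply: measurable_sum => i; case: (mF i).
by under eq_fun do rewrite Im_sum; apply: measurable_sum => i; case: (mF i).
Qed.

Lemma cintegrable_ReIm f D : measurable D -> cmeasurable f ->
  m.-integrable D (fun x => (normc (f x))%:E) ->
  m.-integrable D (fun x => (complex.Re (f x))%:E) /\
  m.-integrable D (fun x => (complex.Im (f x))%:E).
Proof.
move=> mD [mRe mIm] nf; split; apply: le_integrable nf => //.
- exact/measurable_EFinP/measurable_funTS.
- by move=> x _ /=; rewrite lee_fin [leRHS]ger0_norm ?normc_ge0// normc_Re.
- exact/measurable_EFinP/measurable_funTS.
- by move=> x _ /=; rewrite lee_fin [leRHS]ger0_norm ?normc_ge0// normc_Im.
Qed.

Definition cintegral_on D f : R[i] :=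
  Complex (\int[m]_(x in D) complex.Re (f x)) (\int[m]_(x in D) complex.Im (f x)).

(** With z the integral, |z|^2 is the integral of Re z Re f + Im z Im f, which is pointwise at most
    |z||f| by Lagrange's identity; then one divides by |z|. *)
Lemma normc_cintegral_le f D : measurable D -> cmeasurable f ->
  m.-integrable D (fun x => (normc (f x))%:E) ->
  normc (cintegral_on D f) <= \int[m]_(x in D) normc (f x).
Proof.
move=> mD mf nf; have [iRe iIm] := cintegrable_ReIm mD mf nf.
set z := cintegral_on D f.
have [->|z0] := eqVneq (normc z) 0; first by apply: Rintegral_ge0 => x _; exact: normc_ge0.
have {}z0 : 0 < normc z by rewrite lt_neqAle eq_sym z0 normc_ge0.
rewrite -(ler_pM2l z0).
have -> : normc z * normc z =
    \int[m]_(x in D) (complex.Re z * complex.Re (f x) + complex.Im z * complex.Im (f x)).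
  rewrite RintegralD//; [|exact: (integrableZl mD (complex.Re z) iRe)|exact: (integrableZl mD (complex.Im z) iIm)].
  rewrite !RintegralZl// -!expr2 /Normc.normc/= sqr_sqrtr//.
  by rewrite addr_ge0// sqr_ge0.
rewrite -(RintegralZl (normc z) mD nf); apply: le_Rintegral => //.
- apply: (eq_integrable mD (fun x => ((complex.Re z)%:E * (complex.Re (f x))%:E + (complex.Im z)%:E * (complex.Im (f x))%:E)%E)) => //.
  by apply: integrableD => //; exact: integrableZl.
- exact: (integrableZl mD (normc z) nf).
- move=> x _; case: z z0 => a b z0; case: (f x) => u v /=.
  rewrite (le_trans (ler_norm _))// -(@ler_pXn2r _ 2)// ?nnegrE ?mulr_ge0 ?sqrtr_ge0//.
  rewrite exprMn !sqr_sqrtr ?addr_ge0 ?sqr_ge0// real_normK ?num_real//.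
  rewrite -subr_ge0 (_ : _ - _ = (a * v - b * u) ^+ 2) ?sqr_ge0//; ring.
Qed.

End complex_measurability.

(** * Jensen's inequality and integration over finite covers *)

Section integral_facts.
Context d (T : measurableType d) (R : realType).
Variable m : {finite_measure set T -> \bar R}.
Implicit Types (D : set T).

Lemma volE D : measurable D -> m D = (vol m D)%:E.
Proof. by move=> mD; rewrite /vol fineK// fin_num_measure. Qed.

Lemma vol_ge0 D : 0 <= vol m D.
Proof. by rewrite /vol fine_ge0. Qed.

(** The tangent inequality at the mean of g over D, integrated over D. The right side is an extended
    real because g^p may fail to be integrable. *)
Lemma powR_Rintegral_le (g : T -> R) D (p : R) : measurable D -> 1 <= p ->
  (forall x, 0 <= g x) -> m.-integrable D (EFin \o g) ->
  (((\int[m]_(x in D) g x) `^ p)%:E <=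
   (vol m D `^ (p - 1))%:E * \int[m]_(x in D) (g x `^ p)%:E)%E.
Proof.
move=> mD p1 g0 ig; have p0 : 0 < p by apply: lt_le_trans p1.
have mg : measurable_fun D g by apply/measurable_EFinP; exact: measurable_int ig.
have mgp : measurable_fun D (fun x => (g x `^ p)%:E).
  apply/measurable_EFinP.
  exact: (@measurableT_comp _ _ _ _ _ _ (fun x : R => x `^ p)).
set I := \int[m]_(x in D) g x.
have I0 : 0 <= I by apply: Rintegral_ge0.
have igE : (\int[m]_(x in D) (g x)%:E = I%:E)%E by rewrite /I /Rintegral fineK// integrable_fin_num.
have [V0|V0] := eqVneq (vol m D) 0.
  suff -> : I = 0.
    by rewrite powR0 ?gt_eqF// mule_ge0 ?lee_fin ?powR_ge0// integral_ge0// => x _; rewrite lee_fin powR_ge0.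
  have mD0 : m D = 0 by rewrite volE// V0.
  apply: EFin_inj; rewrite -igE; apply: null_set_integral => //.
  exact/measurable_EFinP.
have {}V0 : 0 < vol m D by rewrite lt_neqAle eq_sym V0 vol_ge0.
set mu := I / vol m D; have mu0 : 0 <= mu by rewrite divr_ge0// ltW.
have h : (\int[m]_(x in D) (p * (g x * mu `^ (p - 1)))%:E <=
    \int[m]_(x in D) ((g x `^ p)%:E + ((p - 1) * mu `^ p)%:E))%E.
  apply: ge0_le_integral => //.
  - by move=> x _; rewrite lee_fin !mulr_ge0 ?powR_ge0// ltW.
  - apply/measurable_EFinP; apply: measurable_funM => //; exact: measurable_funM.
  - exact: emeasurable_funD.
  - by move=> x _; rewrite -EFinD lee_fin powR_tangent.
rewrite ge0_integralD// in h; last 2 first.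
  by move=> x _; rewrite lee_fin powR_ge0.
  by move=> x _; rewrite lee_fin mulr_ge0 ?powR_ge0// subr_ge0.
rewrite integral_cst//= in h.
have hl : (\int[m]_(x in D) (p * (g x * mu `^ (p - 1)))%:E = (p * (mu `^ p * vol m D))%:E)%E.
  under eq_integral do rewrite [_ * mu `^ _]mulrC mulrA EFinM.
  rewrite ge0_integralZl_EFin//; last 3 first.
    by move=> x _; rewrite lee_fin.
    exact/measurable_EFinP.
    by rewrite mulr_ge0 ?powR_ge0// ltW.
  rewrite igE -EFinM -(mulr_powRB1 mu0 p0) {2}/mu; congr EFin.
  by field; rewrite gt_eqF.
rewrite hl volE// -EFinM in h.
have -> : I = vol m D * mu by rewrite mulrC divfK ?gt_eqF.
rewrite powRM ?vol_ge0// -(mulr_powRB1 (vol_ge0 D) p0) (mulrC (vol m D)) -mulrA EFinM.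
rewrite lee_wpmul2l ?lee_fin ?powR_ge0//.
move: h; rewrite -leeBlDr// -EFinB; apply: le_trans.
by rewrite lee_fin le_eqVlt; apply/orP; left; apply/eqP; ring.
Qed.

Lemma ge0_integral_cover (D : set T) (F : seq (set T)) (g : T -> \bar R) :
  measurable D -> uniq F -> (forall P, P \in F -> measurable P /\ P `<=` D) ->
  trivIset [set` F] id -> m (D `\` \bigcup_(P in [set` F]) P) = 0 ->
  measurable_fun D g -> (forall x, D x -> 0 <= g x)%E ->
  (\int[m]_(x in D) g x = \sum_(P <- F) \int[m]_(x in P) g x)%E.
Proof.
move=> mD uF FD tF nD mg g0.
(* Replacing the sets outside [F] by the empty set makes the family measurable at every index. *)
pose F' P := if P \in F then P else set0.
have mF' P : measurable (F' P) by rewrite /F'; case: ifPn => // /FD[].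
have UE : \bigcup_(P in [set` F]) P = \big[setU/set0]_(P <- F) F' P.
  rewrite -bigcup_seq; apply: eq_bigcupr => P /= PF; by rewrite /F' PF.
have UD : \big[setU/set0]_(P <- F) F' P `<=` D.
  by rewrite -UE => x [P /= /FD[_ +]]; apply.
rewrite (ge0_negligible_integral (N := D `\` \bigcup_(P in [set` F]) P))//; last first.
  by apply: measurableD => //; rewrite UE; exact: bigsetU_measurable.
rewrite setDD UE (setIidr UD) (@ge0_integral_bigsetU _ _ _ m _ F')//.
- by apply: eq_big_seq => P PF; rewrite /F' PF.
- move=> P Q /= PF QF; rewrite /F' PF QF; exact: tF.
- exact: measurable_funS mg.
- by move=> x /UD; exact: g0.
Qed.

Lemma Rintegral_cover (D : set T) (F : seq (set T)) (f : T -> R) :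
  measurable D -> uniq F -> (forall P, P \in F -> measurable P /\ P `<=` D) ->
  trivIset [set` F] id -> m (D `\` \bigcup_(P in [set` F]) P) = 0 ->
  m.-integrable D (EFin \o f) ->
  \int[m]_(x in D) f x = \sum_(P <- F) \int[m]_(x in P) f x.
Proof.
move=> mD uF FD tF nD fi.
have mf := measurable_int _ fi.
have fiP P : P \in F -> m.-integrable P (EFin \o f).
  by move=> /FD[mP PD]; apply: integrableS fi.
apply: EFin_inj; rewrite /Rintegral fineK; last exact: integrable_fin_num.
rewrite -sumEFin (eq_big_seq (fun P => \int[m]_(x in P) (f x)%:E)%E); last first.
  by move=> P PF; rewrite fineK//; apply: integrable_fin_num; [case: (FD P PF)|exact: fiP].
pose F' P := if P \in F then P else set0.
have mF' P : measurable (F' P) by rewrite /F'; case: ifPn => // /FD[].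
have UE : \bigcup_(P in [set` F]) P = \big[setU/set0]_(P <- F) F' P.
  rewrite -bigcup_seq; apply: eq_bigcupr => P /= PF; by rewrite /F' PF.
have UD : \big[setU/set0]_(P <- F) F' P `<=` D.
  by rewrite -UE => x [P /= /FD[_ +]]; apply.
rewrite (negligible_integral (N := D `\` \bigcup_(P in [set` F]) P))//; last first.
  by apply: measurableD => //; rewrite UE; exact: bigsetU_measurable.
rewrite setDD UE (setIidr UD) (@integral_bigsetU_EFin _ _ _ m _ F')//.
- by apply: eq_big_seq => P PF; rewrite /F' PF.
- move=> P Q /= PF QF; rewrite /F' PF QF; exact: tF.
- exact: measurable_funS mf.
Qed.

End integral_facts.

(** * Norms of nonnegative functions and a Fatou bound *)

Section real_Lp.
Context d (T : measurableType d) (R : realType).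
Variable m : {measure set T -> \bar R}.
Variable p : R.
Hypothesis hp : 1 <= p.
Local Notation "'N[ h ]" := (Lnorm m p%:E (EFin \o h)).
Implicit Types (g h : T -> R).

Let p0 : 0 < p. Proof. exact: lt_le_trans hp. Qed.

Lemma LnormE h : (forall x, 0 <= h x) ->
  'N[h] = ((\int[m]_x (h x `^ p)%:E) `^ p^-1)%E.
Proof.
move=> h0; rewrite unlock; congr (_ `^ _)%E; apply: eq_integral => x _.
by rewrite /= ger0_norm.
Qed.

Lemma measurable_powR_EFin h : measurable_fun setT h ->
  measurable_fun setT (fun x => (h x `^ p)%:E).
Proof.
move=> mh; apply/measurable_EFinP.
exact: (@measurableT_comp _ _ _ _ _ _ (fun x : R => x `^ p)).
Qed.

Lemma le_Lnorm h g : measurable_fun setT h -> measurable_fun setT g ->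
  (forall x, 0 <= h x) -> (forall x, h x <= g x) -> ('N[h] <= 'N[g])%E.
Proof.
move=> mh mg h0 hg; have g0 x : 0 <= g x by apply: le_trans (hg x).
rewrite !LnormE//; apply: le_poweR; first by rewrite invr_ge0 ltW.
  by apply: integral_ge0 => x _; rewrite lee_fin powR_ge0.
apply: ge0_le_integral => //.
- by move=> x _; rewrite lee_fin powR_ge0.
- exact: measurable_powR_EFin.
- exact: measurable_powR_EFin.
- by move=> x _; rewrite lee_fin ge0_ler_powR// ?nnegrE// ltW.
Qed.

Lemma LnormZ_ge0 (B : R) h : 0 <= B -> measurable_fun setT h -> (forall x, 0 <= h x) ->
  ('N[(fun x => B * h x)%R] = B%:E * 'N[h])%E.
Proof.
move=> B0 mh h0; rewrite !LnormE//; last by move=> x; rewrite mulr_ge0.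
under eq_integral do rewrite powRM// EFinM.
rewrite ge0_integralZl_EFin ?powR_ge0//; last 2 first.
- by move=> x _; rewrite lee_fin powR_ge0.
- exact: measurable_powR_EFin.
rewrite poweRM ?lee_fin ?powR_ge0//; last by apply: integral_ge0 => x _; rewrite lee_fin powR_ge0.
by rewrite poweR_EFin -powRrM divff ?gt_eqF// powRr1.
Qed.

End real_Lp.

Section finite_measure_Lp.
Context d (T : measurableType d) (R : realType).
Variable m : {finite_measure set T -> \bar R}.
Local Notation normc := Normc.normc.

(** Since the measure is finite, L^r lies in L^1. Both f in L^beta and f in the Besov space are
    reduced to integrability in this way. *)
Lemma cLp_integrable (r : \bar R) (f : T -> R[i]) : (1 <= r)%E -> cLp m r f ->
  m.-integrable setT (fun x => (normc (f x))%:E).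
Proof.
move=> r1 [mf fr]; have mT : m setT \is a fin_num by exact: fin_num_measure.
apply/(Lfun1_integrable m (fun x => normc (f x))).
apply: (Lfun_subset _ _ mT r1) => //.
by rewrite inE; apply/andP; split; apply: mem_set => //; exact: measurable_normc.
Qed.

Lemma poweR_le_mul (A V r : R) (I : \bar R) : 0 <= A -> 0 <= V -> 0 <= r -> (0 <= I)%E ->
  (A%:E <= V%:E * I -> (A `^ r)%:E <= (V `^ r)%:E * I `^ r)%E.
Proof.
move=> A0 V0 r0 I0 h; rewrite -(poweR_EFin A) -(poweR_EFin V) -poweRM//.
by apply: le_poweR; rewrite ?lee_fin.
Qed.

Lemma cLnormD (p : R) (f g : T -> R[i]) : 1 <= p -> cmeasurable f -> cmeasurable g ->
  (cLnorm m p%:E (fun x => f x + g x)%R <= cLnorm m p%:E f + cLnorm m p%:E g)%E.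
Proof.
move=> p1 mf mg; have nf := measurable_normc mf; have ng := measurable_normc mg.
apply: (le_trans _ (minkowski_EFin m nf ng p1)).
apply: (le_Lnorm m p1) => [||x|x].
- by apply: measurable_normc; exact: cmeasurableD.
- exact: measurable_funD.
- exact: normc_ge0.
- exact: le_normcD.
Qed.

Lemma L1_le_Lnorm (p : R) (g : T -> R) : 1 <= p -> (forall x, 0 <= g x) ->
  m.-integrable setT (EFin \o g) ->
  (\int[m]_x (g x)%:E <= (vol m setT `^ (1 - p^-1))%:E * Lnorm m p%:E (EFin \o g))%E.
Proof.
move=> p1 g0 gi; have p0 : 0 < p by exact: lt_le_trans p1.
have -> : (\int[m]_x (g x)%:E)%E = (\int[m]_x g x)%:E.
  by rewrite /Rintegral fineK//; exact: integrable_fin_num gi.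
have J0 : 0 <= \int[m]_x g x by apply: Rintegral_ge0.
rewrite LnormE//.
have h := powR_Rintegral_le measurableT p1 g0 gi.
rewrite (_ : vol m setT `^ (1 - p^-1) = (vol m setT `^ (p - 1)) `^ p^-1); last first.
  by rewrite -powRrM; congr (_ `^ _); field; rewrite gt_eqF.
have -> : \int[m]_x g x = ((\int[m]_x g x) `^ p) `^ p^-1.
  by rewrite -powRrM divff ?gt_eqF// powRr1.
have I0 : (0 <= \int[m]_x (g x `^ p)%:E)%E.
  by apply: integral_ge0 => x _; rewrite lee_fin powR_ge0.
by apply: poweR_le_mul; rewrite ?powR_ge0// invr_ge0 ltW.
Qed.

(** Almost everywhere [h] is the lower limit of the [g n], so Fatou's lemma applies to it. *)
Lemma fatou_bound (g : nat -> T -> R) (h : T -> R) (C : \bar R) :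
  (forall n, measurable_fun setT (g n)) -> measurable_fun setT h ->
  (forall n x, 0 <= g n x) -> (forall x, 0 <= h x) ->
  {ae m, forall x, g ^~ x @ \oo --> h x} ->
  (forall n, \int[m]_x (g n x)%:E <= C)%E -> (\int[m]_x (h x)%:E <= C)%E.
Proof.
move=> mg mh g0 h0 gh gC.
pose gE n := EFin \o g n.
have mgE n : measurable_fun setT (gE n) by apply/measurable_EFinP.
have gE0 n x : setT x -> (0 <= gE n x)%E by rewrite lee_fin.
have mopp (u : T -> \bar R) : measurable_fun setT u -> measurable_fun setT (fun x => - u x)%E.
  by move=> mu; apply: measurableT_comp mu; exact: oppe_measurable.
have linf (u : nat -> \bar R) D : (forall n, u n <= D)%E -> (limn_einf u <= D)%E.
  move=> uD; rewrite limn_einf_lim; apply: lime_le; first exact: is_cvg_einfs.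
  apply: nearW => n; apply: le_trans (uD n); apply: ereal_inf_lbound.
  by exists n => /=.
apply: (@le_trans _ _ (\int[m]_x limn_einf (gE ^~ x))%E); last first.
  by apply: (le_trans (fatou m measurableT mgE gE0)); exact: linf.
rewrite le_eqVlt; apply/orP; left; apply/eqP; apply: ge0_ae_eq_integral => //.
- by apply/measurable_EFinP.
- by apply: (mopp _ _); apply: measurable_fun_limn_esup => n; exact/mopp/mgE.
- by move=> x _; rewrite lee_fin.
- move=> x _; rewrite limn_einf_lim; apply: lime_ge; first exact: is_cvg_einfs.
  apply: nearW => n; apply: le_ereal_inf_tmp => _ [k _ <-]; exact: gE0.
- apply: filterS gh => x gx _.
  have gx' : gE ^~ x @ \oo --> (h x)%:E by apply: cvg_EFin => //; exact: nearW.
  rewrite is_cvg_limn_einfE; last by apply/cvg_ex; exists (h x)%:E.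
  by apply/esym/cvg_lim.
Qed.

End finite_measure_Lp.

(** * Good grids *)

Section grid_facts.
Context d (T : measurableType d) (R : realType).
Variable m : {finite_measure set T -> \bar R}.
Variables (lam1 lam2 : R) (G : nat -> set (set T)).
Hypothesis hlam : [/\ 0 < lam1, lam1 < lam2 & lam2 < 1].
Hypothesis hG : good_grid m lam1 lam2 G.
Local Notation vol := (vol m).

Definition cells k : seq (set T) := finmap.enum_fset (fset_set (G k)).
Definition child_cells k Q : seq (set T) := finmap.enum_fset (fset_set (children G k Q)).

Lemma lam1_gt0 : 0 < lam1. Proof. by case: hlam. Qed.
Lemma lam2_gt0 : 0 < lam2. Proof. by case: hlam => /lt_trans h /h. Qed.
Lemma lam2_lt1 : lam2 < 1. Proof. by case: hlam. Qed.
Hint Resolve lam1_gt0 lam2_gt0 lam2_lt1 : core.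

Lemma cellsP k Q : reflect (G k Q) (Q \in cells k).
Proof.
rewrite (_ : (Q \in cells k) = (Q \in fset_set (G k)))//.
by rewrite (in_fset_set (grid_finite hG k)); apply: (iffP idP) => [/set_mem|/mem_set].
Qed.

Lemma finite_children k Q : finite_set (children G k Q).
Proof. by apply: sub_finite_set (grid_finite hG k.+1) => P []. Qed.

Lemma child_cellsP k Q P : reflect (G k.+1 P /\ P `<=` Q) (P \in child_cells k Q).
Proof.
rewrite (_ : (P \in child_cells k Q) = (P \in fset_set (children G k Q)))//.
by rewrite (in_fset_set (finite_children k Q)); apply: (iffP idP) => [/set_mem|/mem_set].
Qed.

Lemma cells_uniq k : uniq (cells k). Proof. exact: finmap.fset_uniq. Qed.
Lemma child_cells_uniq k Q : uniq (child_cells k Q). Proof. exact: finmap.fset_uniq. Qed.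

Lemma fsbig_cells (V : nmodType) k (F : set T -> V) :
  \sum_(Q \in G k) F Q = \sum_(Q <- cells k) F Q.
Proof. by rewrite fsbig_finite//; exact: grid_finite hG k. Qed.

Lemma measurable_cell k Q : G k Q -> measurable Q.
Proof. exact: (grid_measurable hG). Qed.

Lemma vol_gt0 k Q : G k Q -> 0 < vol Q.
Proof.
move=> GQ; rewrite -lte_fin -volE ?(grid_pos hG GQ)//.
exact: measurable_cell GQ.
Qed.

Lemma volT_gt0 : 0 < vol setT.
Proof. by apply: (@vol_gt0 0%N); rewrite (grid0 hG). Qed.

Lemma cell_nonempty k Q : G k Q -> Q !=set0.
Proof.
move=> GQ; apply/set0P/eqP => Q0; have := vol_gt0 GQ.
by rewrite Q0 /Defs.vol measure0/= ltxx.
Qed.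

Lemma cell_eq k Q Q' x : G k Q -> G k Q' -> Q x -> Q' x -> Q = Q'.
Proof. by move=> GQ GQ' Qx Q'x; apply: (grid_disj hG GQ GQ'); exists x. Qed.

Lemma cell_ancestor k n P : G (n + k)%N P -> exists2 Q, G k Q & P `<=` Q.
Proof.
elim: n P => [|n ih] P; first by exists P.
rewrite addSn => /(grid_nested hG)[P' /ih[Q GQ P'Q] PP'].
by exists Q => //; exact: subset_trans P'Q.
Qed.

Lemma child_sub k Q P x : G k Q -> G k.+1 P -> Q x -> P x -> P `<=` Q.
Proof.
move=> GQ GP Qx Px; have [Q' GQ' PQ'] := grid_nested hG GP.
by rewrite (cell_eq GQ GQ' Qx (PQ' _ Px)).
Qed.

Lemma cell_sub k n Q P x : G k Q -> G (n + k)%N P -> Q x -> P x -> P `<=` Q.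
Proof.
move=> GQ GP Qx Px; have [Q' GQ' PQ'] := cell_ancestor GP.
by rewrite (cell_eq GQ GQ' Qx (PQ' _ Px)).
Qed.

Lemma child_vol k Q P : G k Q -> G k.+1 P -> P `<=` Q ->
  lam1 * vol Q <= vol P /\ vol P <= lam2 * vol Q.
Proof.
move=> GQ GP PQ; have := grid_ratio hG GQ GP PQ; have Q0 := vol_gt0 GQ.
by rewrite ler_pdivlMr// ler_pdivrMr// => /andP[].
Qed.

Lemma vol_decay k n Q P : G k Q -> G (n + k)%N P -> P `<=` Q ->
  vol P <= lam2 ^+ n * vol Q.
Proof.
move=> GQ; elim: n P => [|n ih] P GP PQ.
  have [x Px] := cell_nonempty GP.
  by rewrite (cell_eq GP GQ Px (PQ _ Px)) mul1r.
have [P' GP' PP'] := grid_nested hG GP.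
have [x Px] := cell_nonempty GP.
have P'Q : P' `<=` Q by apply: (cell_sub GQ GP' (PQ _ Px) (PP' _ Px)).
have [_ /le_trans] := child_vol GP' GP PP'; apply.
by rewrite exprS -mulrA ler_wpM2l ?ih// ltW.
Qed.

(** A cell occurring n levels further down would satisfy |Q| <= lam2^n |Q|, which is impossible for
    n > 0. *)
Lemma cell_level k n Q : G k Q -> G (n + k)%N Q -> n = 0%N.
Proof.
move=> GQ GQ'; have := vol_decay GQ GQ' (fun _ => id).
rewrite -[X in X <= _]mul1r ler_pM2r ?(vol_gt0 GQ)//.
case: n GQ' => // n _; rewrite leNgt exprn_ilt1//; exact: ltW.
Qed.

Lemma parentE k Q P : G k Q -> G k.+1 P -> P `<=` Q -> parent G k P = Q.
Proof.
move=> GQ GP PQ; have [x Px] := cell_nonempty GP.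
rewrite /parent; have /(xgetPex setT) : exists Q, [set Q | G k Q /\ P `<=` Q] Q by exists Q.
by move=> [GQ' PQ']; apply: (cell_eq GQ' GQ (PQ' _ Px) (PQ _ Px)).
Qed.

Lemma cells_trivIset k : trivIset [set` cells k] id.
Proof. by move=> P Q /= /cellsP GP /cellsP GQ; exact: (grid_disj hG GP GQ). Qed.

Lemma child_cells_trivIset k Q : trivIset [set` child_cells k Q] id.
Proof. by move=> P P' /= /child_cellsP[GP _] /child_cellsP[GP' _]; exact: (grid_disj hG GP GP'). Qed.

(** A cell of level k+1 that meets Q is contained in Q. A point of Q outside all children therefore
    lies in no cell of level k+1, hence in a null set. *)
Lemma child_cells_cover k Q : G k Q ->
  m (Q `\` \bigcup_(P in [set` child_cells k Q]) P) = 0.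
Proof.
move=> GQ; apply: (@subset_measure0 _ _ _ m _ (~` \bigcup_(P in G k.+1) P)).
- apply: measurableD; first exact: measurable_cell GQ.
  by apply: fin_bigcup_measurable => // P /= /child_cellsP[/measurable_cell].
- apply: measurableC; apply: fin_bigcup_measurable; first exact: grid_finite hG _.
  by move=> P; exact: measurable_cell.
- move=> x [Qx nx] [P GP Px]; apply: nx; exists P => //=.
  by apply/child_cellsP; split=> //; exact: child_sub GQ GP Qx Px.
- exact: grid_cover hG _.
Qed.

Lemma ge0_integral_cells k (g : T -> \bar R) : measurable_fun setT g ->
  (forall x, 0 <= g x)%E ->
  (\int[m]_x g x = \sum_(Q <- cells k) \int[m]_(x in Q) g x)%E.
Proof.
move=> mg g0; apply: ge0_integral_cover => //.
- exact: cells_uniq.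
- by move=> P /cellsP /measurable_cell.
- exact: cells_trivIset.
- rewrite setTD (_ : \bigcup_(_ in _) _ = \bigcup_(P in G k) P) ?(grid_cover hG k)//.
  by apply: eq_bigcupl; split=> P /= /cellsP.
Qed.

Lemma Rintegral_children k Q (f : T -> R) : G k Q ->
  m.-integrable setT (EFin \o f) ->
  \int[m]_(x in Q) f x = \sum_(P <- child_cells k Q) \int[m]_(x in P) f x.
Proof.
move=> GQ fi; have mQ := measurable_cell GQ; apply: Rintegral_cover => //.
- exact: child_cells_uniq.
- by move=> P /child_cellsP[/measurable_cell].
- exact: child_cells_trivIset.
- exact: child_cells_cover.
- by apply: integrableS fi.
Qed.

Lemma vol_children k Q : G k Q -> vol Q = \sum_(P <- child_cells k Q) vol P.
Proof.
move=> GQ; have := Rintegral_children GQ (finite_measure_integrable_cst m 1 measurableT).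
rewrite Rintegral_cst ?mul1r; last exact: measurable_cell GQ.
rewrite /Defs.vol => ->; apply: eq_big_seq => P /child_cellsP[GP _].
by rewrite Rintegral_cst ?mul1r//; exact: measurable_cell GP.
Qed.

(** A single child would have the full volume of Q, against lam2 < 1. This makes the splitting of
    the children of a cell legitimate. *)
Lemma size_child_cells k Q : G k Q -> (1 < size (child_cells k Q))%N.
Proof.
move=> GQ; have := vol_children GQ; have Q0 := vol_gt0 GQ.
case E : (child_cells k Q) => [|P [|P' s]]//=.
  by rewrite big_nil => Q_eq0; rewrite Q_eq0 ltxx in Q0.
have /child_cellsP[GP PQ] : P \in child_cells k Q by rewrite E mem_head.
have [_] := child_vol GQ GP PQ; rewrite big_seq1 => + QP.
by rewrite -QP -subr_le0 -{1}[vol Q]mul1r -mulrBl leNgt mulr_gt0// subr_gt0.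
Qed.

Lemma sum_child_cells (V : nmodType) k (F : set T -> V) :
  \sum_(P <- cells k.+1) F P = \sum_(Q <- cells k) \sum_(P <- child_cells k Q) F P.
Proof.
have sumP P : P \in cells k.+1 ->
    F P = \sum_(Q <- cells k) if `[< P `<=` Q >] then F P else 0.
  move=> /cellsP GP; have [Q GQ PQ] := grid_nested hG GP.
  rewrite (bigD1_seq Q) ?cells_uniq//=; last exact/cellsP.
  rewrite asboolT// big1_seq ?addr0// => Q' /andP[Q'Q /cellsP GQ'].
  rewrite asboolF// => PQ'; have [x Px] := cell_nonempty GP.
  by move: Q'Q; rewrite (cell_eq GQ' GQ (PQ' _ Px) (PQ _ Px)) eqxx.
rewrite (eq_big_seq _ sumP) exchange_big/=; apply: eq_big_seq => Q /cellsP GQ.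
rewrite -big_mkcond -big_filter; apply: perm_big; apply: uniq_perm.
- exact/filter_uniq/cells_uniq.
- exact: child_cells_uniq.
- move=> P; rewrite mem_filter; apply/andP/child_cellsP => [[/asboolP PQ /cellsP GP]//|[GP PQ]].
  by split; [exact/asboolP|exact/cellsP].
Qed.

Lemma cells_nonempty k : exists Q, G k Q.
Proof.
apply: contrapT => nG; have : m setT = 0.
  rewrite -(grid_cover hG k); congr (m _); rewrite bigcup0 ?setC0// => Q GQ.
  by case: nG; exists Q.
by move=> mT0; have := volT_gt0; rewrite /Defs.vol mT0 ltxx.
Qed.

Lemma vol_le_mesh k Q : G k Q -> vol Q <= mesh m G k.
Proof.
move=> GQ; rewrite /mesh; apply: ub_le_sup; last by exists Q.
exists (vol setT) => _ [P GP <-]; rewrite /Defs.vol fine_le ?fin_num_measure//.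
all: try exact: measurable_cell GP.
by rewrite le_measure// mem_set//; exact: measurable_cell GP.
Qed.

Lemma mesh_ge0 k : 0 <= mesh m G k.
Proof.
by have [Q GQ] := cells_nonempty k; apply: le_trans (vol_le_mesh GQ); exact: vol_ge0.
Qed.

Lemma mesh_le k : mesh m G k <= lam2 ^+ k * vol setT.
Proof.
have GT : G 0%N setT by rewrite (grid0 hG).
have [Q GQ] := cells_nonempty k; apply: ge_sup; first by exists (vol Q), Q.
move=> _ [P GP <-]; apply: (vol_decay GT) => //.
by rewrite addn0.
Qed.

End grid_facts.

(** * The Haar pairs of a finite family of sets *)

Section haar_tree.
Context d (T : measurableType d) (R : realType).
Variable m : {finite_measure set T -> \bar R}.
Variable ord : set (set T) -> seq (set T).
Local Notation family := (set (set T)).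
Local Notation mass := (mass m).
Local Notation vol := (vol m).

(** The content of [orderings] for the children of one cell, so that the tree of pairs can be
    studied without the grid. *)
Definition enumerated (Om : family) : Prop :=
  forall A : family, A `<=` Om -> uniq (ord A) /\ [set` ord A] = A.

Definition haar_tree (A : family) : set (family * family) :=
  \bigcup_j haar_level ord A j.

(* Families with fewer than two elements are not split in the construction, whereas
   [halves] would give them an empty side. *)
Definition haar_subtree (A : family) : set (family * family) :=
  if (2 <= size (ord A))%N then haar_tree A else set0.

(** [haar_level] grows the tree at its leaves. Decomposing it at the root instead gives a recursion
    on the two halves, on which all later inductions rest. *)
Lemma haar_treeE A : haar_tree A =
  halves ord A |` (haar_subtree (halves ord A).1 `|` haar_subtree (halves ord A).2).
Proof.
have levelS j : haar_level ord A j.+1 =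
    (if (2 <= size (ord (halves ord A).1))%N then haar_level ord (halves ord A).1 j else set0) `|`
    (if (2 <= size (ord (halves ord A).2))%N then haar_level ord (halves ord A).2 j else set0).
  elim: j => [|j ih].
    apply/seteqP; split => S /=.
      by move=> [_ ->] [[h ->]|[h ->]]; [left|right]; rewrite h.
    move=> [|]; case: ifPn => //= h ->; exists (halves ord A) => //; [by left|by right].
  have E B i : haar_level ord B i.+1 = [set S' | exists2 S, haar_level ord B i S &
      (2 <= size (ord S.1))%N /\ S' = halves ord S.1 \/
      (2 <= size (ord S.2))%N /\ S' = halves ord S.2] by [].
  rewrite E ih; apply/seteqP; split => S.
    by move=> [S' [|]]; case: ifPn => // h h1 h2; [left|right]; rewrite ?h E; exists S'.
  by move=> [|]; case: ifPn => // h [S' h1 h2]; exists S' => //; [left|right]; rewrite ?h.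
apply/seteqP; split => S.
  move=> [[|j] _]; first by left.
  rewrite levelS => -[|]; case: ifPn => // h hS; right; [left|right]; rewrite /haar_subtree h; exists j => //.
move=> [->|[|]]; first by exists 0%N.
all: rewrite /haar_subtree; case: ifPn => // h [j _ hj]; exists j.+1 => //; rewrite levelS.
all: by [left; rewrite h|right; rewrite h].
Qed.

Section enumerated_family.
Variable Om : family.
Hypothesis eOm : enumerated Om.

Lemma mem_ord A P : A `<=` Om -> (P \in ord A) = (P \in A).
Proof.
move=> AOm; have [_ E] := eOm AOm.
by apply/idP/idP => [h|/set_mem]; [apply: mem_set; rewrite -E|rewrite -{1}E].
Qed.

Lemma ord_finite A : A `<=` Om -> finite_set A.
Proof. by move=> /eOm[_ <-]; exact: finite_seq. Qed.

Lemma fsbig_ord (V : nmodType) A (F : set T -> V) : A `<=` Om ->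
  \sum_(P \in A) F P = \sum_(P <- ord A) F P.
Proof. by move=> /eOm[uA EA]; rewrite [RHS]fsbig_seq//; apply: eq_fsbigl; exact: esym EA. Qed.

Lemma halves_facts A (S := halves ord A) : A `<=` Om -> (2 <= size (ord A))%N ->
  [/\ S.1 `|` S.2 = A, S.1 `&` S.2 = set0,
      (0 < size (ord S.1))%N /\ (0 < size (ord S.2))%N,
      size (ord S.1) = (size (ord A))./2 /\ size (ord S.2) = uphalf (size (ord A)) &
      S.1 `<=` Om /\ S.2 `<=` Om].
Proof.
move=> AOm sA; have [uA EA] := eOm AOm.
set n := (size (ord A))./2.
have S1 : S.1 = [set` take n (ord A)] by [].
have S2 : S.2 = [set` drop n (ord A)] by [].
have SU : S.1 `|` S.2 = A.
  rewrite S1 S2 -[RHS]EA -[in RHS](cat_take_drop n (ord A)).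
  apply/seteqP; split=> P /=; rewrite mem_cat; last by move/orP.
  by move=> [->//|->]; rewrite orbT.
have S1Om : S.1 `<=` Om by apply: subset_trans AOm; rewrite -SU; exact: subsetUl.
have S2Om : S.2 `<=` Om by apply: subset_trans AOm; rewrite -SU; exact: subsetUr.
(* The enumeration [ord] of a half may order it differently from the list that defines the half;
   only the lengths agree. *)
have size_set A' (l : seq (set T)) : A' `<=` Om -> uniq l -> A' = [set` l] -> size (ord A') = size l.
  move=> A'Om ul El; apply/eqP; rewrite -uniq_size_uniq//; first by case: (eOm A'Om).
  by move=> P; rewrite mem_ord// El; apply/idP/idP => [|/set_mem]//; move=> h; apply: mem_set.
have sz1 : size (ord S.1) = n.
  rewrite (size_set _ (take n (ord A)))// ?take_uniq// size_take /n.
  by case: ltnP => //; lia.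
have sz2 : size (ord S.2) = uphalf (size (ord A)).
  by rewrite (size_set _ (drop n (ord A)))// ?drop_uniq// size_drop /n; lia.
split=> //.
- rewrite S1 S2; apply/seteqP; split => // P /= [P1 P2].
  move: uA; rewrite -(cat_take_drop n (ord A)) cat_uniq => /and3P[_ /hasPn/(_ P P2)].
  by rewrite /= P1.
- by rewrite sz1 sz2 /n; lia.
Qed.

Lemma haar_tree_sub A S : A `<=` Om -> (2 <= size (ord A))%N -> haar_tree A S ->
  [/\ S.1 `<=` A, S.2 `<=` A, S.1 `&` S.2 = set0, S.1 !=set0 & S.2 !=set0].
Proof.
have [n] := ubnP (size (ord A)); elim: n A => // n ih A.
rewrite ltnS => sn AOm sA.
have [SU Sdis [S1 S2] [z1 z2] [B1 B2]] := halves_facts AOm sA.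
rewrite haar_treeE => -[->|[|]].
- split=> //.
  + by rewrite -[X in _ `<=` X]SU; exact: subsetUl.
  + by rewrite -[X in _ `<=` X]SU; exact: subsetUr.
  + case E : (ord (halves ord A).1) S1 => [//|P s] _; exists P.
    by apply: set_mem; rewrite -mem_ord// E mem_head.
  + case E : (ord (halves ord A).2) S2 => [//|P s] _; exists P.
    by apply: set_mem; rewrite -mem_ord// E mem_head.
- rewrite /haar_subtree; case: ifPn => // s1 /(ih _ _ B1 s1)[]; first by lia.
  move=> a b c e f; split=> //.
    by apply: subset_trans a _; rewrite -[X in _ `<=` X]SU; exact: subsetUl.
  by apply: subset_trans b _; rewrite -[X in _ `<=` X]SU; exact: subsetUl.
- rewrite /haar_subtree; case: ifPn => // s1 /(ih _ _ B2 s1)[]; first by lia.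
  move=> a b c e f; split=> //.
    by apply: subset_trans a _; rewrite -[X in _ `<=` X]SU; exact: subsetUr.
  by apply: subset_trans b _; rewrite -[X in _ `<=` X]SU; exact: subsetUr.
Qed.

Lemma haar_subtree_sub A S : A `<=` Om -> haar_subtree A S ->
  [/\ S.1 `<=` A, S.2 `<=` A, S.1 `&` S.2 = set0, S.1 !=set0 & S.2 !=set0].
Proof. by move=> AOm; rewrite /haar_subtree; case: ifPn => // sA; exact: haar_tree_sub. Qed.

Lemma haar_subtree_finite A : A `<=` Om -> finite_set (haar_subtree A).
Proof.
have [n] := ubnP (size (ord A)); elim: n A => // n ih A.
rewrite ltnS => sn AOm; rewrite /haar_subtree; case: ifPn => // sA.
have [SU Sdis [S1 S2] [z1 z2] [B1 B2]] := halves_facts AOm sA.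
rewrite haar_treeE !finite_setU; split; first exact: finite_set1.
by split; apply: ih => //; lia.
Qed.

(** The three pieces are disjoint: a pair from one subtree has both its sides, which are nonempty,
    in the corresponding half, whereas the root pair reaches into both halves. *)
Lemma haar_subtree_sum (V : nmodType) A (F : family * family -> V) :
  A `<=` Om -> (2 <= size (ord A))%N ->
  \sum_(S \in haar_subtree A) F S = F (halves ord A) +
    (\sum_(S \in haar_subtree (halves ord A).1) F S +
     \sum_(S \in haar_subtree (halves ord A).2) F S).
Proof.
move=> AOm sA; have [SU Sdis [S1 S2] [z1 z2] [B1 B2]] := halves_facts AOm sA.
have f1 := haar_subtree_finite B1; have f2 := haar_subtree_finite B2.
rewrite {1}/haar_subtree sA haar_treeE fsbigU0.
- rewrite fsbig_set1 fsbigU0// => S [/(haar_subtree_sub B1)[a _ _ [P SP] _]].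
  move=> /(haar_subtree_sub B2)[b _ _ _ _].
  suff : set0 P by []. by rewrite -Sdis; split; [exact: a|exact: b].
- exact: finite_set1.
- by rewrite finite_setU.
- have [h1 h2 _ [P1 hP1] [P2 hP2]] :
    [/\ (halves ord A).1 `<=` A, (halves ord A).2 `<=` A, (halves ord A).1 `&` (halves ord A).2 = set0,
      (halves ord A).1 !=set0 & (halves ord A).2 !=set0].
    by apply: haar_tree_sub => //; rewrite haar_treeE; left.
  move=> _ [-> [/(haar_subtree_sub B1)[_ b _ _ _]|/(haar_subtree_sub B2)[a _ _ _ _]]].
    suff : set0 P2 by []. by rewrite -Sdis; split => //; exact: b.
  suff : set0 P1 by []. by rewrite -Sdis; split => //; exact: a.
Qed.


(** The constant value of phi_S on the child P, as a function of the cell instead of the point; it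
    is 0 when P is on neither side of S. *)
Definition haar_val (S : family * family) (P : set T) : R :=
  (Num.sqrt ((mass S.1)^-1 + (mass S.2)^-1))^-1 *
  ((P \in S.1)%:R / mass S.1 - (P \in S.2)%:R / mass S.2).

Section haar_estimates.
Hypothesis Om_vol : forall P, Om P -> 0 < vol P.

Lemma mass_ord A : A `<=` Om -> mass A = \sum_(P <- ord A) vol P.
Proof. exact: fsbig_ord. Qed.

Lemma mass_ge_vol A P : A `<=` Om -> A P -> vol P <= mass A.
Proof.
move=> AOm AP; rewrite mass_ord//.
have PA : P \in ord A by rewrite mem_ord//; exact: mem_set.
rewrite (big_rem P)//= lerDl big_seq sumr_ge0// => Q /mem_rem.
by rewrite mem_ord// => /set_mem /AOm /Om_vol /ltW.
Qed.

Lemma mass_gt0 A : A `<=` Om -> A !=set0 -> 0 < mass A.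
Proof. by move=> AOm [P AP]; apply: lt_le_trans (mass_ge_vol AOm AP); exact/Om_vol/AOm. Qed.

Lemma mass_setU A B : A `<=` Om -> B `<=` Om -> A `&` B = set0 ->
  mass (A `|` B) = mass A + mass B.
Proof.
move=> AOm BOm AB0; rewrite /Defs.mass fsbigU0//; try exact: ord_finite.
by rewrite AB0.
Qed.

Lemma haar_val_notin S P : ~ S.1 P -> ~ S.2 P -> haar_val S P = 0.
Proof. by move=> h1 h2; rewrite /haar_val !memNset// !mul0r subr0 mulr0. Qed.

Lemma haar_val_l S P : S.1 `&` S.2 = set0 -> S.1 P ->
  haar_val S P = (Num.sqrt ((mass S.1)^-1 + (mass S.2)^-1))^-1 / mass S.1.
Proof.
move=> d0 SP; rewrite /haar_val mem_set// memNset; last first.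
  by move=> h; suff : set0 P by []; rewrite -d0.
by rewrite mul0r subr0 mul1r.
Qed.

Lemma haar_val_r S P : S.1 `&` S.2 = set0 -> S.2 P ->
  haar_val S P = - ((Num.sqrt ((mass S.1)^-1 + (mass S.2)^-1))^-1 / mass S.2).
Proof.
move=> d0 SP; rewrite /haar_val [P \in S.2]mem_set// memNset; last first.
  by move=> h; suff : set0 P by []; rewrite -d0.
by rewrite mul0r sub0r mul1r mulrN.
Qed.

(* [|phi_S| = sqrt (1/a - 1/(a+b))] on the side of mass [a]; the AM-GM bound
   below telescopes along the nested families containing [P]. *)
Lemma haar_val_bound (a b c : R) : 0 < a -> 0 < b -> 0 < c ->
  (Num.sqrt (a^-1 + b^-1))^-1 / a <= c / 2 * (a^-1 - (a + b)^-1) + (c * 2)^-1.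
Proof.
move=> a0 b0 c0; have ab0 : 0 < a + b by rewrite addr_gt0.
have h0 : 0 < a^-1 - (a + b)^-1.
  rewrite (_ : _ - _ = b / (a * (a + b))); first by rewrite divr_gt0// mulr_gt0.
  by field; rewrite !gt_eqF.
have -> : (Num.sqrt (a^-1 + b^-1))^-1 / a = Num.sqrt (a^-1 - (a + b)^-1).
  apply/eqP; rewrite -(@eqrXn2 _ 2)//; last 1 first.
  - by rewrite mulr_ge0 ?invr_ge0 ?sqrtr_ge0// ltW.
  rewrite exprMn exprVn !sqr_sqrtr ?ltW// ?addr_gt0 ?invr_gt0//.
  by apply/eqP; field; rewrite !gt_eqF.
set z := _ - _ in h0 *; have z2 : z = Num.sqrt z ^+ 2 by rewrite sqr_sqrtr// ltW.
rewrite {2}z2 -subr_ge0.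
rewrite (_ : _ - _ = (c * Num.sqrt z - 1) ^+ 2 / (c * 2)).
  by rewrite divr_ge0 ?sqr_ge0// mulr_ge0// ltW.
by field; rewrite gt_eqF.
Qed.

Lemma haar_subtree_notin A P : A `<=` Om -> ~ A P -> forall S, haar_subtree A S ->
  haar_val S P = 0.
Proof.
move=> AOm nAP S /(haar_subtree_sub AOm)[a b _ _ _].
by apply: haar_val_notin => [/a|/b].
Qed.

(* [D] is the number of splittings that separate [P] from the rest of [A]; as each one
   halves the family, [2 D <= #A + 1], which is what produces the constant [C_H]. *)
Lemma haar_val_sum_le (c : R) A P : 0 < c -> A `<=` Om -> A P -> exists D : nat,
  [/\ (D < size (ord A))%N, (D.*2 <= (size (ord A)).+1)%N &
   \sum_(S \in haar_subtree A) `|haar_val S P| <=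
     c / 2 * ((vol P)^-1 - (mass A)^-1) + D%:R / (c * 2)].
Proof.
move=> c0; have [n] := ubnP (size (ord A)); elim: n A => // n ih A.
rewrite ltnS => sn AOm AP.
have sA0 : (0 < size (ord A))%N.
  by rewrite -has_predT; apply/hasP; exists P => //; rewrite mem_ord//; exact: mem_set.
have vP0 : 0 < vol P by exact/Om_vol/AOm.
have [sA|sA] := leqP 2 (size (ord A)); last first.
  (* Here A = {P}: nothing is split, and the telescoped difference of reciprocal masses is 0. *)
  exists 0%N; split=> //; rewrite /haar_subtree leqNgt sA/= fsbig_set0 mul0r addr0.
  have -> : A = [set P].
    case E : (ord A) sA sA0 => [//|P' [|//]] _ _.
    have memA P2 : A P2 -> P2 = P'.
      by move=> /mem_set; rewrite -(mem_ord _ AOm) E mem_seq1 => /eqP.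
    by apply/seteqP; split=> P2 /=; [move=> /memA ->; rewrite (memA _ AP)|move=> ->].
  by rewrite /Defs.mass fsbig_set1 subrr mulr0.
have [SU Sdis [S1 S2] [z1 z2] [B1 B2]] := halves_facts AOm sA.
rewrite (haar_subtree_sum _ AOm sA).
set H := halves ord A in SU Sdis S1 S2 z1 z2 B1 B2 *.
have [h1 h2 _ n1 n2] : [/\ H.1 `<=` A, H.2 `<=` A, H.1 `&` H.2 = set0, H.1 !=set0 & H.2 !=set0].
  by apply: haar_tree_sub => //; rewrite haar_treeE; left.
have m1 := mass_gt0 B1 n1; have m2 := mass_gt0 B2 n2.
have mA : mass A = mass H.1 + mass H.2 by rewrite -SU mass_setU.
have [H1P|H2P] : H.1 P \/ H.2 P by move: AP; rewrite -{1}SU.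
- have nH2P : ~ H.2 P by move=> h; suff : set0 P by []; rewrite -Sdis.
  rewrite [X in _ + (_ + X)]fsbig1 ?addr0; last first.
    by move=> S hS; rewrite (haar_subtree_notin B2 nH2P hS) normr0.
  have [] := ih _ _ B1 H1P; first by lia.
  move=> D [D1 D2 le1]; exists D.+1; split; [lia|lia|].
  have leH : `|haar_val H P| <=
      c / 2 * ((mass H.1)^-1 - (mass H.1 + mass H.2)^-1) + (c * 2)^-1.
    rewrite haar_val_l// ger0_norm; last by rewrite divr_ge0 ?invr_ge0 ?sqrtr_ge0// ltW.
    exact: (haar_val_bound m1 m2 c0).
  apply: le_trans (lerD leH le1) _.
  rewrite mA -natr1 le_eqVlt; apply/orP; left; apply/eqP; field.
  by rewrite !gt_eqF// addr_gt0.
- have nH1P : ~ H.1 P by move=> h; suff : set0 P by []; rewrite -Sdis.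
  rewrite [X in _ + (X + _)]fsbig1 ?add0r; last first.
    by move=> S hS; rewrite (haar_subtree_notin B1 nH1P hS) normr0.
  have [] := ih _ _ B2 H2P; first by lia.
  move=> D [D1 D2 le1]; exists D.+1; split; [lia|lia|].
  have leH : `|haar_val H P| <=
      c / 2 * ((mass H.2)^-1 - (mass H.2 + mass H.1)^-1) + (c * 2)^-1.
    rewrite haar_val_r// normrN ger0_norm; last by rewrite divr_ge0 ?invr_ge0 ?sqrtr_ge0// ltW.
    by rewrite [_^-1 + _]addrC; exact: (haar_val_bound m2 m1 c0).
  apply: le_trans (lerD leH le1) _.
  rewrite mA -natr1 le_eqVlt; apply/orP; left; apply/eqP; field.
  by rewrite !gt_eqF// addr_gt0.
Qed.

Lemma big_ord_mem (V : nmodType) A B (F : set T -> V) : A `<=` B -> B `<=` Om ->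
  \sum_(P <- ord B | P \in A) F P = \sum_(P <- ord A) F P.
Proof.
move=> AB BOm; rewrite -big_filter; apply: perm_big; apply: uniq_perm.
- by apply: filter_uniq; case: (eOm BOm).
- by case: (eOm (subset_trans AB BOm)).
- move=> P; rewrite mem_filter !mem_ord//; last exact: subset_trans BOm.
  by apply/andP/idP => [[]//|PA]; split=> //; apply: mem_set; apply: AB; exact: set_mem.
Qed.

Lemma sum_two_sides A (S : family * family) (I : set T -> R) (a b : R) :
  A `<=` Om -> S.1 `<=` A -> S.2 `<=` A ->
  \sum_(P <- ord A) I P * (a * (P \in S.1)%:R + b * (P \in S.2)%:R) =
  a * (\sum_(P <- ord S.1) I P) + b * (\sum_(P <- ord S.2) I P).
Proof.
move=> AOm S1 S2; rewrite -(big_ord_mem I S1 AOm) -(big_ord_mem I S2 AOm).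
rewrite [in RHS]big_mkcond/= [X in _ + _ * X]big_mkcond/=.
rewrite !mulr_sumr -big_split/=; apply: eq_bigr => P _.
by case: (P \in S.1); case: (P \in S.2); rewrite /=; ring.
Qed.

Local Notation weight S := ((Num.sqrt ((mass S.1)^-1 + (mass S.2)^-1))^-1).

Lemma sum_haar_val A S (I : set T -> R) : A `<=` Om -> S.1 `<=` A -> S.2 `<=` A ->
  \sum_(P <- ord A) I P * haar_val S P =
  weight S * ((\sum_(P <- ord S.1) I P) / mass S.1 - (\sum_(P <- ord S.2) I P) / mass S.2).
Proof.
move=> AOm S1 S2.
transitivity (\sum_(P <- ord A) I P * (weight S / mass S.1 * (P \in S.1)%:R +
    (- (weight S / mass S.2)) * (P \in S.2)%:R)).
  by apply: eq_bigr => P _; rewrite /haar_val; ring.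
by rewrite sum_two_sides//; ring.
Qed.

(** The integral of |phi_S| equals 2 / (1/a + 1/b)^(1/2), with a and b the masses of the sides.
    Since 4 <= (a + b)(1/a + 1/b), it is at most (a + b)^(1/2). *)
Lemma sum_abs_haar_val A S : A `<=` Om -> S.1 `<=` A -> S.2 `<=` A ->
  S.1 `&` S.2 = set0 -> S.1 !=set0 -> S.2 !=set0 ->
  \sum_(P <- ord A) vol P * `|haar_val S P| <= Num.sqrt (mass A).
Proof.
move=> AOm S1 S2 d0 n1 n2.
have S1O := subset_trans S1 AOm; have S2O := subset_trans S2 AOm.
have m1 := mass_gt0 S1O n1; have m2 := mass_gt0 S2O n2.
have s0 : 0 < Num.sqrt ((mass S.1)^-1 + (mass S.2)^-1).
  by rewrite sqrtr_gt0 addr_gt0// invr_gt0.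
apply: (@le_trans _ _ (\sum_(P <- ord A) vol P * (weight S / mass S.1 * (P \in S.1)%:R +
    weight S / mass S.2 * (P \in S.2)%:R))).
  apply: ler_sum => P _; rewrite ler_wpM2l ?vol_ge0// /haar_val normrM ger0_norm; last first.
    by rewrite invr_ge0 ltW.
  rewrite -!mulrA -mulrDr ler_wpM2l ?invr_ge0 ?(ltW s0)//.
  rewrite (le_trans (ler_normB _ _))// !normrM !normr_nat !normfV !gtr0_norm//.
  by rewrite [X in X + _ <= _]mulrC [X in _ + X <= _]mulrC.
rewrite sum_two_sides// -!mass_ord// !divfK ?gt_eqF//.
rewrite -mulr2n -mulr_natl -ler_pdivlMr ?invr_gt0// invrK -sqrtrM; last first.
  by rewrite (mass_ord AOm) sumr_ge0// => P _; exact: vol_ge0.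
rewrite -[X in X <= _](@ger0_norm _ 2)// -sqrtr_sqr ler_wsqrtr//.
apply: (@le_trans _ _ ((mass S.1 + mass S.2) * ((mass S.1)^-1 + (mass S.2)^-1))).
  rewrite -subr_ge0 (_ : _ - _ = (mass S.1 - mass S.2) ^+ 2 / (mass S.1 * mass S.2)).
    by rewrite divr_ge0 ?sqr_ge0// mulr_ge0// ltW.
  by field; rewrite !gt_eqF.
rewrite ler_wpM2r ?addr_ge0 ?invr_ge0 ?(ltW m1) ?(ltW m2)//.
rewrite -mass_setU// mass_ord; last by apply: subset_trans AOm => P [/S1|/S2].
rewrite -(@big_ord_mem _ _ A)// ?mass_ord//; last by move=> P [/S1|/S2].
rewrite [leRHS](bigID (mem (S.1 `|` S.2)))/= lerDl sumr_ge0// => P _.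
exact: vol_ge0.
Qed.

(** [I] stands for the integrals of f over the cells. As m_S^(-2) = ab/(a + b), the root pair
    contributes the average over the half containing P minus the average over A. The other half does
    not see P, and the induction continues in the half of P. *)
Lemma haar_reconstruction (I : set T -> R) A P : A `<=` Om -> A P ->
  \sum_(S \in haar_subtree A) (\sum_(Q <- ord Om) I Q * haar_val S Q) * haar_val S P =
  I P / vol P - (\sum_(Q <- ord A) I Q) / mass A.
Proof.
have [n] := ubnP (size (ord A)); elim: n A => // n ih A.
rewrite ltnS => sn AOm AP.
have sA0 : (0 < size (ord A))%N.
  by rewrite -has_predT; apply/hasP; exists P => //; rewrite mem_ord//; exact: mem_set.
have vP0 : 0 < vol P by exact/Om_vol/AOm.
have [sA|sA] := leqP 2 (size (ord A)); last first.
  rewrite /haar_subtree leqNgt sA/= fsbig_set0 mass_ord//.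
  case E : (ord A) sA sA0 => [//|P' [|//]] _ _.
  have -> : P' = P by move: (mem_set AP); rewrite -(mem_ord _ AOm) E mem_seq1 => /eqP.
  by rewrite !big_seq1 subrr.
have [SU Sdis [S1 S2] [z1 z2] [B1 B2]] := halves_facts AOm sA.
rewrite (haar_subtree_sum _ AOm sA).
set H := halves ord A in SU Sdis S1 S2 z1 z2 B1 B2 *.
have [h1 h2 _ n1 n2] : [/\ H.1 `<=` A, H.2 `<=` A, H.1 `&` H.2 = set0, H.1 !=set0 & H.2 !=set0].
  by apply: haar_tree_sub => //; rewrite haar_treeE; left.
have m1 := mass_gt0 B1 n1; have m2 := mass_gt0 B2 n2.
have mA : mass A = mass H.1 + mass H.2 by rewrite -SU mass_setU.
have w2 : weight H * weight H = ((mass H.1)^-1 + (mass H.2)^-1)^-1.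
  by rewrite -expr2 exprVn sqr_sqrtr// addr_ge0 ?invr_ge0 ?(ltW m1) ?(ltW m2).
have IA : \sum_(Q <- ord A) I Q = \sum_(Q <- ord H.1) I Q + \sum_(Q <- ord H.2) I Q.
  by rewrite -!fsbig_ord// -{1}SU fsbigU0//; [exact: ord_finite|exact: ord_finite|rewrite Sdis].
rewrite IA mA sum_haar_val//.
set I1 := \sum_(Q <- ord H.1) I Q in ih *; set I2 := \sum_(Q <- ord H.2) I Q in ih *.
have [H1P|H2P] : H.1 P \/ H.2 P by move: AP; rewrite -{1}SU.
- have nH2P : ~ H.2 P by move=> h; suff : set0 P by []; rewrite -Sdis.
  rewrite [X in _ + (_ + X)]fsbig1 ?addr0; last first.
    by move=> S hS; rewrite (haar_subtree_notin B2 nH2P hS) mulr0.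
  rewrite (ih _ _ B1 H1P); last by lia.
  rewrite haar_val_l// -/I1.
  rewrite (_ : weight H * _ * _ = weight H * weight H * (I1 / mass H.1 - I2 / mass H.2) / mass H.1); last by ring.
  by rewrite w2; field; rewrite !gt_eqF// ?addr_gt0.
- have nH1P : ~ H.1 P by move=> h; suff : set0 P by []; rewrite -Sdis.
  rewrite [X in _ + (X + _)]fsbig1 ?add0r; last first.
    by move=> S hS; rewrite (haar_subtree_notin B1 nH1P hS) mulr0.
  rewrite (ih _ _ B2 H2P); last by lia.
  rewrite haar_val_r// -/I2.
  rewrite (_ : weight H * _ * _ = - (weight H * weight H * (I1 / mass H.1 - I2 / mass H.2) / mass H.2)); last by ring.
  by rewrite w2; field; rewrite !gt_eqF// ?addr_gt0.
Qed.

(** [haar_val_sum_le] with c = (|Q|/2)^(1/2) gives the bound 1 / (sqrt 2 lam1 |Q|^(1/2)), where |Q|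
    is the mass of [Om]. Because lam1 < lam2, the factor 1 / (sqrt 2 lam1) is at most the first
    summand of [C_H]. *)
Lemma haar_sum_C_H (lam1 lam2 : R) P : 0 < lam1 -> lam1 < lam2 -> Om P ->
  (forall Q, Om Q -> lam1 * mass Om <= vol Q) ->
  \sum_(S \in haar_subtree Om) `|haar_val S P| <= C_H lam1 lam2 / Num.sqrt (mass Om).
Proof.
move=> l10 l12 OmP lOm; have M0 : 0 < mass Om by apply: mass_gt0 => //; exists P.
set M := mass Om in M0 lOm *; set r := Num.sqrt M; have r0 : 0 < r by rewrite sqrtr_gt0.
have r2 : M = r ^+ 2 by rewrite sqr_sqrtr// ltW.
set t : R := Num.sqrt 2; have t0 : 0 < t by rewrite sqrtr_gt0.
have t2 : t ^+ 2 = 2 by rewrite sqr_sqrtr.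
have vP0 : 0 < vol P by exact: Om_vol.
have c0 : 0 < r / t by rewrite divr_gt0.
have [D [_ D2 le]] := haar_val_sum_le c0 (@subset_refl _ Om) OmP.
(* Each member carries at least the proportion lam1 of the total mass, so there are at most 1/lam1
   of them. *)
have n_le : (size (ord Om))%:R * lam1 <= 1.
  rewrite -(ler_pM2r M0) mul1r -mulrA {2}/M (mass_ord (@subset_refl _ Om)).
  rewrite (_ : _ * _ = \sum_(Q <- ord Om) lam1 * M); last first.
    by rewrite big_const_seq count_predT iter_addr_0 mulr_natl.
  rewrite big_seq [leRHS]big_seq; apply: ler_sum => Q.
  by rewrite mem_ord// => /set_mem /lOm.
have D_le : D%:R <= (lam1^-1 + 1) / 2.
  rewrite ler_pdivlMr// -natrM muln2 (le_trans (_ : _ <= (size (ord Om)).+1%:R))//.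
    by rewrite ler_nat.
  by rewrite -natr1 lerD2r -[X in _ <= X]div1r ler_pdivlMr.
apply: (le_trans le); rewrite ler_pdivlMr//.
apply: (@le_trans _ _ (lam1^-1 / t)).
  have vinv : (vol P)^-1 <= (lam1 * M)^-1 by rewrite lef_pV2 ?posrE ?mulr_gt0// lOm.
  apply: (@le_trans _ _ ((r / t / 2 * ((lam1 * M)^-1 - M^-1) + (lam1^-1 + 1) / 2 / (r / t * 2)) * r)).
    rewrite ler_wpM2r ?(ltW r0)// lerD//.
        apply: ler_wpM2l; first by rewrite divr_ge0// ltW.
      by rewrite -/M lerD2r.
    by rewrite ler_wpM2r// invr_ge0 mulr_ge0// ltW.
  rewrite le_eqVlt; apply/orP; left; apply/eqP.
  (* The AM-GM parameter is tuned for this point: as [t ^+ 2 = 2], both fractions have denominator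
     2t, and the terms -1 and +1 cancel. *)
  rewrite r2 (_ : _ * r = (lam1^-1 - 1) / (2 * t) + (lam1^-1 + 1) * (t ^+ 2) / (4 * t)).
    by rewrite t2; field; rewrite !gt_eqF.
  by field; rewrite !gt_eqF.
rewrite /C_H -/t; apply: (@le_trans _ _ (lam2 `^ 2^-1 / (t * lam1 `^ (3 / 2)))); last by rewrite lerDl.
have -> : lam1^-1 / t = lam1 `^ 2^-1 / (t * lam1 `^ (3 / 2)).
  have -> : lam1 `^ (3 / 2) = lam1 * lam1 `^ 2^-1.
    rewrite (_ : (3 / 2 : R) = 1 + 2^-1); last by field.
    by rewrite powRD ?powRr1 ?(ltW l10)// (gt_eqF l10) implybT.
  have := powR_gt0 2^-1 l10; set z := lam1 `^ _ => z0.
  by field; rewrite !gt_eqF.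
rewrite ler_wpM2r ?invr_ge0 ?mulr_ge0 ?powR_ge0 ?(ltW t0)//.
by rewrite ge0_ler_powR ?nnegrE ?(ltW l10) ?(ltW l12)// ?invr_ge0// (le_trans (ltW l10) (ltW l12)).
Qed.

End haar_estimates.
End enumerated_family.
End haar_tree.

(** * Haar coefficients on a good grid *)

Section Rintegral_sums.
Context d (T : measurableType d) (R : realType).
Variable m : {measure set T -> \bar R}.

Lemma Rintegral_sum (D : set T) (I : Type) (r : seq I) (F : I -> T -> R) : measurable D ->
  (forall i, m.-integrable D (EFin \o F i)) ->
  m.-integrable D (EFin \o (fun x => \sum_(i <- r) F i x)) /\
  \int[m]_(x in D) (\sum_(i <- r) F i x) = \sum_(i <- r) \int[m]_(x in D) F i x.
Proof.
move=> mD iF; elim: r => [|i r [ih1 ih2]].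
  split; last by under eq_Rintegral do rewrite big_nil; rewrite big_nil /Rintegral integral0.
  by under eq_fun do rewrite big_nil; exact: integrable0.
split.
  apply: (eq_integrable mD (fun x => (F i x)%:E + (\sum_(j <- r) F j x)%:E)%E).
    by move=> x _ /=; rewrite big_cons EFinD.
  exact: (integrableD mD (iF i) ih1).
rewrite big_cons -ih2 -RintegralD//.
by apply: eq_Rintegral => x _; rewrite big_cons.
Qed.

Lemma Rintegral_indicM (D : set T) (f : T -> R) : measurable D ->
  m.-integrable setT (EFin \o f) ->
  m.-integrable setT (EFin \o (fun x => f x * \1_D x)) /\
  \int[m]_x (f x * \1_D x) = \int[m]_(x in D) f x.
Proof.
move=> mD fi; have E : (fun x => f x * \1_D x) = f \_ D.
  by apply/funext => x; rewrite patchE indicE; case: (x \in D); rewrite ?mulr1 ?mulr0.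
split; last by rewrite E -Rintegral_mkcond.
rewrite E; apply: (eq_integrable measurableT ((EFin \o f) \_ D)).
  by move=> x _; rewrite /= !patchE; case: ifPn.
apply/(integrable_mkcond (EFin \o f) mD); exact: integrableS fi.
Qed.

End Rintegral_sums.

Section haar_grid.
Context d (T : measurableType d) (R : realType).
Variable m : {finite_measure set T -> \bar R}.
Variables (lam1 lam2 : R) (G : nat -> set (set T)).
Hypothesis hlam : [/\ 0 < lam1, lam1 < lam2 & lam2 < 1].
Hypothesis hG : good_grid m lam1 lam2 G.
Variable ord : set (set T) -> seq (set T).
Hypothesis hord : orderings G ord.
Local Notation vol := (vol m).
Local Notation normc := Normc.normc.

Lemma enumerated_children k Q : G k Q -> enumerated ord (children G k Q).
Proof. by move=> GQ A; exact: hord GQ. Qed.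

Lemma children_vol_gt0 k Q P : children G k Q P -> 0 < vol P.
Proof. by case=> GP _; exact: vol_gt0 hG _ _ GP. Qed.

Lemma perm_children k Q : G k Q -> perm_eq (ord (children G k Q)) (child_cells G k Q).
Proof.
move=> GQ; have eO := enumerated_children GQ; apply: uniq_perm.
- by case: (eO _ (@subset_refl _ _)).
- exact: child_cells_uniq.
- move=> P; rewrite (mem_ord eO)//; apply/idP/(child_cellsP hG) => [/set_mem//|h]; exact: mem_set.
Qed.

Lemma mass_children k Q : G k Q -> mass m (children G k Q) = vol Q.
Proof.
move=> GQ; rewrite (mass_ord _ (enumerated_children GQ))// (perm_big _ (perm_children GQ)).
by rewrite (vol_children hG GQ).
Qed.

(** A cell has at least two children, so the guard in [haar_subtree] holds at the root. *)
Lemma haar_pairsE k Q : G k Q -> haar_pairs G ord k Q = haar_subtree ord (children G k Q).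
Proof.
move=> GQ; rewrite /haar_subtree (perm_size (perm_children GQ)).
by rewrite (size_child_cells hlam hG GQ).
Qed.

Lemma haar_pairs_finite k Q : G k Q -> finite_set (haar_pairs G ord k Q).
Proof.
by move=> GQ; rewrite haar_pairsE//; apply: haar_subtree_finite (@subset_refl _ _); exact: enumerated_children.
Qed.

Definition pairs k Q : seq (set (set T) * set (set T)) :=
  enum_fset (fset_set (haar_pairs G ord k Q)).

Lemma pairsP k Q S : G k Q -> reflect (haar_subtree ord (children G k Q) S) (S \in pairs k Q).
Proof.
move=> GQ; rewrite -haar_pairsE// (_ : (S \in pairs k Q) = (S \in fset_set (haar_pairs G ord k Q)))//.
by rewrite (in_fset_set (haar_pairs_finite GQ)); apply: (iffP idP) => [/set_mem|/mem_set].
Qed.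

Lemma fsbig_pairs (V : nmodType) k Q (F : _ -> V) : G k Q ->
  \sum_(S \in haar_pairs G ord k Q) F S = \sum_(S <- pairs k Q) F S.
Proof. by move=> GQ; rewrite fsbig_finite//; exact: haar_pairs_finite. Qed.

Lemma fsbig_subtree (V : nmodType) k Q (F : _ -> V) : G k Q ->
  \sum_(S \in haar_subtree ord (children G k Q)) F S = \sum_(S <- pairs k Q) F S.
Proof. by move=> GQ; rewrite -haar_pairsE// fsbig_pairs. Qed.

Lemma haar_fun_sum k Q S x : G k Q -> S \in pairs k Q ->
  haar_fun m S x = \sum_(P <- child_cells G k Q) \1_P x * haar_val m S P.
Proof.
move=> GQ /(pairsP _ GQ) hS; have eO := enumerated_children GQ.
have [S1 S2 _ _ _] := haar_subtree_sub eO (@subset_refl _ _) hS.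
rewrite -(perm_big _ (perm_children GQ))/= (sum_haar_val _ eO)// /haar_fun.
by rewrite !(fsbig_ord eO).
Qed.

Lemma indic_child k Q P P' x : P \in child_cells G k Q -> P' \in child_cells G k Q ->
  P x -> (\1_P' x : R) = (P' == P)%:R.
Proof.
move=> /(child_cellsP hG)[GP _] /(child_cellsP hG)[GP' _] Px; rewrite indicE.
have [->|PP'] := eqVneq P' P; first by rewrite mem_set.
rewrite memNset// => P'x; move: PP'; rewrite (cell_eq hG GP' GP P'x Px) eqxx//.
Qed.

Lemma haar_fun_child k Q S P x : G k Q -> S \in pairs k Q -> P \in child_cells G k Q ->
  P x -> haar_fun m S x = haar_val m S P.
Proof.
move=> GQ hS hP Px; rewrite (haar_fun_sum _ GQ hS) (bigD1_seq P) ?child_cells_uniq//=.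
rewrite (indic_child hP hP Px) eqxx mul1r big1_seq ?addr0// => P' /andP[P'P hP'].
by rewrite (indic_child hP hP' Px) (negbTE P'P) mul0r.
Qed.

Lemma Rintegral_haar k Q S (f : T -> R) : G k Q -> S \in pairs k Q ->
  m.-integrable setT (EFin \o f) ->
  \int[m]_x (f x * haar_fun m S x) =
  \sum_(P <- child_cells G k Q) \int[m]_(x in P) f x * haar_val m S P.
Proof.
move=> GQ hS fi.
(* The value 0 at sets that are not children makes [F P] integrable for every index. *)
pose F P x := if P \in child_cells G k Q then (haar_val m S P) * (f x * \1_P x) else 0.
have mP P : P \in child_cells G k Q -> measurable P.
  by move=> /(child_cellsP hG)[/(measurable_cell hG)].
have iF P : m.-integrable setT (EFin \o F P).
  rewrite /F; have [hP|_] := boolP (P \in child_cells G k Q); last exact: integrable0.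
  have [+ _] := Rintegral_indicM (mP _ hP) fi.
  exact: integrableZl.
have [_ E] := Rintegral_sum (child_cells G k Q) measurableT iF.
transitivity (\int[m]_x (\sum_(P <- child_cells G k Q) F P x)).
  apply: eq_Rintegral => x _; rewrite (haar_fun_sum _ GQ hS) mulr_sumr.
  by apply: eq_big_seq => P hP; rewrite /F hP; ring.
rewrite E; apply: eq_big_seq => P hP; rewrite /F hP.
have [h1 h2] := Rintegral_indicM (mP _ hP) fi.
by rewrite RintegralZl// h2 mulrC.
Qed.

(** * Haar coefficients and averages of an integrable function *)

Section complex_coefficients.
Variable f : T -> R[i].
Hypothesis mf : cmeasurable f.
Hypothesis fi : m.-integrable setT (fun x => (normc (f x))%:E).

Let iRe : m.-integrable setT (EFin \o (fun x => complex.Re (f x))).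
Proof. by case: (cintegrable_ReIm measurableT mf fi). Qed.

Let iIm : m.-integrable setT (EFin \o (fun x => complex.Im (f x))).
Proof. by case: (cintegrable_ReIm measurableT mf fi). Qed.

Definition caverage (P : set T) : R[i] := cintegral_on m P f * real_complex R (vol P)^-1.

Lemma haar_coefE k Q S : G k Q -> S \in pairs k Q ->
  haar_coef m f S =
  \sum_(P <- child_cells G k Q) cintegral_on m P f * real_complex R (haar_val m S P).
Proof.
move=> GQ hS; apply: complexP.
  have -> : complex.Re (haar_coef m f S) = \int[m]_x (complex.Re (f x) * haar_fun m S x).
    by apply: eq_Rintegral => x _; rewrite Re_realM.
  by rewrite Re_sum (Rintegral_haar GQ hS)//; apply: eq_bigr => P _; rewrite Re_realM.
have -> : complex.Im (haar_coef m f S) = \int[m]_x (complex.Im (f x) * haar_fun m S x).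
  by apply: eq_Rintegral => x _; rewrite Im_realM.
by rewrite Im_sum (Rintegral_haar GQ hS)//; apply: eq_bigr => P _; rewrite Im_realM.
Qed.

Lemma Rintegral_ord k Q (g : T -> R) : G k Q -> m.-integrable setT (EFin \o g) ->
  \sum_(P <- ord (children G k Q)) \int[m]_(x in P) g x = \int[m]_(x in Q) g x.
Proof.
by move=> GQ gi; rewrite (perm_big _ (perm_children GQ)) -(Rintegral_children hG GQ gi).
Qed.

Lemma haar_sum_average k Q P : G k Q -> P \in child_cells G k Q ->
  \sum_(S <- pairs k Q) haar_coef m f S * real_complex R (haar_val m S P) =
  caverage P - caverage Q.
Proof.
move=> GQ hP; have eO := enumerated_children GQ.
have OmP : children G k Q P by move/(child_cellsP hG) : hP.
have Ov Q' : children G k Q Q' -> 0 < vol Q' by exact: children_vol_gt0.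
rewrite (eq_big_seq (fun S => (\sum_(P <- child_cells G k Q) cintegral_on m P f *
  real_complex R (haar_val m S P)) * real_complex R (haar_val m S P))); last first.
  by move=> S hS; rewrite (haar_coefE GQ hS).
apply: complexP.
  rewrite Re_sum ReB /caverage !Re_realM [complex.Re (cintegral_on _ _ _)]/= [X in _ - X * _]/=.
  have := haar_reconstruction eO Ov (fun P => \int[m]_(x in P) complex.Re (f x)) (@subset_refl _ _) OmP.
  rewrite (Rintegral_ord GQ iRe) (mass_children GQ) => <-.
  rewrite (fsbig_subtree _ GQ); apply: eq_bigr => S _.
  rewrite Re_realM Re_sum (perm_big _ (perm_children GQ)); congr (_ * _).
  by apply: eq_bigr => P' _; rewrite Re_realM.
rewrite Im_sum ImB /caverage !Im_realM [complex.Im (cintegral_on _ _ _)]/= [X in _ - X * _]/=.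
have := haar_reconstruction eO Ov (fun P => \int[m]_(x in P) complex.Im (f x)) (@subset_refl _ _) OmP.
rewrite (Rintegral_ord GQ iIm) (mass_children GQ) => <-.
rewrite (fsbig_subtree _ GQ); apply: eq_bigr => S _.
rewrite Im_realM Im_sum (perm_big _ (perm_children GQ)); congr (_ * _).
by apply: eq_bigr => P' _; rewrite Im_realM.
Qed.

(** phi_S has mean zero, so any constant [c] can be subtracted from f without changing the
    coefficient. This is how the oscillation enters. *)
Lemma haar_coef_le k Q S (c : R[i]) : G k Q -> S \in pairs k Q ->
  normc (haar_coef m f S) <=
  \sum_(P <- child_cells G k Q) `|haar_val m S P| * \int[m]_(x in P) normc (f x - c).
Proof.
move=> GQ hS; have eO := enumerated_children GQ.
have [S1 S2 Sd n1 n2] := haar_subtree_sub eO (@subset_refl _ _) (pairsP _ GQ hS).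
have mS1 := mass_gt0 eO (@children_vol_gt0 k Q) S1 n1.
have mS2 := mass_gt0 eO (@children_vol_gt0 k Q) S2 n2.
have val0 : \sum_(P <- child_cells G k Q) vol P * haar_val m S P = 0.
  rewrite -(perm_big _ (perm_children GQ))/= (sum_haar_val _ eO)//.
  by rewrite -!(mass_ord m eO)// !divff ?gt_eqF// subrr mulr0.
have mfc : cmeasurable (fun x => f x - c) by apply: cmeasurableB => //; exact: cmeasurable_cst.
have fci : m.-integrable setT (fun x => (normc (f x - c))%:E).
  apply: (@le_integrable _ _ _ _ _ measurableT _ (fun x => (normc (f x) + normc c)%:E)).
  - by apply/measurable_EFinP; exact: measurable_normc.
  - move=> x _; rewrite lee_fin !ger0_norm ?addr_ge0 ?normc_ge0//.
    by rewrite -[normc c]normcN le_normcD.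
  - apply: (eq_integrable measurableT (fun x => (normc (f x))%:E + (normc c)%:E)%E) => //.
    apply: integrableD => //; exact: finite_measure_integrable_cst.
have -> : haar_coef m f S =
    \sum_(P <- child_cells G k Q) cintegral_on m P (fun x => f x - c) * real_complex R (haar_val m S P).
  rewrite (haar_coefE GQ hS).
  transitivity (\sum_(P <- child_cells G k Q) cintegral_on m P f * real_complex R (haar_val m S P) -
      c * real_complex R (\sum_(P <- child_cells G k Q) vol P * haar_val m S P)).
    by rewrite val0 rmorph0 mulr0 subr0.
  rewrite real_complex_sum mulr_sumr -sumrB; apply: eq_big_seq => P /(child_cellsP hG)[GP _].
  have mP := measurable_cell hG GP.
  rewrite real_complexM mulrA -mulrBl; congr (_ * _); apply: complexP.
    rewrite ReB Re_realM; rewrite [RHS](_ : _ = \int[m]_(x in P) (complex.Re (f x) - complex.Re c)).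
      rewrite RintegralB ?Rintegral_cst//.
        by apply: integrableS iRe.
      by apply: finite_measure_integrable_cst.
    by apply: eq_Rintegral => x _; rewrite ReB.
  rewrite ImB Im_realM; rewrite [RHS](_ : _ = \int[m]_(x in P) (complex.Im (f x) - complex.Im c)).
    rewrite RintegralB ?Rintegral_cst//.
      by apply: integrableS iIm.
    by apply: finite_measure_integrable_cst.
  by apply: eq_Rintegral => x _; rewrite ImB.
apply: (le_trans (ler_normc_sum _ _)).
rewrite big_seq [leRHS]big_seq; apply: ler_sum => P /(child_cellsP hG)[GP _].
have mP := measurable_cell hG GP.
rewrite Normc.normcM normc_real mulrC ler_wpM2l//.
by apply: normc_cintegral_le => //; apply: integrableS fci.
Qed.

End complex_coefficients.
Lemma C_H_ge1 : 1 <= C_H lam1 lam2.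
Proof. by rewrite /C_H lerDr divr_ge0 ?mulr_ge0 ?powR_ge0 ?sqrtr_ge0. Qed.

Lemma haar_val_sum_pairs k Q P : G k Q -> P \in child_cells G k Q ->
  \sum_(S <- pairs k Q) `|haar_val m S P| <= C_H lam1 lam2 / Num.sqrt (vol Q).
Proof.
move=> GQ hP; have eO := enumerated_children GQ.
rewrite -(mass_children GQ) -fsbig_subtree//.
case: hlam => l10 l12 _; apply: (haar_sum_C_H eO (@children_vol_gt0 k Q) l10 l12).
  by move/(child_cellsP hG) : hP.
move=> P' [GP' P'Q]; rewrite (mass_children GQ).
by case: (child_vol hG GQ GP' P'Q).
Qed.

Lemma haar_val_mass_pairs k Q S : G k Q -> S \in pairs k Q ->
  \sum_(P <- child_cells G k Q) vol P * `|haar_val m S P| <= Num.sqrt (vol Q).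
Proof.
move=> GQ hS; have eO := enumerated_children GQ.
have [S1 S2 Sd n1 n2] := haar_subtree_sub eO (@subset_refl _ _) (pairsP _ GQ hS).
rewrite -(perm_big _ (perm_children GQ))/= -(mass_children GQ).
exact: (sum_abs_haar_val eO (@children_vol_gt0 k Q)).
Qed.

Lemma sqrt_powR (v r : R) : 0 < v -> Num.sqrt v `^ r = v `^ (r / 2).
Proof. by move=> v0; rewrite -powR12_sqrt ?(ltW v0)// -powRrM mulrC. Qed.

(** * Comparison of coefficients, oscillations and jumps of averages *)

Section L1_function.
Variable f : T -> R[i].
Hypothesis mf : cmeasurable f.
Hypothesis fi : m.-integrable setT (fun x => (normc (f x))%:E).
Variables (s p : R).
Hypothesis hp : 1 <= p.

Let p0 : 0 < p. Proof. exact: lt_le_trans hp. Qed.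

(** For each S, Jensen's inequality over the children with weights |P||phi_S(P)|, of total at most
    |Q|^(1/2), costs |Q|^((p-1)/2). Summing over S costs [C_H] |Q|^(-1/2). A second use of Jensen's
    inequality, on each child, replaces the p-th power of the average of |f - c| by the average of
    |f - c|^p. *)
Lemma sum_haar_coef_le k Q (c : R[i]) : G k Q ->
  ((\sum_(S <- pairs k Q) normc (haar_coef m f S) `^ p)%:E <=
   (C_H lam1 lam2 * vol Q `^ (p / 2 - 1))%:E *
   \int[m]_(x in Q) (normc (f x - c) `^ p)%:E)%E.
Proof.
move=> GQ; have v0 := vol_gt0 hG GQ.
have mfc : cmeasurable (fun x => f x - c) by apply: cmeasurableB => //; exact: cmeasurable_cst.
have mnfc := measurable_normc mfc.
have mpow : measurable_fun setT (fun x => (normc (f x - c) `^ p)%:E).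
  apply/measurable_EFinP.
  exact: (@measurableT_comp _ _ _ _ _ _ (fun x : R => x `^ p)).
have fci : m.-integrable setT (fun x => (normc (f x - c))%:E).
  apply: (@le_integrable _ _ _ _ _ measurableT _ (fun x => (normc (f x) + normc c)%:E)).
  - exact/measurable_EFinP.
  - move=> x _; rewrite lee_fin !ger0_norm ?addr_ge0 ?normc_ge0//.
    by rewrite -[normc c]normcN le_normcD.
  - apply: (eq_integrable measurableT (fun x => (normc (f x))%:E + (normc c)%:E)%E) => //.
    apply: integrableD => //; exact: finite_measure_integrable_cst.
pose u P := \int[m]_(x in P) normc (f x - c).
have u0 P : 0 <= u P by apply: Rintegral_ge0 => x _; exact: normc_ge0.
have cvol P : P \in child_cells G k Q -> 0 < vol P.
  by move=> /(child_cellsP hG)[GP _]; exact: (vol_gt0 hG GP).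
have coefS S : S \in pairs k Q -> normc (haar_coef m f S) `^ p <=
    Num.sqrt (vol Q) `^ (p - 1) *
    \sum_(P <- child_cells G k Q) `|haar_val m S P| * (vol P * (u P / vol P) `^ p).
  move=> hS.
  apply: (@le_trans _ _ ((\sum_(P <- child_cells G k Q)
      (vol P * `|haar_val m S P|) * (u P / vol P)) `^ p)).
    apply: ge0_ler_powR; rewrite ?(ltW p0)// ?nnegrE ?normc_ge0//.
      by apply: sumr_ge0 => P _; rewrite !mulr_ge0 ?invr_ge0 ?vol_ge0.
    rewrite (le_trans (haar_coef_le mf fi c GQ hS))//.
    rewrite le_eqVlt; apply/orP; left; apply/eqP; apply: eq_big_seq => P hP.
    by rewrite -/(u P); field; rewrite gt_eqF// cvol.
  apply: le_trans (powR_sum_le hp _ _) _.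
  - by move=> P _; rewrite mulr_ge0 ?vol_ge0.
  - by move=> P _; rewrite divr_ge0 ?vol_ge0.
  apply: ler_pM; rewrite ?powR_ge0//.
  - by apply: sumr_ge0 => P _; rewrite !mulr_ge0 ?vol_ge0 ?powR_ge0.
  - apply: ge0_ler_powR; rewrite ?subr_ge0// ?nnegrE ?sqrtr_ge0//.
      by apply: sumr_ge0 => P _; rewrite mulr_ge0 ?vol_ge0.
    exact: haar_val_mass_pairs.
  - by apply: ler_sum => P _; rewrite [vol P * _]mulrC mulrA.
(* The sums over S and P are exchanged, so that for each child only the sum of the |phi_S(P)|
   remains. *)
apply: (@le_trans _ _ ((Num.sqrt (vol Q) `^ (p - 1) * (C_H lam1 lam2 / Num.sqrt (vol Q))) *
   \sum_(P <- child_cells G k Q) vol P * (u P / vol P) `^ p)%:E).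
  rewrite lee_fin -mulrA big_seq (le_trans (ler_sum _ coefS))// -big_seq -mulr_sumr.
  rewrite ler_wpM2l ?powR_ge0// exchange_big/= mulr_sumr big_seq [leRHS]big_seq.
  apply: ler_sum => P hP; rewrite -mulr_suml ler_wpM2r//.
    by rewrite mulr_ge0 ?vol_ge0 ?powR_ge0.
  exact: haar_val_sum_pairs.
rewrite (_ : _ * (_ / _) = C_H lam1 lam2 * vol Q `^ (p / 2 - 1)); last first.
  have -> : Num.sqrt (vol Q) `^ (p - 1) = vol Q `^ (p / 2 - 1) * Num.sqrt (vol Q).
    rewrite sqrt_powR// -(powR12_sqrt (vol_ge0 m Q)) -powRD; last first.
      by rewrite (gt_eqF v0) implybT.
    by congr (_ `^ _); field.
  by field; rewrite gt_eqF// sqrtr_gt0.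
rewrite EFinM lee_wpmul2l ?lee_fin ?mulr_ge0 ?powR_ge0 ?(le_trans ler01 C_H_ge1)//.
rewrite (ge0_integral_cover (F := child_cells G k Q)); last 7 first.
- exact: (measurable_cell hG GQ).
- exact: child_cells_uniq.
- by move=> P /(child_cellsP hG)[/(measurable_cell hG)].
- exact: (child_cells_trivIset hG).
- exact: (child_cells_cover hG GQ).
- exact: measurable_funTS.
- by move=> x _; rewrite lee_fin powR_ge0.
rewrite -sumEFin big_seq [leRHS]big_seq; apply: lee_sum => P hP.
have [GP _] := child_cellsP hG _ _ _ hP; have mP := measurable_cell hG GP.
have vP := cvol _ hP.
have fciP : m.-integrable P (EFin \o (fun x => normc (f x - c))) by apply: integrableS fci.
have := powR_Rintegral_le mP hp (fun x => normc_ge0 (f x - c)) fciP.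
rewrite -/(u P) => h.
(* The factor |P|^(1-p) cancels exactly the factor |P|^(p-1) in Jensen's inequality on P. *)
have vE : vol P * (u P / vol P) `^ p = vol P `^ (1 - p) * u P `^ p.
  rewrite powRM ?invr_ge0 ?vol_ge0// -powR_inv1 ?vol_ge0// -powRrM mulN1r.
  rewrite [vol P `^ (1 - p)]powRD ?powRr1 ?vol_ge0//; first by ring.
  by rewrite (gt_eqF vP) implybT.
rewrite vE EFinM (le_trans (lee_wpmul2l _ h)) ?lee_fin ?powR_ge0//.
rewrite muleA -EFinM -powRD; last by rewrite (gt_eqF vP) implybT.
by rewrite (_ : 1 - p + (p - 1) = 0) ?powRr0 ?mul1e//; ring.
Qed.

Lemma osc_ge0 Q : (0 <= osc m p f Q)%E.
Proof. by apply: le_ereal_inf_tmp => _ [c _ <-]; exact: poweR_ge0. Qed.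

(** The previous estimate holds for every constant c, hence for the infimum, once the factor [K] has
    been moved to the other side. *)
Lemma haar_level_le_osc k Q : G k Q ->
  ((vol Q `^ (1 - s * p - p / 2) * \sum_(S \in haar_pairs G ord k Q) normc (haar_coef m f S) `^ p)%:E
   <= (C_H lam1 lam2 `^ p)%:E * ((vol Q `^ (- (s * p)))%:E * osc m p f Q `^ p))%E.
Proof.
move=> GQ; rewrite fsbig_pairs//; have v0 := vol_gt0 hG GQ.
set X := \sum_(S <- _) _.
have X0 : 0 <= X by apply: sumr_ge0 => S _; exact: powR_ge0.
have CH1 := C_H_ge1; have CH0 : 0 < C_H lam1 lam2 by exact: lt_le_trans CH1.
set K := C_H lam1 lam2 * vol Q `^ (p / 2 - 1).
have K0 : 0 < K by rewrite mulr_gt0// powR_gt0.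
have oscge : (((X / K) `^ p^-1)%:E <= osc m p f Q)%E.
  apply: le_ereal_inf_tmp => _ [c _ <-].
  rewrite -poweR_EFin; apply: le_poweR; rewrite ?invr_ge0 ?(ltW p0)//.
    by rewrite lee_fin divr_ge0// ltW.
  have := sum_haar_coef_le c GQ; rewrite -/K -/X => h.
  rewrite -(@lee_pmul2l _ K%:E)//.
  by rewrite -EFinM mulrC divfK ?gt_eqF.
have oscp : ((X / K)%:E <= osc m p f Q `^ p)%E.
  rewrite (_ : X / K = ((X / K) `^ p^-1) `^ p); last first.
    by rewrite -powRrM mulVf ?gt_eqF// powRr1// divr_ge0// ltW.
  by rewrite -poweR_EFin; apply: le_poweR; rewrite ?(ltW p0)// lee_fin powR_ge0.
have XE : vol Q `^ (1 - s * p - p / 2) * X = vol Q `^ (- (s * p)) * (C_H lam1 lam2 * (X / K)).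
  rewrite /K (_ : 1 - s * p - p / 2 = - (s * p) + - (p / 2 - 1)); last by ring.
  rewrite powRD; last by rewrite (gt_eqF v0) implybT.
  rewrite [vol Q `^ (- (p / 2 - 1))]powRN; have := powR_gt0 (p / 2 - 1) v0; set z := vol Q `^ _ => z0.
  by field; rewrite !gt_eqF.
rewrite XE EFinM muleCA lee_wpmul2l ?lee_fin ?powR_ge0// EFinM.
(* The estimate produces [C_H] to the first power; as [C_H] >= 1, it is at most its p-th power. *)
apply: lee_pmul; rewrite ?lee_fin ?(ltW CH0) ?divr_ge0 ?(ltW K0)//.
exact: le1r_powR.
Qed.

Lemma haar_coef0E :
  haar_coef0 m f = cintegral_on m setT f * real_complex R (Num.sqrt (vol setT))^-1.
Proof.
have [iRe iIm] := cintegrable_ReIm measurableT mf fi.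
apply: complexP.
  rewrite Re_realM -RintegralZr//; apply: eq_Rintegral => x _.
  by rewrite Re_realM /haar_fun0 indicT mul1r.
rewrite Im_realM -RintegralZr//; apply: eq_Rintegral => x _.
by rewrite Im_realM /haar_fun0 indicT mul1r.
Qed.

(** |d_I| <= |I|^(-1/2) |f|_1 and |f|_1 <= |I|^(1-1/p) |f|_p; the powers of |I| combine to
    |I|^(-s). *)
Lemma haar_coef0_le :
  ((vol setT `^ (p^-1 - s - 2^-1) * normc (haar_coef0 m f))%:E <=
   (vol setT `^ (- s))%:E * cLnorm m p%:E f)%E.
Proof.
have v0 := volT_gt0 hG.
set J := \int[m]_x normc (f x).
have J0 : 0 <= J by apply: Rintegral_ge0 => x _; exact: normc_ge0.
rewrite haar_coef0E.
have cle := normc_cintegral_le measurableT mf fi; rewrite -/J in cle.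
have s0 : 0 < Num.sqrt (vol setT) by rewrite sqrtr_gt0.
rewrite Normc.normcM normc_real ger0_norm ?invr_ge0 ?(ltW s0)//.
apply: (@le_trans _ _ ((vol setT `^ (- s)) * (vol setT `^ (p^-1 - 1) * J))%:E).
  rewrite lee_fin (_ : p^-1 - s - 2^-1 = - s + (p^-1 - 1) + 2^-1); last by field; rewrite gt_eqF.
  rewrite !powRD ?(gt_eqF v0) ?implybT// powR12_sqrt ?(ltW v0)// -!mulrA.
  rewrite !ler_wpM2l ?powR_ge0// mulrCA mulfV ?gt_eqF// mulr1//.
rewrite EFinM lee_wpmul2l ?lee_fin ?powR_ge0//.
have h : (J%:E <= (vol setT `^ (1 - p^-1))%:E * cLnorm m p%:E f)%E.
  rewrite (_ : J%:E = \int[m]_x (normc (f x))%:E)%E.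
    exact: (L1_le_Lnorm hp (fun x => normc_ge0 (f x)) fi).
  by rewrite /J /Rintegral fineK//; exact: integrable_fin_num fi.
rewrite EFinM (le_trans (lee_wpmul2l _ h)) ?lee_fin ?powR_ge0//.
rewrite muleA -EFinM -powRD; last by rewrite (gt_eqF v0) implybT.
rewrite (_ : p^-1 - 1 + (1 - p^-1) = 0) ?powRr0 ?mul1e//; last by ring.
Qed.

Lemma N_haar_le_N_osc (q : \bar R) : (1 <= q)%E ->
  (N_haar m G ord s p q f <= (C_H lam1 lam2)%:E * N_osc m G s p q f)%E.
Proof.
move=> hq; have CH1 := C_H_ge1; have CH0 : 0 <= C_H lam1 lam2 by exact: le_trans CH1.
have mixed0 a : (0 <= mixed_norm p q a)%E by exact: mixed_norm_ge0.
have first0 : (0 <= (vol setT `^ (- s))%:E * cLnorm m p%:E f)%E.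
  by rewrite mule_ge0 ?lee_fin ?powR_ge0// Lnorm_ge0.
rewrite /N_haar /N_osc muleDr// ?ge0_adde_def ?inE//.
apply: leeD.
  apply: (le_trans haar_coef0_le).
  by rewrite -[leLHS]mul1e lee_wpmul2r.
rewrite -mixed_normZ//; last first.
  move=> k; rewrite (fsbig_cells hG) sume_ge0// => Q _.
  by rewrite mule_ge0 ?lee_fin ?powR_ge0 ?poweR_ge0.
apply: le_mixed_norm => // k.
  rewrite lee_fin (fsbig_cells hG) sumr_ge0// => Q _.
  by rewrite mulr_ge0 ?powR_ge0//; apply: sumr_ge0 => S _; exact: powR_ge0.
rewrite !(fsbig_cells hG) -sumEFin ge0_sume_distrr; last first.
  by move=> Q _; rewrite mule_ge0 ?lee_fin ?powR_ge0 ?poweR_ge0.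
rewrite big_seq [leRHS]big_seq; apply: lee_sum => Q /(cellsP hG) GQ.
exact: haar_level_le_osc.
Qed.

Variable pt : set T -> T.
Hypothesis hpt : forall k P, G k P -> P (pt P).

(** Up to scaling, k_P is the jump of the averages of f between a cell and its child. *)
Lemma st_coefE k Q P : G k Q -> P \in child_cells G k Q ->
  st_coef m G ord s p pt f k P =
  real_complex R (vol P `^ (p^-1 - s)) * (caverage f P - caverage f Q).
Proof.
move=> GQ hP; have [GP PQ] := child_cellsP hG _ _ _ hP.
rewrite /st_coef (parentE hG GQ GP PQ) fsbig_pairs// -(haar_sum_average mf fi GQ hP).
congr (_ * _); apply: eq_big_seq => S hS.
by rewrite (haar_fun_child GQ hS hP (hpt GP)).
Qed.

(** The left side is the factor that arises on a single cell. Since [C_H] >= 1 and 1/lam1 <=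
    lam1^(-2p-1), it is bounded by the p-th power of the second summand of [C_e]. *)
Lemma C_e_ge (M : R) : M = Num.max (lam2 `^ (p^-1 - s)) (lam1 `^ (p^-1 - s)) ->
  M `^ p * C_H lam1 lam2 `^ (p - 1) / lam1 <= C_e lam1 lam2 s p `^ p.
Proof.
move=> ME; have M0 : 0 <= M by rewrite ME le_max powR_ge0.
have CH1 := C_H_ge1; have CH0 : 0 < C_H lam1 lam2 by exact: lt_le_trans CH1.
have l10 := lam1_gt0 hlam.
have l1_1 : lam1 <= 1 by case: hlam => _ /ltW h1 /ltW; exact: le_trans.
apply: (@le_trans _ _ ((C_H lam1 lam2 * M * lam1 `^ (- 2 - p^-1)) `^ p)); last first.
  apply: ge0_ler_powR; rewrite ?(ltW p0)// ?nnegrE ?mulr_ge0 ?powR_ge0 ?(ltW CH0)//.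
    by rewrite /C_e -ME addr_ge0// !mulr_ge0 ?powR_ge0 ?(ltW CH0).
  by rewrite /C_e -ME lerDr.
rewrite !powRM ?mulr_ge0 ?powR_ge0 ?(ltW CH0)// [C_H _ _ `^ p * _]mulrC -!mulrA ler_wpM2l ?powR_ge0//.
apply: ler_pM; rewrite ?powR_ge0 ?invr_ge0 ?(ltW l10)//.
  by apply: ler_powR => //; rewrite gerBl.
rewrite -powRrM -powR_inv1 ?(ltW l10)//; apply: ger_powR; first by rewrite l10.
rewrite mulrBl mulVf ?gt_eqF// lerBlDr addNr mulNr oppr_le0.
by rewrite mulr_ge0// ltW.
Qed.

(** Dual to [sum_haar_coef_le]: at each child, Jensen's inequality runs over the pairs S with
    weights |phi_S(P)|, of total at most [C_H] |Q|^(-1/2), and the children are summed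
    afterwards. *)
Lemma st_level_le k Q : G k Q ->
  \sum_(P <- child_cells G k Q) normc (st_coef m G ord s p pt f k P) `^ p <=
  C_e lam1 lam2 s p `^ p * (vol Q `^ (1 - s * p - p / 2) *
    \sum_(S \in haar_pairs G ord k Q) normc (haar_coef m f S) `^ p).
Proof.
move=> GQ; rewrite fsbig_pairs//; have v0 := vol_gt0 hG GQ.
set M := Num.max (lam2 `^ (p^-1 - s)) (lam1 `^ (p^-1 - s)).
have M0 : 0 <= M by rewrite le_max powR_ge0.
have CH1 := C_H_ge1; have CH0 : 0 < C_H lam1 lam2 by exact: lt_le_trans CH1.
have l10 := lam1_gt0 hlam; have l20 := lam2_gt0 hlam.
set r := Num.sqrt (vol Q); have r0 : 0 < r by rewrite sqrtr_gt0.
set X := \sum_(S <- pairs k Q) _.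
have X0 : 0 <= X by apply: sumr_ge0 => S _; exact: powR_ge0.
have coefP P : P \in child_cells G k Q ->
    normc (st_coef m G ord s p pt f k P) `^ p <=
    (M `^ p * vol Q `^ (1 - s * p)) * ((C_H lam1 lam2 / r) `^ (p - 1) *
     \sum_(S <- pairs k Q) `|haar_val m S P| * normc (haar_coef m f S) `^ p).
  move=> hP; have [GP PQ] := child_cellsP hG _ _ _ hP.
  rewrite (st_coefE GQ hP) Normc.normcM normc_real ger0_norm ?powR_ge0//.
  rewrite (powRM _ (powR_ge0 _ _) (normc_ge0 _)); apply: ler_pM; rewrite ?powR_ge0//.
    rewrite (_ : M `^ p * _ = (M * vol Q `^ (p^-1 - s)) `^ p); last first.
      rewrite powRM ?powR_ge0// -powRrM mulrBl mulVf ?gt_eqF//.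
    apply: ge0_ler_powR; rewrite ?(ltW p0)// ?nnegrE ?mulr_ge0 ?powR_ge0//.
    have rho : vol P = (vol P / vol Q) * vol Q by rewrite divfK ?gt_eqF.
    have [/andP[rho1 rho2]] : lam1 <= vol P / vol Q <= lam2 /\ True.
      by split=> //; exact: (grid_ratio hG GQ GP PQ).
    move=> _; rewrite rho powRM ?divr_ge0 ?vol_ge0// ler_wpM2r ?powR_ge0//.
    have rho0 : 0 < vol P / vol Q by exact: lt_le_trans rho1.
    (* The sign of 1/p - s decides which end of [lam1, lam2] maximizes the power of |P|/|Q|; this is
       the maximum in [C_e]. *)
    rewrite /M le_max; have [e0|e0] := lerP 0 (p^-1 - s).
      by rewrite ge0_ler_powR// nnegrE ltW.
    apply/orP; right; rewrite -[p^-1 - s]opprK !(powRN _ (- (p^-1 - s))).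
    rewrite lef_pV2 ?posrE ?powR_gt0//.
    by rewrite ge0_ler_powR ?nnegrE ?oppr_ge0 ?(ltW e0) ?(ltW l10) ?(ltW rho0).
  rewrite -(haar_sum_average mf fi GQ hP).
  apply: (@le_trans _ _ ((\sum_(S <- pairs k Q) `|haar_val m S P| * normc (haar_coef m f S)) `^ p)).
    apply: ge0_ler_powR; rewrite ?(ltW p0)// ?nnegrE ?normc_ge0//.
      by apply: sumr_ge0 => S _; rewrite mulr_ge0 ?normc_ge0.
    apply: (le_trans (ler_normc_sum _ _)); apply: ler_sum => S _.
    by rewrite Normc.normcM normc_real mulrC.
  apply: le_trans (powR_sum_le hp _ _) _; [by []|by move=> *; exact: normc_ge0|].
  rewrite ler_wpM2r//; first by apply: sumr_ge0 => S _; rewrite mulr_ge0 ?powR_ge0.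
  apply: ge0_ler_powR; rewrite ?subr_ge0// ?nnegrE ?divr_ge0 ?(ltW CH0) ?(ltW r0)//.
    exact: sumr_ge0.
  exact: haar_val_sum_pairs.
rewrite big_seq (le_trans (ler_sum _ coefP))// -big_seq -!mulr_sumr exchange_big/=.
(* Each child has volume at least lam1 |Q|, so the bound |Q|^(1/2) on the integral of |phi_S| bounds
   the unweighted sum of the |phi_S(P)| by 1 / (lam1 |Q|^(1/2)). *)
have sumP S : S \in pairs k Q ->
    \sum_(P <- child_cells G k Q) `|haar_val m S P| * normc (haar_coef m f S) `^ p <=
    (lam1 * r)^-1 * normc (haar_coef m f S) `^ p.
  move=> hS; rewrite -mulr_suml ler_wpM2r ?powR_ge0//.
  have := haar_val_mass_pairs GQ hS; rewrite -/r => hr.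
  have : lam1 * vol Q * \sum_(P <- child_cells G k Q) `|haar_val m S P| <= r.
    apply: le_trans hr; rewrite mulr_sumr big_seq [leRHS]big_seq; apply: ler_sum => P.
    move=> /(child_cellsP hG)[GP PQ]; rewrite ler_wpM2r//.
    by case: (child_vol hG GQ GP PQ).
  have -> : vol Q = r * r by rewrite -expr2 sqr_sqrtr// ltW.
  move=> h; rewrite -[leRHS]mul1r ler_pdivlMr ?mulr_gt0//.
  rewrite -(ler_pM2r r0) mul1r; apply: le_trans h.
  by rewrite le_eqVlt; apply/orP; left; apply/eqP; ring.
apply: (@le_trans _ _ (M `^ p * vol Q `^ (1 - s * p) * ((C_H lam1 lam2 / r) `^ (p - 1) * ((lam1 * r)^-1 * X)))).
  rewrite !ler_wpM2l ?mulr_ge0 ?powR_ge0//.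
  by rewrite big_seq (le_trans (ler_sum _ sumP))// -big_seq -mulr_sumr.
rewrite mulrA [leRHS]mulrA [X in X <= _](_ : _ = (M `^ p * C_H lam1 lam2 `^ (p - 1) / lam1) * vol Q `^ (1 - s * p - p / 2) * X).
  by rewrite !ler_wpM2r ?powR_ge0// C_e_ge.
rewrite powRM ?invr_ge0 ?(ltW CH0) ?(ltW r0)//.
have -> : vol Q `^ (1 - s * p - p / 2) = vol Q `^ (1 - s * p) * (r^-1 `^ (p - 1) * r^-1).
  rewrite -[X in _ * (_ * X)]powRr1 ?invr_ge0 ?(ltW r0)// -powRD; last first.
    by rewrite (gt_eqF (_ : 0 < r^-1)) ?invr_gt0// implybT.
  rewrite subrK -(powR_inv1 (ltW r0)) -powRrM mulN1r /r sqrt_powR// -powRD; last first.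
    by rewrite (gt_eqF v0) implybT.
  by congr (_ `^ _); ring.
by field; rewrite !gt_eqF.
Qed.

Lemma N_st_le_N_haar (q : \bar R) : (1 <= q)%E ->
  (N_st m G ord s p q pt f <= (C_e lam1 lam2 s p)%:E * N_haar m G ord s p q f)%E.
Proof.
move=> hq; have CH1 := C_H_ge1; have CH0 : 0 <= C_H lam1 lam2 by exact: le_trans CH1.
have Ce1 : 1 <= C_e lam1 lam2 s p.
  by rewrite /C_e lerDl !mulr_ge0 ?powR_ge0// le_max powR_ge0.
have Ce0 : 0 <= C_e lam1 lam2 s p by exact: le_trans Ce1.
have mixed0 a : (0 <= mixed_norm p q a)%E by exact: mixed_norm_ge0.
have first0 : (0 <= (vol setT `^ (p^-1 - s - 2^-1) * normc (haar_coef0 m f))%:E)%E.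
  by rewrite lee_fin mulr_ge0 ?powR_ge0 ?normc_ge0.
rewrite /N_st /N_haar muleDr// ?ge0_adde_def ?inE//.
have haar0 k : 0 <= \sum_(Q <- cells G k) vol Q `^ (1 - s * p - p / 2) *
    \sum_(S \in haar_pairs G ord k Q) normc (haar_coef m f S) `^ p.
  by apply: sumr_ge0 => Q _; rewrite mulr_ge0 ?powR_ge0//; apply: sumr_ge0 => S _; exact: powR_ge0.
apply: leeD.
  rewrite /st_coef0 Normc.normcM normc_real ger0_norm ?powR_ge0//.
  by rewrite -[leLHS]mul1e lee_wpmul2r.
rewrite -mixed_normZ//; last by move=> k; rewrite lee_fin (fsbig_cells hG).
apply: le_mixed_norm => // k.
  by rewrite lee_fin sumr_ge0// => P _; exact: powR_ge0.
rewrite -EFinM lee_fin !(fsbig_cells hG) (sum_child_cells hG) mulr_sumr.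
rewrite big_seq [leRHS]big_seq; apply: ler_sum => Q /(cellsP hG) GQ.
exact: st_level_le.
Qed.

End L1_function.
End haar_grid.

(** * From a Besov representation to oscillations *)

Section series_facts.
Context {R : realType}.
Local Open Scope ereal_scope.
Implicit Types (p : R) (q : \bar R).

Lemma nneseries_le (u : nat -> \bar R) (C : \bar R) : (forall k, 0 <= u k) ->
  (forall n, \sum_(0 <= k < n) u k <= C) -> \sum_(0 <= k <oo) u k <= C.
Proof.
move=> u0 uC; apply: lime_le; first by apply: is_cvg_nneseries => k _ _; exact: u0.
by apply: nearW => n; exact: uC.
Qed.

Lemma sum_geometric_le (z : R) n : (0 <= z)%R -> (z < 1)%R ->
  (\sum_(0 <= k < n) z ^+ k <= (1 - z)^-1)%R.
Proof.
move=> z0 z1; rewrite -[leRHS]mul1r ler_pdivlMr ?subr_gt0// mulrC big_mkord.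
have := subrX1 z n; rewrite -opprB -[(z - 1)%R]opprB mulNr => /oppr_inj <-.
by rewrite lerBlDr lerDl exprn_ge0.
Qed.

(** For finite q, every partial sum of the series is controlled by a truncated norm; for q infinite,
    entry k appears in the truncation at k+1. *)
Lemma mixed_norm_trunc p q (a : nat -> \bar R) (C : \bar R) : (1 <= p)%R -> 1 <= q ->
  (forall k, 0 <= a k) ->
  (forall K, mixed_norm p q (fun k => if (k < K)%N then a k else 0) <= C) ->
  mixed_norm p q a <= C.
Proof.
move=> p1 q1 a0 aC; have p0 : (0 < p)%R by apply: lt_le_trans p1.
have C0 : 0 <= C by apply: le_trans (aC 0%N); exact: mixed_norm_ge0.
case: q q1 aC => [r|_ aC|//].
  rewrite lee_fin => r1 aC; have r0 : (0 < r)%R by apply: lt_le_trans r1.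
  have -> : C = (C `^ r) `^ r^-1 by rewrite -poweRrM divff ?gt_eqF// poweRe1.
  apply: le_poweR; first by rewrite invr_ge0 ltW.
    by apply: nneseries_ge0 => k _ _; exact: poweR_ge0.
  apply: nneseries_le => [k|n]; first exact: poweR_ge0.
  apply: le_trans (le_poweR (ltW r0) (mixed_norm_ge0 p _ _) (aC n)); last by rewrite lee_fin.
  rewrite /mixed_norm -poweRrM mulVf ?gt_eqF// poweRe1; last first.
    by apply: nneseries_ge0 => k _ _; exact: poweR_ge0.
  apply: le_trans (@nneseries_lim_ge _ _ xpredT _ n _); last by move=> k _ _; exact: poweR_ge0.
  rewrite !big_mkord; apply: lee_sum => k _; by rewrite ltn_ord.
apply: ge_ereal_sup => _ [k _ <-]; apply: le_trans (aC k.+1).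
by apply: ereal_sup_ubound; exists k => //; rewrite ltnSn.
Qed.

(** The triangle inequality over K entries. The linear growth in K is harmless because the error is
    chosen after K. *)
Lemma mixed_norm_cst_trunc p q (e : R) K : (1 <= p)%R -> 1 <= q -> (0 <= e)%R ->
  mixed_norm p q (fun k => ((if (k < K)%N then e else 0%R) `^ p)%:E) <= (K%:R * e)%:E.
Proof.
move=> p1 q1 e0; have p0 : (0 < p)%R by apply: lt_le_trans p1.
elim: K => [|K ih].
  rewrite mul0r mixed_norm_Lnorm// (_ : EFin \o _ = cst 0)//.
  by rewrite Lnorm0// gt_eqF// (lt_le_trans _ q1).
apply: le_trans (@mixed_norm_recl _ p q (fun k => if (k < K.+1)%N then e else 0%R) p1 q1 _) _.
  by move=> k; case: ifP.
apply: (@le_trans _ _ (e%:E + (K%:R * e)%:E)); first exact: leeD2l.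
by rewrite -EFinD -natr1 mulrDl mul1r addrC.
Qed.

(* The discrete Young inequality [l^q * l^1 -> l^q] for a geometric kernel;
   the error terms [e] allow for a remainder that is only pointwise small. *)
Lemma mixed_norm_young p q (z : R) (b dl : nat -> R) : (1 <= p)%R -> 1 <= q ->
  (0 <= z)%R -> (z < 1)%R -> (forall k, 0 <= b k)%R -> (forall k, 0 <= dl k)%R ->
  (forall K (e : R), (0 < e)%R -> exists M, forall k, (k < K)%N ->
     dl k <= \sum_(i < M) z ^+ i * b (k + i)%N + e)%R ->
  mixed_norm p q (fun k => (dl k `^ p)%:E) <=
  ((1 - z)^-1)%:E * mixed_norm p q (fun k => (b k `^ p)%:E).
Proof.
move=> p1 q1 z0 z1 b0 d0 hd; have p0 : (0 < p)%R by apply: lt_le_trans p1.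
apply: mixed_norm_trunc => // [k|K]; first by rewrite lee_fin powR_ge0.
apply/lee_addgt0Pr => e e0.
(* The errors on K levels add up to at most [e]; [K.+1] keeps the quotient meaningful for K = 0. *)
have eK : (0 < e / K.+1%:R)%R by rewrite divr_gt0.
have [M hM] := hd K _ eK.
have s0 k : (0 <= \sum_(i < M) z ^+ i * b (k + i)%N)%R.
  by apply: sumr_ge0 => i _; rewrite mulr_ge0// exprn_ge0.
have t0 k : (0 <= if (k < K)%N then (e / K.+1%:R) else 0)%R by case: ifP => // _; exact: ltW.
apply: (@le_trans _ _ (mixed_norm p q (fun k =>
   ((\sum_(i < M) z ^+ i * b (k + i)%N + (if (k < K)%N then (e / K.+1%:R) else 0)) `^ p)%:E))%R).
  apply: le_mixed_norm => // k; first by case: ifP => // _; rewrite lee_fin powR_ge0.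
  case: ifP => kK; last by rewrite lee_fin powR_ge0.
  by rewrite lee_fin ge0_ler_powR// ?nnegrE ?(ltW p0) ?addr_ge0 ?(ltW eK) ?d0 ?hM ?s0.
apply: (le_trans (mixed_normD p1 q1 s0 t0)); apply: leeD.
  apply: le_trans (@mixed_norm_sum _ p q M (fun i k => z ^+ i * b (k + i)%N)%R p1 q1 _) _.
    by move=> i k; rewrite mulr_ge0// exprn_ge0.
  apply: (@le_trans _ _ (\sum_(i < M) (z ^+ i)%:E * mixed_norm p q (fun k => (b k `^ p)%:E))).
    apply: lee_sum => i _.
    rewrite (_ : (fun k => _) = (fun k => ((z ^+ i) `^ p)%:E * (b (k + i)%N `^ p)%:E)); last first.
      by apply/funext => k; rewrite powRM ?exprn_ge0// EFinM.
    have zi0 : (0 <= z ^+ i)%R by rewrite exprn_ge0.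
    have bi0 k : 0 <= (b (k + i)%N `^ p)%:E by rewrite lee_fin powR_ge0.
    apply: (@le_trans _ _ ((z ^+ i)%:E * mixed_norm p q (fun k => (b (k + i)%N `^ p)%:E))).
      rewrite le_eqVlt; apply/orP; left; apply/eqP; exact: (mixed_normZ p1 q1 zi0 bi0).
    apply: lee_wpmul2l; first by rewrite lee_fin exprn_ge0.
    apply: (@mixed_norm_shift _ p q (fun k => (b k `^ p)%:E)) => // k.
    by rewrite lee_fin powR_ge0.
  rewrite -ge0_sume_distrl; last by move=> i _; rewrite lee_fin exprn_ge0.
  apply: lee_wpmul2r; first exact: mixed_norm_ge0.
  by rewrite sumEFin lee_fin -(big_mkord xpredT (fun i => z ^+ i)%R) sum_geometric_le.
apply: le_trans (mixed_norm_cst_trunc _ _ _ _) _ => //; first exact: ltW.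
rewrite lee_fin mulrCA ger_pMr// ler_pdivrMr// mul1r ler_nat//.
Qed.

End series_facts.

Section besov_to_osc.
Context d (T : measurableType d) (R : realType).
Variable m : {finite_measure set T -> \bar R}.
Variables (lam1 lam2 : R) (G : nat -> set (set T)).
Hypothesis hlam : [/\ 0 < lam1, lam1 < lam2 & lam2 < 1].
Hypothesis hG : good_grid m lam1 lam2 G.
Variables (s p : R) (q : \bar R).
Hypotheses (hs : 0 < s) (hp : 1 <= p) (hq : (1 <= q)%E).
Local Notation vol := (vol m).
Local Notation normc := Normc.normc.
Local Notation "'N[ h ]" := (Lnorm m p%:E (EFin \o h)).

Let p0 : 0 < p. Proof. exact: lt_le_trans hp. Qed.

Lemma lam2_powR_lt1 (r : R) : 0 < r -> lam2 `^ r < 1.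
Proof.
move=> r0; have : lam2 `^ r < 1 `^ r.
  by rewrite gt0_ltr_powR// ?nnegrE ?ler01 ?(ltW (lam2_gt0 hlam))// (lam2_lt1 hlam).
by rewrite powR1.
Qed.

Lemma Gamma_ge0 : (0 <= Gamma m G s q)%E.
Proof.
have sup0 : (0 <= ereal_sup (range (fun k => (mesh m G k `^ s)%:E)))%E.
  apply: (@le_trans _ _ (mesh m G 0%N `^ s)%:E); first by rewrite lee_fin powR_ge0.
  by apply: ereal_sup_ubound; exists 0%N.
by rewrite /Gamma; case: (hoelder_conjugate q) => [r| |] //; exact: poweR_ge0.
Qed.

(** On a cell P the bound contributes at most (C e_P)^p to the integral, the factor |P|^(-1/p)
    compensating the volume of P. *)
Lemma Lnorm_step_le k (h : T -> R) (e : set T -> R) (C : R) : 0 <= C ->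
  (forall P, 0 <= e P) -> measurable_fun setT h -> (forall x, 0 <= h x) ->
  (forall P x, G k P -> P x -> h x <= C * (e P * vol P `^ (- p^-1))) ->
  ('N[h] <= (C * (\sum_(P <- cells G k) e P `^ p) `^ p^-1)%:E)%E.
Proof.
move=> C0 e0 mh h0 hle; rewrite LnormE//.
have S0 : 0 <= \sum_(P <- cells G k) e P `^ p by apply: sumr_ge0 => P _; exact: powR_ge0.
rewrite (_ : C * _ = (C `^ p * \sum_(P <- cells G k) e P `^ p) `^ p^-1); last first.
  by rewrite powRM ?powR_ge0// -powRrM divff ?gt_eqF// powRr1.
rewrite -poweR_EFin; apply: le_poweR; first by rewrite invr_ge0 ltW.
  by apply: integral_ge0 => x _; rewrite lee_fin powR_ge0.
rewrite (ge0_integral_cells hG k); last 2 first.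
- exact: measurable_powR_EFin.
- by move=> x; rewrite lee_fin powR_ge0.
rewrite mulr_sumr -sumEFin big_seq [leRHS]big_seq; apply: lee_sum => P /(cellsP hG) GP.
have mP := measurable_cell hG GP; have vP := vol_gt0 hG GP.
apply: (@le_trans _ _ (\int[m]_(x in P) (cst ((C * (e P * vol P `^ (- p^-1))) `^ p)%:E x))%E).
  apply: ge0_le_integral => //.
  - by move=> x _; rewrite lee_fin powR_ge0.
  - by apply: measurable_funTS; exact: measurable_powR_EFin.
  - move=> x Px; rewrite lee_fin ge0_ler_powR ?(ltW p0)// ?nnegrE//.
      by rewrite !mulr_ge0 ?powR_ge0.
    exact: hle.
rewrite integral_cst//; have mPE : m P = (vol P)%:E by exact: volE.
rewrite [X in (_ * X <= _)%E]mPE -EFinM lee_fin !powRM ?mulr_ge0 ?powR_ge0//.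
rewrite -powRrM mulNr mulVf ?gt_eqF// powR_inv1 ?vol_ge0//.
by rewrite -!mulrA mulVf ?gt_eqF// mulr1.
Qed.

(** The definition bounds only an essential supremum. A constant value on Q exceeding the bound
    would violate it on all of Q, a set of positive measure. *)
Lemma souza_atom_bound k Q a x : G k Q -> souza_atom m s p Q a -> Q x ->
  normc (a x) <= vol Q `^ (s - p^-1).
Proof.
move=> GQ [[c ac] _ le] Qx; rewrite leNgt; apply/negP => gt.
have mT0 : (0 < m setT)%E.
  by apply: (grid_pos hG (k := 0%N)); rewrite (grid0 hG).
move: le; rewrite /cLnorm unlock /= mT0 => /ess_supP[N [mN N0 subN]].
have : (m Q <= m N)%E.
  apply: le_measure; rewrite ?mem_set//; first exact: (measurable_cell hG GQ).
  move=> y Qy; apply: subN => /=; rewrite lee_fin ger0_norm ?normc_ge0//.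
  by rewrite (ac _ Qy) -(ac _ Qx) leNgt gt.
by rewrite N0 leNgt (grid_pos hG GQ).
Qed.

(** * Levels and remainders of a Besov representation *)

Section representation.
Variables (c : set T -> R[i]) (a : set T -> T -> R[i]).
Hypothesis atoms : forall k Q, G k Q -> souza_atom m s p Q (a Q).

Lemma level_sum_cell k P x : G k P -> P x -> level_sum G c a k x = c P * a P x.
Proof.
move=> GP Px; rewrite /level_sum (fsbig_cells hG) (bigD1_seq P) ?cells_uniq//=; last exact/(cellsP hG).
rewrite big1_seq ?addr0// => Q /andP[QP /(cellsP hG) GQ].
have [_ -> //] := atoms GQ; first by rewrite mulr0.
by move=> Qx; move: QP; rewrite (cell_eq hG GQ GP Qx Px) eqxx.
Qed.

Lemma level_sum_cst j k Q x y : (j <= k)%N -> G k Q -> Q x -> Q y ->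
  level_sum G c a j x = level_sum G c a j y.
Proof.
move=> jk GQ Qx Qy.
have [P GP QP] : exists2 P, G j P & Q `<=` P.
  by apply: (cell_ancestor hG (n := k - j)); rewrite subnK.
rewrite (level_sum_cell GP (QP _ Qx)) (level_sum_cell GP (QP _ Qy)).
by have [[v av] _ _] := atoms GP; rewrite !av//; exact: QP.
Qed.

Lemma cmeasurable_level_sum k : cmeasurable (level_sum G c a k).
Proof.
(* The level is rewritten as a step function with the value of each atom read off at a chosen point
   of its cell; the guard below gives measurability at every index. *)
pose v Q := c Q * a Q (xget point Q).
have E : level_sum G c a k = fun x => \sum_(Q <- cells G k) (if `[< G k Q >] then
    v Q * real_complex R (\1_Q x) else 0).
  apply/funext => x; rewrite /level_sum (fsbig_cells hG).
  apply: eq_big_seq => Q /(cellsP hG) GQ; rewrite asboolT//.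
  have [[w aw] a0 _] := atoms GQ; rewrite indicE.
  have [y Qy] := cell_nonempty hG GQ.
  have Qp : Q (xget point Q) by apply: (@xgetPex _ point Q); exists y.
  have [/set_mem Qx|/negP nQx] := boolP (x \in Q).
    by rewrite /v !aw// (_ : real_complex R true%:R = 1) ?mulr1//.
  rewrite a0; first by rewrite mulr0 (_ : real_complex R false%:R = 0) ?mulr0.
  by move=> Qx; apply: nQx; exact: mem_set.
rewrite E; apply: cmeasurable_sum => Q; case: asboolP => GQ; last exact: cmeasurable_cst.
have mQ := measurable_cell hG GQ.
split.
  under eq_fun do rewrite Re_realM; apply: measurable_funM => //.
under eq_fun do rewrite Im_realM; apply: measurable_funM => //.
Qed.

Lemma normc_level_sum k P x : G k P -> P x ->
  normc (level_sum G c a k x) <= normc (c P) * vol P `^ (s - p^-1).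
Proof.
move=> GP Px; rewrite (level_sum_cell GP Px) Normc.normcM ler_wpM2l ?normc_ge0//.
exact: (souza_atom_bound GP (atoms GP) Px).
Qed.

Definition level_cost k := (\sum_(Q <- cells G k) normc (c Q) `^ p) `^ p^-1.

Lemma level_cost_ge0 k : 0 <= level_cost k. Proof. exact: powR_ge0. Qed.

Lemma besov_costE : besov_cost G p q c = mixed_norm p q (fun k => (level_cost k `^ p)%:E).
Proof.
rewrite /besov_cost; congr mixed_norm; apply/funext => k.
rewrite (fsbig_cells hG) /level_cost -powRrM mulVf ?gt_eqF// powRr1//.
by apply: sumr_ge0 => Q _; exact: powR_ge0.
Qed.

(** The weight [U] serves two purposes: U = 1 with C = [mesh ^ s] for the L^p norm of f, and U =
    [cell_weight] with C a power of lam2^s for the oscillations. *)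
Lemma Lnorm_level_sum k (U : T -> R) (C : R) : 0 <= C -> measurable_fun setT U ->
  (forall x, 0 <= U x) ->
  (forall P x, G k P -> P x -> U x * vol P `^ s <= C) ->
  ('N[(fun x => U x * normc (level_sum G c a k x))%R] <= (C * level_cost k)%:E)%E.
Proof.
move=> C0 mU U0 UC; apply: Lnorm_step_le => //.
- by move=> P; exact: normc_ge0.
- by apply: measurable_funM => //; apply: measurable_normc; exact: cmeasurable_level_sum.
- by move=> x; rewrite mulr_ge0 ?normc_ge0.
- move=> P x GP Px; have vP := vol_gt0 hG GP.
  apply: (@le_trans _ _ (U x * (normc (c P) * vol P `^ (s - p^-1)))).
    by rewrite ler_wpM2l// normc_level_sum.
  rewrite powRD; last by rewrite (gt_eqF vP) implybT.
  rewrite (_ : _ * _ = U x * vol P `^ s * (normc (c P) * vol P `^ (- p^-1))); last by ring.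
  by rewrite ler_wpM2r ?mulr_ge0 ?normc_ge0 ?powR_ge0//; exact: UC GP Px.
Qed.

Lemma level_mesh_le k P : G k P -> vol P `^ s <= mesh m G k `^ s.
Proof.
move=> GP; rewrite ge0_ler_powR ?(ltW hs)// ?nnegrE ?vol_ge0 ?(mesh_ge0 hG)//.
exact: (vol_le_mesh hG GP).
Qed.

(** Hölder's inequality across the levels; [Gamma] is [conj_norm] of the sequence [mesh ^ s]. *)
Lemma mesh_cost_le : (\sum_(0 <= k <oo) (mesh m G k `^ s * level_cost k)%:E <=
  Gamma m G s q * besov_cost G p q c)%E.
Proof.
have mesh0 k : 0 <= mesh m G k `^ s by exact: powR_ge0.
rewrite besov_costE.
apply: le_trans (mixed_norm_hoelder hp hq mesh0 level_cost_ge0) _.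
apply: lee_wpmul2r; first exact: mixed_norm_ge0.
rewrite le_eqVlt; apply/orP; left; apply/eqP; rewrite /conj_norm /Gamma.
case: (hoelder_conjugate q) => [r| |] //; congr (_ `^ _)%E.
by apply: eq_eseriesr => k _; rewrite -powRrM.
Qed.

Lemma cLnorm_level_sum_le k :
  (cLnorm m p%:E (level_sum G c a k) <= (mesh m G k `^ s * level_cost k)%:E)%E.
Proof.
apply: (@le_trans _ _ ('N[(fun x => cst 1 x * normc (level_sum G c a k x))%R])%E).
  rewrite le_eqVlt; apply/orP; left; apply/eqP; apply: eq_Lnorm => x /=.
  by rewrite mul1r.
apply: Lnorm_level_sum => //; first exact: powR_ge0.
by move=> P x GP Px; rewrite mul1r level_mesh_le.
Qed.

Section sum_representation.
Variable f : T -> R[i].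
Hypothesis rep : besov_rep m G s p q f c a.

Let mf : cmeasurable f. Proof. by case: (rep_Lp rep). Qed.

Definition remainder n x := f x - \sum_(k < n) level_sum G c a k x.

Lemma cmeasurable_remainder n : cmeasurable (remainder n).
Proof.
apply: cmeasurableB => //; apply: cmeasurable_sum => i; exact: cmeasurable_level_sum.
Qed.

(** Minkowski's inequality peels off M levels and keeps the later remainder, since L^p convergence
    makes remainders small only far out. *)
Lemma remainder_le (U : T -> R) (C : nat -> R) n M : measurable_fun setT U ->
  (forall x, 0 <= U x) -> (forall i, 0 <= C i) ->
  (forall i P x, G (n + i)%N P -> P x -> U x * vol P `^ s <= C i) ->
  ('N[(fun x => U x * normc (remainder n x))%R] <=
    (\sum_(i < M) C i * level_cost (n + i)%N)%:E +
    'N[(fun x => U x * normc (remainder (n + M)%N x))%R])%E.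
Proof.
move=> mU U0 C0 UC; elim: M => [|M ih]; first by rewrite big_ord0 add0e addn0.
apply: (le_trans ih); rewrite big_ord_recr/= EFinD -addeA leeD2l//.
have mN g : cmeasurable g -> measurable_fun setT (fun x => U x * normc (g x)).
  by move=> mg; apply: measurable_funM => //; exact: measurable_normc.
have mL := cmeasurable_level_sum (n + M)%N.
apply: (@le_trans _ _ ('N[((fun x => U x * normc (level_sum G c a (n + M)%N x)) \+
    (fun x => U x * normc (remainder (n + M.+1)%N x)))%R])%E).
  apply: le_Lnorm => //.
  - by apply: mN; exact: cmeasurable_remainder.
  - by apply: measurable_funD; apply: mN => //; exact: cmeasurable_remainder.
  - by move=> x; rewrite mulr_ge0 ?normc_ge0.
  - move=> x /=; rewrite -mulrDr ler_wpM2l//.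
    rewrite (_ : remainder (n + M)%N x = level_sum G c a (n + M)%N x + remainder (n + M.+1)%N x).
      exact: le_normcD.
    by rewrite /remainder addnS big_ord_recr/=; ring.
apply: (le_trans (minkowski_EFin _ _ _ hp)).
- exact: mN.
- by apply: mN; exact: cmeasurable_remainder.
rewrite leeD2r//; apply: Lnorm_level_sum => // P x GP Px; exact: UC GP Px.
Qed.

Lemma remainder_small (e : R) : 0 < e ->
  exists N, forall n, (N <= n)%N -> (cLnorm m p%:E (remainder n) <= e%:E)%E.
Proof.
move=> e0; have /fine_cvgP[fin /cvgrPdist_lt/(_ _ e0) lim] := rep_sum rep.
have [N _ hN] := filterI fin lim; exists N => n /hN [/= fn].
rewrite sub0r normrN => /ltW h; rewrite -[leLHS](fineK fn) lee_fin.
exact: le_trans (ler_norm _) h.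
Qed.

(** The threshold N depends on the weight only through its bound B. Dividing by [B + 1] also covers
    B = 0. *)
Lemma weighted_remainder_small (e B : R) : 0 < e -> 0 <= B ->
  exists N, forall n (U : T -> R), (N <= n)%N -> measurable_fun setT U ->
    (forall x, 0 <= U x) -> (forall x, U x <= B) ->
    ('N[(fun x => U x * normc (remainder n x))%R] <= e%:E)%E.
Proof.
move=> e0 B0; have eB : 0 < e / (B + 1) by rewrite divr_gt0// ltr_wpDl.
have [N hN] := remainder_small eB; exists N => n U Nn mU U0 UB.
have mr := measurable_normc (cmeasurable_remainder n).
apply: (@le_trans _ _ ('N[(fun x => (B + 1) * normc (remainder n x))%R])%E).
  apply: le_Lnorm => //.
  - exact: measurable_funM.
  - exact: measurable_funM.
  - by move=> x; rewrite mulr_ge0 ?normc_ge0.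
  - by move=> x; rewrite ler_wpM2r ?normc_ge0// (le_trans (UB x))// lerDl.
have B10 : 0 < B + 1 by rewrite ltr_wpDl.
rewrite LnormZ_ge0 ?(ltW B10)//; last by move=> x; exact: normc_ge0.
apply: (@le_trans _ _ ((B + 1)%:E * (e / (B + 1))%:E)%E).
  by apply: lee_wpmul2l; [rewrite lee_fin ltW|exact: hN].
by rewrite -EFinM mulrC divfK ?gt_eqF.
Qed.

(** The remainder of index 0 is f itself, so the peeling estimate with weight 1 applies, up to an
    arbitrarily small last remainder. *)
Lemma cLnorm_le_Gamma :
  (cLnorm m p%:E f <= Gamma m G s q * besov_cost G p q c)%E.
Proof.
apply: le_trans mesh_cost_le.
apply/lee_addgt0Pr => e e0.
have [N hN] := weighted_remainder_small e0 (@ler01 R).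
apply: (@le_trans _ _ ('N[(fun x => 1 * normc (remainder 0 x))%R])%E).
  rewrite le_eqVlt; apply/orP; left; apply/eqP; apply: eq_Lnorm => x /=.
  by rewrite /remainder big_ord0 subr0 mul1r.
apply: (le_trans (@remainder_le (cst 1) (fun k => mesh m G k `^ s) 0%N N _ _ _ _)) => //.
    by move=> i; exact: powR_ge0.
  by move=> i P x GP Px; rewrite mul1r level_mesh_le.
apply: leeD; last by apply: hN => //= x.
rewrite -sumEFin -(big_mkord xpredT (fun k => (mesh m G k `^ s * level_cost (0 + k)%N)%:E)).
apply: (le_trans _ (@nneseries_lim_ge _ _ xpredT _ N _)); first by [].
by move=> k _ _; rewrite lee_fin mulr_ge0 ?level_cost_ge0 ?powR_ge0.
Qed.

(* Multiplying by [cell_weight k] turns the level-[k] sum of weighted oscillations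
   into a single [L^p] norm, to which Minkowski's inequality applies. *)
Definition cell_weight k (x : T) : R := \sum_(Q <- cells G k) vol Q `^ (- s) * \1_Q x.

Lemma cell_weightE k Q x : G k Q -> Q x -> cell_weight k x = vol Q `^ (- s).
Proof.
move=> GQ Qx; rewrite /cell_weight (bigD1_seq Q) ?cells_uniq//=; last exact/(cellsP hG).
rewrite indicE mem_set// mulr1 big1_seq ?addr0// => Q' /andP[Q'Q /(cellsP hG) GQ'].
rewrite indicE memNset ?mulr0// => Q'x.
by move: Q'Q; rewrite (cell_eq hG GQ' GQ Q'x Qx) eqxx.
Qed.

Lemma cell_weight_ge0 k x : 0 <= cell_weight k x.
Proof. by apply: sumr_ge0 => Q _; rewrite mulr_ge0 ?powR_ge0. Qed.

Lemma cell_weight_le k x : cell_weight k x <= \sum_(Q <- cells G k) vol Q `^ (- s).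
Proof.
by apply: ler_sum => Q _; rewrite ler_piMr ?powR_ge0.
Qed.

Lemma measurable_cell_weight k : measurable_fun setT (cell_weight k).
Proof.
rewrite (_ : cell_weight k = fun x => \sum_(Q <- cells G k)
   (if `[< G k Q >] then vol Q `^ (- s) * \1_Q x else 0)); last first.
  by apply/funext => x; apply: eq_big_seq => Q /(cellsP hG) GQ; rewrite asboolT.
apply: measurable_sum => Q; case: asboolP => GQ; last exact: measurable_cst.
apply: measurable_funM => //; apply: measurable_indic; exact: (measurable_cell hG GQ).
Qed.

(** P lies i+1 generations below the cell of level k that carries the weight, so its volume has
    shrunk by at least lam2^(i+1). *)
Lemma cell_weight_vol k i P x : G (k.+1 + i)%N P -> P x ->
  cell_weight k x * vol P `^ s <= (lam2 `^ s) ^+ i.+1.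
Proof.
move=> GP Px; have [Q GQ PQ] : exists2 Q, G k Q & P `<=` Q.
  by apply: (cell_ancestor hG (n := i.+1)); rewrite addSn addnC -addSn.
have vQ := vol_gt0 hG GQ; have l2 := lam2_gt0 hlam.
rewrite (cell_weightE GQ (PQ _ Px)) powRN ler_pdivrMl ?powR_gt0//.
have -> : (lam2 `^ s) ^+ i.+1 = (lam2 ^+ i.+1) `^ s.
  by rewrite -powR_mulrn ?powR_ge0// -powRrM mulrC powRrM powR_mulrn ?(ltW l2).
rewrite -powRM ?vol_ge0 ?exprn_ge0 ?(ltW l2)//.
rewrite ge0_ler_powR ?(ltW hs)// ?nnegrE ?mulr_ge0 ?vol_ge0 ?exprn_ge0 ?(ltW l2)//.
rewrite mulrC; apply: (vol_decay hlam hG GQ) => //.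
by move: GP; rewrite addSn addnC -addSn.
Qed.

Definition osc_bound k := 'N[(fun x => cell_weight k x * normc (remainder k.+1 x))%R]%E.

(** A single number of levels M serves all k < K because finitely many thresholds have a maximum.
    This is the form in which the Young inequality takes its premise. *)
Lemma osc_bound_le (K : nat) (e : R) : 0 < e -> exists M, forall k, (k < K)%N ->
  (osc_bound k <= (\sum_(i < M) (lam2 `^ s) ^+ i * level_cost (k + i)%N + e)%:E)%E.
Proof.
move=> e0; have z0 : 0 <= lam2 `^ s by exact: powR_ge0.
have small k : exists N, forall n, (N <= n)%N ->
    ('N[(fun x => cell_weight k x * normc (remainder n x))%R] <= e%:E)%E.
  have B0 : 0 <= \sum_(Q <- cells G k) vol Q `^ (- s) by apply: sumr_ge0 => Q _; exact: powR_ge0.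
  have [N hN] := weighted_remainder_small e0 B0; exists N => n Nn; apply: hN => //.
  - exact: measurable_cell_weight.
  - by move=> x; exact: cell_weight_ge0.
  - by move=> x; exact: cell_weight_le.
have [N hN] := choice small.
exists (\max_(k < K) N k).+1 => k kK; set M := \max_(k < K) N k.
apply: (le_trans (@remainder_le (cell_weight k) (fun i => (lam2 `^ s) ^+ i.+1) k.+1 M _ _ _ _)).
- exact: measurable_cell_weight.
- by move=> x; exact: cell_weight_ge0.
- by move=> i; exact: exprn_ge0.
- by move=> i P x; exact: cell_weight_vol.
rewrite EFinD; apply: leeD; last first.
  apply: hN; rewrite (leq_trans _ (leq_addl _ _))//.
  by rewrite /M -[k in N k]/(nat_of_ord (Ordinal kK)) (leq_bigmax (Ordinal kK)).
(* Level k+1+i carries the exponent i+1. Adding the nonnegative term of level k gives a kernel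
   starting at exponent 0, with sum at most 1/(1 - lam2^s) as in [C_o]; the successor in the witness
   makes room for it. *)
rewrite lee_fin big_ord_recl/= addn0.
rewrite -[leLHS]add0r lerD ?mulr_ge0 ?level_cost_ge0//.
by apply: ler_sum => i _; rewrite /bump/= add1n addnS addSn.
Qed.

Lemma osc_sum_le k :
  (\sum_(Q \in G k) (vol Q `^ (- (s * p)))%:E * (osc m p f Q `^ p)
   <= osc_bound k `^ p)%E.
Proof.
have mW : measurable_fun setT (fun x => cell_weight k x * normc (remainder k.+1 x)).
  apply: measurable_funM; first exact: measurable_cell_weight.
  by apply: measurable_normc; exact: cmeasurable_remainder.
have W0 x : 0 <= cell_weight k x * normc (remainder k.+1 x).
  by rewrite mulr_ge0 ?normc_ge0 ?cell_weight_ge0.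
rewrite /osc_bound LnormE// -poweRrM mulVf ?gt_eqF// poweRe1; last first.
  by apply: integral_ge0 => x _; rewrite lee_fin powR_ge0.
rewrite (ge0_integral_cells hG k); last 2 first.
- exact: measurable_powR_EFin.
- by move=> x; rewrite lee_fin powR_ge0.
rewrite (fsbig_cells hG) big_seq [leRHS]big_seq; apply: lee_sum => Q /(cellsP hG) GQ.
have [y Qy] := cell_nonempty hG GQ; have mQ := measurable_cell hG GQ.
(* The levels 0 to k are constant on Q; their common value is the competitor in the infimum defining
   the oscillation. *)
set C := \sum_(j < k.+1) level_sum G c a j y.
have mfC : cmeasurable (fun x => f x - C) by apply: cmeasurableB => //; exact: cmeasurable_cst.
have mfCp : measurable_fun setT (fun x => (normc (f x - C) `^ p)%:E).
  by apply: measurable_powR_EFin; exact: measurable_normc.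
have remE x : Q x -> remainder k.+1 x = f x - C.
  move=> Qx; rewrite /remainder; congr (_ - _); apply: eq_bigr => j _.
  by apply: (level_sum_cst _ GQ Qx Qy); rewrite -ltnS.
apply: (@le_trans _ _ ((vol Q `^ (- (s * p)))%:E * \int[m]_(x in Q) (normc (f x - C) `^ p)%:E)%E).
  apply: lee_wpmul2l; first by rewrite lee_fin powR_ge0.
  have I0 : (0 <= \int[m]_(x in Q) (normc (f x - C) `^ p)%:E)%E.
    by apply: integral_ge0 => x _; rewrite lee_fin powR_ge0.
  rewrite -[leRHS](poweRe1 I0) -{1}(mulVf (lt0r_neq0 p0)) poweRrM.
  apply: le_poweR; [exact: ltW|exact: osc_ge0|].
  by apply: ereal_inf_lbound; exists C.
rewrite -ge0_integralZl_EFin ?powR_ge0//; last 2 first.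
- by move=> x _; rewrite lee_fin powR_ge0.
- exact: measurable_funTS.
rewrite le_eqVlt; apply/orP; left; apply/eqP; apply: eq_integral => x /set_mem Qx.
rewrite (cell_weightE GQ Qx) (remE _ Qx) powRM ?powR_ge0 ?normc_ge0//.
by rewrite -powRrM mulNr EFinM.
Qed.

Lemma N_osc_le_cost : (N_osc m G s p q f <= C_o m G lam2 s q * besov_cost G p q c)%E.
Proof.
have z0 : 0 <= lam2 `^ s by exact: powR_ge0.
have z1 : lam2 `^ s < 1.
  exact: lam2_powR_lt1.
have cost0 : (0 <= besov_cost G p q c)%E by exact: mixed_norm_ge0.
have Gamma0 := Gamma_ge0.
rewrite /N_osc /C_o ge0_muleDl ?lee_fin ?invr_ge0 ?subr_ge0 ?(ltW z1) ?mule_ge0//; last first.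
  by rewrite lee_fin powR_ge0.
apply: leeD.
  rewrite [X in (_ <= X)%E](_ : _ = (vol setT `^ (- s))%:E * (Gamma m G s q * besov_cost G p q c))%E.
    by apply: lee_wpmul2l; [rewrite lee_fin powR_ge0|exact: cLnorm_le_Gamma].
  by rewrite muleA [X in (X * _)%E]muleC.
(* Finiteness comes from the preceding bound with error 1, and allows the Young inequality for real
   sequences to be applied. *)
have bound_fin k : osc_bound k \is a fin_num.
  have [M hM] := osc_bound_le k.+1 (@ltr01 R).
  rewrite ge0_fin_numE; last exact: Lnorm_ge0.
  exact: le_lt_trans (hM k (ltnSn k)) (ltry _).
pose dl k := fine (osc_bound k).
have dl0 k : 0 <= dl k by rewrite fine_ge0// Lnorm_ge0.
rewrite besov_costE.
apply: (@le_trans _ _ (mixed_norm p q (fun k => (dl k `^ p)%:E))).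
  apply: le_mixed_norm => // k.
    rewrite (fsbig_cells hG) sume_ge0// => Q _.
    by rewrite mule_ge0 ?lee_fin ?powR_ge0 ?poweR_ge0.
  apply: (le_trans (osc_sum_le k)).
  by rewrite -poweR_EFin /dl fineK.
apply: mixed_norm_young => //; first exact: level_cost_ge0.
move=> K e e0; have [M hM] := osc_bound_le K e0; exists M => k /hM.
by rewrite -[osc_bound k]fineK.
Qed.

End sum_representation.
End representation.
(** The mesh of level k is at most lam2^k |I|, so the defining series is dominated by a geometric
    one, and the supremum by |I|^s. *)
Lemma Gamma_lty : (Gamma m G s q < +oo)%E.
Proof.
have l2 := lam2_gt0 hlam.
have q'1 := hoelder_conj_ge1 hq; rewrite /Gamma.
case: (hoelder_conjugate q) q'1 => [r|_|//].
  rewrite lee_fin => r1; have sr0 : 0 < s * r by rewrite mulr_gt0// (lt_le_trans ltr01).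
  apply: poweR_lty; set z := lam2 `^ (s * r).
  have z0 : 0 <= z by exact: powR_ge0.
  have z1 : z < 1 by exact: lam2_powR_lt1.
  apply: (@le_lt_trans _ _ (vol setT `^ (s * r) * (1 - z)^-1)%:E); last exact: ltry.
  apply: nneseries_le => [k|n]; first by rewrite lee_fin powR_ge0.
  rewrite sumEFin lee_fin.
  apply: (@le_trans _ _ (\sum_(0 <= k < n) vol setT `^ (s * r) * z ^+ k)).
    apply: ler_sum => k _.
    rewrite (_ : z ^+ k = (lam2 ^+ k) `^ (s * r)); last first.
      by rewrite -(powR_mulrn k z0) -(powR_mulrn k (ltW l2)) /z -!powRrM (mulrC k%:R).
    rewrite -powRM ?vol_ge0 ?exprn_ge0 ?(ltW l2)//.
    rewrite ge0_ler_powR ?(ltW sr0)// ?nnegrE ?(mesh_ge0 hG) ?mulr_ge0 ?vol_ge0 ?exprn_ge0 ?(ltW l2)//.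
    by rewrite mulrC; exact: (mesh_le hlam hG).
  by rewrite -mulr_sumr ler_wpM2l ?powR_ge0// sum_geometric_le.
apply: (@le_lt_trans _ _ (vol setT `^ s)%:E); last exact: ltry.
apply: ge_ereal_sup => _ [k _ <-].
rewrite lee_fin ge0_ler_powR ?(ltW hs)// ?nnegrE ?vol_ge0 ?(mesh_ge0 hG)//.
rewrite (le_trans (mesh_le hlam hG k))// ler_piMl ?vol_ge0// exprn_ile1 ?(ltW l2)//.
by rewrite ltW ?(lam2_lt1 hlam).
Qed.

Lemma C_o_fin_num : C_o m G lam2 s q \is a fin_num.
Proof. by rewrite /C_o fin_numD fin_numM// ge0_fin_numE ?Gamma_lty ?Gamma_ge0. Qed.

Lemma C_o_ge1 : (1 <= C_o m G lam2 s q)%E.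
Proof.
have z1 := lam2_powR_lt1 hs.
rewrite /C_o -[leLHS]add0e; apply: leeD.
  by rewrite mule_ge0 ?Gamma_ge0// lee_fin powR_ge0.
by rewrite lee_fin invf_ge1 ?subr_gt0// gerBl powR_ge0.
Qed.

(** [C_o] is finite and positive, so it can be divided out before passing to the infimum over
    representations. *)
Lemma N_osc_le_besov_norm f :
  (N_osc m G s p q f <= C_o m G lam2 s q * besov_norm m G s p q f)%E.
Proof.
have Co1 := C_o_ge1; have Cof := C_o_fin_num.
rewrite -(fineK Cof); have Co0 : 0 < fine (C_o m G lam2 s q).
  by rewrite -lte_fin fineK// (lt_le_trans _ Co1).
rewrite -lee_pdivrMl//; apply: le_ereal_inf_tmp => _ [c [a [rep ->]]].
rewrite lee_pdivrMl// fineK//.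
by apply: (N_osc_le_cost (rep_atom rep) rep).
Qed.

End besov_to_osc.

(** * Recovering a function from its averages over the cells *)

Section recovery.
Context d (T : measurableType d) (R : realType).
Variable m : {finite_measure set T -> \bar R}.
Variables (lam1 lam2 : R) (G : nat -> set (set T)).
Hypothesis hG : good_grid m lam1 lam2 G.

(** The cells form a pi-system generating the sigma-algebra, so equality of integrals over cells
    extends to all measurable sets by Dynkin's theorem. *)
Lemma ae_eq_cells (g w : T -> R) :
  m.-integrable setT (EFin \o g) -> m.-integrable setT (EFin \o w) ->
  (forall k Q, G k Q -> \int[m]_(x in Q) g x = \int[m]_(x in Q) w x) ->
  ae_eq m setT (EFin \o g) (EFin \o w).
Proof.
move=> gi wi gw.
have iS A (h : T -> R) : measurable A -> m.-integrable setT (EFin \o h) -> m.-integrable A (EFin \o h).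
  by move=> mA hi; apply: integrableS hi.
have RE A (h : T -> R) : measurable A -> m.-integrable setT (EFin \o h) ->
    (\int[m]_(x in A) (h x)%:E)%E = (\int[m]_(x in A) h x)%:E.
  by move=> mA hi; rewrite /Rintegral fineK//; apply: integrable_fin_num => //; exact: iS.
(* Two cells are nested or disjoint, so adding the empty set is enough for closure under
   intersection. *)
pose G0 : set (set T) := [set A | A = set0 \/ exists k, G k A].
have mG0 : @measurable _ T = <<s G0 >>.
  rewrite -(grid_generates hG); apply/seteqP; split.
    apply: smallest_sub; first exact: smallest_sigma_algebra.
    by move=> A [k _ GA]; apply: sub_sigma_algebra; right; exists k.
  apply: smallest_sub; first exact: smallest_sigma_algebra.
  move=> A [->|[k GA]]; first exact: sigma_algebra0.
  by apply: sub_sigma_algebra; exists k.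
have G0I : setI_closed G0.
  have sym A B : G0 (A `&` B) -> G0 (B `&` A) by rewrite setIC.
  have key k j A B : (k <= j)%N -> G k A -> G j B -> G0 (A `&` B).
    move=> kj GA GB; have [AB0|/set0P[x [Ax Bx]]] := eqVneq (A `&` B) set0; first by left.
    have BA : B `<=` A by apply: (cell_sub hG (n := j - k) GA _ Ax Bx); rewrite subnK.
    by right; exists j; rewrite (setIidr BA).
  move=> A B [->|[k GA]]; first by rewrite set0I => _; left.
  move=> [->|[j GB]]; first by rewrite setI0; left.
  have [kj|/ltnW jk] := leqP k j; first exact: key kj GA GB.
  by apply: sym; exact: key jk GB GA.
have gwT : \int[m]_x g x = \int[m]_x w x by apply: (gw 0%N); rewrite (grid0 hG).
apply: integral_ae_eq => //; first exact: measurable_int wi.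
move=> E _ mE.
suff : \int[m]_(x in E) g x = \int[m]_(x in E) w x by rewrite !RE// => ->.
apply: (@dynkin_induction _ T G0 (fun A => \int[m]_(x in A) g x = \int[m]_(x in A) w x)) => //.
- by move=> A [->|[k GA]]; [rewrite !Rintegral_set0|exact: gw GA].
- move=> S mS SE; have mSC := measurableC mS.
  have split_int (h : T -> R) : m.-integrable setT (EFin \o h) ->
      \int[m]_x h x = \int[m]_(x in S) h x + \int[m]_(x in ~` S) h x.
    move=> hi; rewrite -(setUv S) Rintegral_setU ?setUv//.
    by rewrite disj_set2E setICr.
  by have := gwT; rewrite (split_int g)// (split_int w)// SE => /addrI.
- move=> F mF tF FE.
  have mU : measurable (\bigcup_k F k) by exact: bigcup_measurable.
  apply: EFin_inj; rewrite -!RE//.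
  rewrite (integral_bigcup tF mF (iS _ _ mU gi)) (integral_bigcup tF mF (iS _ _ mU wi)).
  by apply: eq_eseriesr => n _; rewrite !RE// FE.
- by rewrite -mG0.
Qed.

(** The sequence has an integrable limit by domination. Over each cell its integrals are eventually
    those of w, so dominated convergence gives the limit and w the same cell integrals. *)
Lemma limit_recovery (w : T -> R) (u : nat -> T -> R) (F : T -> \bar R) :
  m.-integrable setT (EFin \o w) -> m.-integrable setT F ->
  (forall n, measurable_fun setT (u n)) ->
  (forall n x, `|u n x|%:E <= F x)%E ->
  (forall x, (F x < +oo)%E -> cvgn (u ^~ x)) ->
  (forall k Q n, G k Q -> (k < n)%N -> \int[m]_(x in Q) u n x = \int[m]_(x in Q) w x) ->
  {ae m, forall x, u ^~ x @ \oo --> w x}.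
Proof.
move=> wi Fi mu uF ucvg uw.
have F0 x : (0 <= F x)%E by apply: le_trans (uF 0%N x); rewrite lee_fin.
have mF := measurable_int _ Fi.
pose E := [set x | (F x < +oo)%E].
have mE : measurable E.
  rewrite (_ : E = setT `&` F @^-1` [set~ +oo%E]).
    by apply: mF => //; apply: measurableC; exact: emeasurable_set1.
  rewrite setTI; apply/seteqP; split => x /=; rewrite /E/= ltey; first by move/eqP.
  by move=> h; apply/eqP.
(* Cutting off the null set where the majorant is infinite gives convergence at every point, hence a
   measurable limit. *)
pose v n x := u n x * \1_E x.
have vE n x : E x -> v n x = u n x by move=> Ex; rewrite /v indicE mem_set// mulr1.
have vC n x : ~ E x -> v n x = 0 by move=> Ex; rewrite /v indicE memNset// mulr0.
have vcvg x : cvgn (v ^~ x).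
  have [Ex|nEx] := pselect (E x).
    by rewrite (_ : v ^~ x = u ^~ x); [exact: ucvg|apply/funext => n; exact: vE].
  by rewrite (_ : v ^~ x = cst 0); [exact: is_cvg_cst|apply/funext => n; exact: vC].
pose g x := limn (v ^~ x).
have vg x : v ^~ x @ \oo --> g x by exact: vcvg.
have mv n : measurable_fun setT (v n) by apply: measurable_funM => //; exact: measurable_indic.
have mg : measurable_fun setT g by apply: measurable_fun_cvg (mv) _ => x _; exact: vg.
have vF n x : (`|(v n x)%:E| <= F x)%E.
  have [Ex|nEx] := pselect (E x); first by rewrite vE//; exact: uF.
  by rewrite vC// abse0.
have dc D : measurable D -> m.-integrable D (EFin \o g) /\
    (\int[m]_(x in D) (v n x)%:E)%E @[n --> \oo] --> (\int[m]_(x in D) (g x)%:E)%E.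
  move=> mD.
  have [] := @dominated_convergence _ _ _ m D mD (fun n => EFin \o v n) (EFin \o g) F.
  - by move=> n; apply/measurable_EFinP; exact: measurable_funTS.
  - by apply/measurable_EFinP; exact: measurable_funTS.
  - by apply: nearW => x _; apply: cvg_EFin; [exact: nearW|exact: vg].
  - by apply: integrableS Fi.
  - by apply: nearW => x n _; exact: vF.
  - by move=> h1 _ h3; split.
have [gi _] := dc _ measurableT.
have aeE : {ae m, forall x, E x}.
  apply: filterS (integrable_ae measurableT Fi) => x /(_ I) h.
  by rewrite /E/= ltey; move: h; rewrite fin_numE => /andP[].
have gw : ae_eq m setT (EFin \o g) (EFin \o w).
  apply: ae_eq_cells => // k Q GQ; have mQ := measurable_cell hG GQ.
  have [giQ lim] := dc _ mQ.
  have ev : \forall n \near \oo, (\int[m]_(x in Q) (v n x)%:E)%E = (\int[m]_(x in Q) w x)%:E.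
    exists k.+1 => // n /= kn; rewrite -(uw _ _ _ GQ kn).
    have uni : m.-integrable Q (EFin \o u n).
      apply: (@le_integrable _ _ _ _ _ mQ _ F).
      - by apply/measurable_EFinP; exact: measurable_funTS.
      - by move=> x _; rewrite [leRHS]gee0_abs//; exact: uF.
      - by apply: integrableS Fi.
    rewrite /Rintegral fineK ?integrable_fin_num//.
    apply: ae_eq_integral => //.
    - by apply/measurable_EFinP; exact: measurable_funTS.
    - by apply/measurable_EFinP; exact: measurable_funTS.
    - by apply: filterS aeE => x Ex _; rewrite vE.
  have lim2 : (\int[m]_(x in Q) (v n x)%:E)%E @[n --> \oo] --> (\int[m]_(x in Q) w x)%:E.
    by apply: cvg_near_cst.
  have := cvg_unique _ lim lim2 => h.
  by rewrite /Rintegral h.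
apply: filterS2 aeE gw => x Ex /(_ I) /= [<-].
by rewrite (_ : u ^~ x = v ^~ x); [exact: vg|apply/funext => n; rewrite vE].
Qed.

End recovery.

(** * The atomic series with the coefficients k_P *)

Section st_to_besov.
Context d (T : measurableType d) (R : realType).
Variable m : {finite_measure set T -> \bar R}.
Variables (lam1 lam2 : R) (G : nat -> set (set T)).
Hypothesis hlam : [/\ 0 < lam1, lam1 < lam2 & lam2 < 1].
Hypothesis hG : good_grid m lam1 lam2 G.
Variables (s p : R) (q : \bar R).
Hypotheses (hs : 0 < s) (hp : 1 <= p) (hq : (1 <= q)%E).
Local Notation vol := (vol m).
Local Notation normc := Normc.normc.
Local Notation "'N[ h ]" := (Lnorm m p%:E (EFin \o h)).

Let p0 : 0 < p. Proof. exact: lt_le_trans hp. Qed.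

Definition canonical_atom (Q : set T) (x : T) : R[i] :=
  real_complex R (vol Q `^ (s - p^-1) * \1_Q x).

Lemma canonical_atomP Q : souza_atom m s p Q (canonical_atom Q).
Proof.
split.
- by exists (real_complex R (vol Q `^ (s - p^-1))) => x Qx; rewrite /canonical_atom indicE mem_set// mulr1.
- by move=> x nQx; rewrite /canonical_atom indicE memNset// mulr0.
- have le x : normc (canonical_atom Q x) <= vol Q `^ (s - p^-1).
    rewrite normc_real normrM ger0_norm ?powR_ge0// ler_piMr ?powR_ge0//.
    by rewrite indicE; case: (x \in Q); rewrite ?normr1 ?normr0.
  rewrite /cLnorm unlock /=; case: ifPn => _; last by rewrite lee_fin powR_ge0.
  apply/ess_supP; apply: nearW => x; rewrite lee_fin ger0_norm ?sqrtr_ge0//.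
  exact: le.
Qed.

(* Volumes strictly decrease from a level to the next, so a set lies in at most one
   [G k]: coefficients may depend on the set alone. *)
Definition level_of (Q : set T) : nat := xget 0%N [set k | G k Q].

Lemma level_ofE k Q : G k Q -> level_of Q = k.
Proof.
move=> GQ; have GL : G (level_of Q) Q by apply: (@xgetPex _ 0%N [set k | G k Q]); exists k.
have [kl|/ltnW lk] := leqP k (level_of Q).
  apply/eqP; rewrite eqn_leq kl andbT -subn_eq0; apply/eqP.
  by apply: (cell_level hlam hG GQ); rewrite subnK.
apply/eqP; rewrite eqn_leq lk/= -subn_eq0; apply/eqP.
by apply: (cell_level hlam hG GL); rewrite subnK.
Qed.

Variable ord : set (set T) -> seq (set T).
Hypothesis hord : orderings G ord.
Variable pt : set T -> T.
Hypothesis hpt : forall k P, G k P -> P (pt P).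
Variable f : T -> R[i].
Hypothesis mf : cmeasurable f.
Hypothesis fi : m.-integrable setT (fun x => (normc (f x))%:E).

Definition st_coefficient (Q : set T) : R[i] :=
  if level_of Q is k.+1 then st_coef m G ord s p pt f k Q else st_coef0 m s p f.

Local Notation L := (level_sum G st_coefficient canonical_atom).

Let atoms k Q : G k Q -> souza_atom m s p Q (canonical_atom Q).
Proof. by move=> _; exact: canonical_atomP. Qed.

Definition partial_sum n x := \sum_(k < n) L k x.

(** The factor |P|^(1/p-s) in k_P cancels the height |P|^(s-1/p) of the canonical atom, leaving the
    jump of averages. *)
Lemma level_sum_st k Q P x : G k Q -> G k.+1 P -> P `<=` Q -> P x ->
  L k.+1 x = caverage m f P - caverage m f Q.
Proof.
move=> GQ GP PQ Px; have vP := vol_gt0 hG GP.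
rewrite (level_sum_cell hG _ atoms GP Px) /st_coefficient (level_ofE GP).
rewrite (st_coefE hlam hG hord mf fi s p hpt GQ); last exact/(child_cellsP hG).
rewrite /canonical_atom indicE mem_set// mulr1 mulrAC -real_complexM.
rewrite -powRD; last by rewrite (gt_eqF vP) implybT.
by rewrite (_ : p^-1 - s + (s - p^-1) = 0) ?powRr0 ?mul1r//; ring.
Qed.

Lemma level_sum_st0 x : L 0%N x = caverage m f setT.
Proof.
have GT : G 0%N setT by rewrite (grid0 hG).
have vT := volT_gt0 hG.
rewrite (level_sum_cell hG _ atoms GT (I : setT x)) /st_coefficient (level_ofE GT).
rewrite /st_coef0 (haar_coef0E mf fi) /canonical_atom indicT mulr1 /caverage.
rewrite mulrAC -real_complexM mulrCA -real_complexM; congr (_ * real_complex R _).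
rewrite -powR12_sqrt ?(ltW vT)// -powRN -!powRD ?(gt_eqF vT) ?implybT//.
rewrite (_ : p^-1 - s - 2^-1 + (s - p^-1) + - 2^-1 = -1) ?powR_inv1 ?(ltW vT)//.
by field; rewrite gt_eqF.
Qed.

(** The jumps telescope along the ancestors of Q. The levels 0 to n are n+1 in number, whence the
    shift of the index. *)
Lemma partial_sumE n Q x : G n Q -> Q x -> partial_sum n.+1 x = caverage m f Q.
Proof.
elim: n Q => [|n ih] P GP Px; rewrite /partial_sum big_ord_recr/=.
  rewrite big_ord0 add0r level_sum_st0; congr caverage.
  by move: GP; rewrite (grid0 hG).
have [Q GQ PQ] := grid_nested hG GP.
by rewrite -/(partial_sum n.+1 x) (ih Q GQ (PQ _ Px)) (level_sum_st GQ GP PQ Px) addrC subrK.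
Qed.

Lemma cmeasurable_partial_sum n : cmeasurable (partial_sum n).
Proof. by apply: cmeasurable_sum => k; exact: (cmeasurable_level_sum hG _ atoms). Qed.

(** Induction on j for all cells at once: the integral over Q splits over its children, for which
    the same partial sum is one generation closer. For j = 0 the partial sum is the average of f on
    Q. *)
Lemma Rintegral_partial_sum k j Q :
  (forall n, m.-integrable setT (fun x => (normc (partial_sum n x))%:E)) -> G k Q ->
  cintegral_on m Q (partial_sum (j + k).+1) = cintegral_on m Q f.
Proof.
move=> Si; have [iRe iIm] := cintegrable_ReIm measurableT mf fi.
elim: j k Q => [|j ih] k Q GQ; have mQ := measurable_cell hG GQ.
  have vQ := vol_gt0 hG GQ.
  apply: complexP => /=.
    rewrite (@eq_Rintegral _ _ _ _ _ (cst (complex.Re (caverage m f Q)))); last first.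
      by move=> x /set_mem Qx; rewrite (partial_sumE GQ Qx).
    by rewrite Rintegral_cst// Re_realM -/(vol Q) mulfVK ?gt_eqF.
  rewrite (@eq_Rintegral _ _ _ _ _ (cst (complex.Im (caverage m f Q)))); last first.
    by move=> x /set_mem Qx; rewrite (partial_sumE GQ Qx).
  by rewrite Rintegral_cst// Im_realM -/(vol Q) mulfVK ?gt_eqF.
have [sRe sIm] := cintegrable_ReIm measurableT (cmeasurable_partial_sum (j.+1 + k).+1) (Si _).
have ihP P : P \in child_cells G k Q ->
    cintegral_on m P (partial_sum (j.+1 + k).+1) = cintegral_on m P f.
  by move=> /(child_cellsP hG)[GP _]; rewrite addSnnS; exact: ih.
apply: complexP => /=; rewrite !(Rintegral_children hG GQ)//; apply: eq_big_seq => P /ihP; by case.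
Qed.

Hypothesis st_fin : (N_st m G ord s p q pt f < +oo)%E.

(** [N_st] adds the root coefficient outside the l^q norm, which can only increase the cost. *)
Lemma st_cost_le : (besov_cost G p q st_coefficient <= N_st m G ord s p q pt f)%E.
Proof.
rewrite (besov_costE hG q hp).
apply: (le_trans (@mixed_norm_recl _ p q (level_cost G p st_coefficient) hp hq _)).
  exact: level_cost_ge0.
rewrite /N_st; apply: leeD.
  rewrite lee_fin /level_cost -(fsbig_cells hG) (grid0 hG) fsbig_set1.
  rewrite /st_coefficient (@level_ofE 0%N); last by rewrite (grid0 hG).
  by rewrite -powRrM divff ?gt_eqF// powRr1// normc_ge0.
rewrite le_eqVlt; apply/orP; left; apply/eqP; congr (mixed_norm p q _).
apply/funext => k; rewrite (fsbig_cells hG) /level_cost -powRrM mulVf ?gt_eqF// powRr1; last first.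
  by apply: sumr_ge0 => Q _; exact: powR_ge0.
congr EFin; apply: eq_big_seq => Q /(cellsP hG) GQ.
by rewrite /st_coefficient (level_ofE GQ).
Qed.

Lemma st_abs : (\sum_(0 <= k <oo) cLnorm m p%:E (L k) < +oo)%E.
Proof.
apply: (@le_lt_trans _ _ (\sum_(0 <= k <oo)
    (mesh m G k `^ s * level_cost G p st_coefficient k)%:E)%E).
  apply: lee_nneseries => [k _ _|k _]; first exact: Lnorm_ge0.
  exact: (cLnorm_level_sum_le hG hs hp _ atoms).
apply: (le_lt_trans (mesh_cost_le hG s hp hq st_coefficient)).
apply: lte_mul_pinfty.
- exact: Gamma_ge0.
- by rewrite ge0_fin_numE ?(Gamma_lty hlam hG hs hq)//; exact: Gamma_ge0.
- exact: le_lt_trans st_cost_le st_fin.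
Qed.

Lemma cLp_level_sum k : cLp m p%:E (L k).
Proof.
split; first exact: (cmeasurable_level_sum hG _ atoms).
by apply: le_lt_trans (cLnorm_level_sum_le hG hs hp _ atoms k) _; exact: ltry.
Qed.

Let iL k : m.-integrable setT (fun x => (normc (L k x))%:E).
Proof. by apply: cLp_integrable (cLp_level_sum k); rewrite lee_fin. Qed.

(** The dominating function for all partial sums. Its integral is at most |I|^(1-1/p) times the sum
    of the L^p norms of the levels. *)
Definition level_majorant x : \bar R := (\sum_(0 <= k <oo) (normc (L k x))%:E)%E.

Lemma level_majorant_integrable : m.-integrable setT level_majorant.
Proof.
have mL k : measurable_fun setT (fun x => (normc (L k x))%:E) by exact: measurable_int (iL k).
apply/integrableP; split.
  by apply: (ge0_emeasurable_sum (P := xpredT)) => // k x _ _; rewrite lee_fin normc_ge0.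
rewrite (eq_integral level_majorant); last first.
  move=> x _; rewrite gee0_abs//; apply: nneseries_ge0 => k _ _.
  by rewrite lee_fin normc_ge0.
rewrite integral_nneseries//; last by move=> k x _; rewrite lee_fin normc_ge0.
apply: (@le_lt_trans _ _ (\sum_(0 <= k <oo)
    (vol setT `^ (1 - p^-1))%:E * cLnorm m p%:E (L k))%E).
  apply: lee_nneseries => [k _ _|k _].
    by apply: integral_ge0 => x _; rewrite lee_fin normc_ge0.
  by apply: (L1_le_Lnorm hp (fun x => normc_ge0 (L k x)) (iL k)).
rewrite nneseriesZl; last by move=> k _; exact: Lnorm_ge0.
by apply: lte_mul_pinfty st_abs => //; rewrite lee_fin powR_ge0.
Qed.

Lemma normc_partial_sum_le n x : ((normc (partial_sum n x))%:E <= level_majorant x)%E.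
Proof.
apply: (@le_trans _ _ (\sum_(0 <= k < n) (normc (L k x))%:E)%E).
  by rewrite sumEFin lee_fin big_mkord; exact: ler_normc_sum.
by apply: (@nneseries_lim_ge _ _ xpredT) => k _ _; rewrite lee_fin normc_ge0.
Qed.

Lemma partial_sum_integrable n :
  m.-integrable setT (fun x => (normc (partial_sum n x))%:E).
Proof.
apply: le_integrable level_majorant_integrable => //.
- by apply/measurable_EFinP; apply: measurable_normc; exact: cmeasurable_partial_sum.
- move=> x _; rewrite gee0_abs ?lee_fin ?normc_ge0// (le_trans (normc_partial_sum_le n x))//.
  exact: lee_abs.
Qed.

(** The parameter [re] treats real and imaginary parts with one argument. Where the majorant is
    finite, the series of levels converges absolutely. *)
Lemma partial_sum_cvg (re : R[i] -> R) : (re = @complex.Re R \/ re = @complex.Im R) ->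
  {ae m, forall x, (fun n => re (partial_sum n x)) @ \oo --> re (f x)}.
Proof.
move=> hre.
have re_le z : `|re z| <= normc z by case: hre => ->; [exact: normc_Re|exact: normc_Im].
have re_sum n x : re (partial_sum n x) = series (fun k => re (L k x)) n.
  by rewrite /series/= big_mkord; case: hre => ->; [rewrite Re_sum|rewrite Im_sum].
have mre g : cmeasurable g -> measurable_fun setT (fun x => re (g x)).
  by case: hre => -> [].
have ire : m.-integrable setT (EFin \o (fun x => re (f x))).
  by case: hre => ->; case: (cintegrable_ReIm measurableT mf fi).
apply: (@limit_recovery _ _ _ _ _ _ _ hG (fun x => re (f x))
  (fun n x => re (partial_sum n x)) level_majorant ire level_majorant_integrable).
- by move=> n; apply: mre; exact: cmeasurable_partial_sum.
- by move=> n x; apply: le_trans (normc_partial_sum_le n x); rewrite lee_fin.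
- move=> x xoo; rewrite (_ : (fun n => _) = series (fun k => re (L k x))); last first.
    by apply/funext => n; exact: re_sum.
  apply: normed_cvg; apply: nondecreasing_is_cvgn; first by apply: nondecreasing_series => k _ _; exact: normr_ge0.
  exists (fine (level_majorant x)) => _ [n _ <-].
  have M0 : (0 <= level_majorant x)%E.
    by apply: nneseries_ge0 => k _ _; rewrite lee_fin normc_ge0.
  rewrite -lee_fin fineK ?ge0_fin_numE// /series/=.
  apply: (@le_trans _ _ (\sum_(0 <= k < n) (normc (L k x))%:E)%E).
    by rewrite sumEFin lee_fin; apply: ler_sum => k _.
  by apply: (@nneseries_lim_ge _ _ xpredT) => k _ _; rewrite lee_fin normc_ge0.
- move=> k Q n GQ kn.
  have := @Rintegral_partial_sum k (n - k.+1)%N Q partial_sum_integrable GQ.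
  rewrite -addnS subnK// => h.
  by case: hre => ->; case: h.
Qed.

Lemma partial_sum_diff_le n M :
  (cLnorm m p%:E (fun x => partial_sum (M + n)%N x - partial_sum n x)%R <=
   \sum_(n <= k <oo) cLnorm m p%:E (L k))%E.
Proof.
apply: (@le_trans _ _ (\sum_(n <= k < M + n) cLnorm m p%:E (L k))%E); last first.
  by apply: (@nneseries_lim_ge _ _ xpredT) => k _ _; exact: Lnorm_ge0.
elim: M => [|M ih].
  rewrite add0n big_geq// /cLnorm (_ : (fun x => _) = cst 0%E) ?Lnorm0//; first by rewrite gt_eqF.
  by apply/funext => x /=; rewrite subrr Normc.normc0.
rewrite addSn big_nat_recr/= ?leq_addl//.
apply: (@le_trans _ _ (cLnorm m p%:E (fun x => partial_sum (M + n)%N x - partial_sum n x)%R +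
  cLnorm m p%:E (L (M + n)%N))%E); last by rewrite leeD2r.
rewrite (_ : (fun x => _) =
    (fun x => (partial_sum (M + n)%N x - partial_sum n x) + L (M + n)%N x)).
  apply: cLnormD => //; last exact: (cmeasurable_level_sum hG _ atoms).
  by apply: cmeasurableB; exact: cmeasurable_partial_sum.
by apply/funext => x; rewrite /partial_sum big_ord_recr/= addrAC.
Qed.

(** The differences of partial sums are bounded by the tail uniformly in M, and Fatou's lemma lets M
    tend to infinity. For n = 0 this also yields f in L^p. *)
Lemma partial_sum_remainder_le n :
  (cLnorm m p%:E (fun x => f x - partial_sum n x)%R <=
   \sum_(n <= k <oo) cLnorm m p%:E (L k))%E.
Proof.
set C := (\sum_(n <= k <oo) _)%E.
have C0 : (0 <= C)%E by apply: nneseries_ge0 => k _ _; exact: Lnorm_ge0.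
have mS := cmeasurable_partial_sum.
pose D M x := normc (partial_sum (M + n)%N x - partial_sum n x).
have D0 M x : 0 <= D M x by exact: normc_ge0.
have mD M : measurable_fun setT (D M) by apply: measurable_normc; exact: cmeasurableB.
have mfS : measurable_fun setT (fun x => normc (f x - partial_sum n x)).
  by apply: measurable_normc; exact: cmeasurableB.
have C_E : C = ((C `^ p) `^ p^-1)%E by rewrite -poweRrM divff ?gt_eqF// poweRe1.
have N_E : (cLnorm m p%:E (fun x => f x - partial_sum n x)%R =
    (\int[m]_x (normc (f x - partial_sum n x) `^ p)%:E) `^ p^-1)%E.
  exact: (LnormE m p (fun x => normc_ge0 (f x - partial_sum n x))).
rewrite [leRHS]C_E N_E.
apply: le_poweR; first by rewrite invr_ge0 ltW.
  by apply: integral_ge0 => x _; rewrite lee_fin powR_ge0.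
apply: (@fatou_bound _ _ _ _ (fun M x => D M x `^ p)).
- by move=> M; apply/measurable_EFinP; exact: measurable_powR_EFin.
- by apply/measurable_EFinP; exact: (measurable_powR_EFin p mfS).
- by move=> M x; exact: powR_ge0.
- by move=> x; exact: powR_ge0.
- apply: filterS2 (partial_sum_cvg (or_introl erefl)) (partial_sum_cvg (or_intror erefl)).
  move=> x cRe cIm; apply: cvg_powR => //; first exact: normc_ge0.
  apply: cvg_normc.
    under eq_fun do rewrite ReB; rewrite ReB; apply: cvgB; last exact: cvg_cst.
    by rewrite (cvg_shiftn n (fun k => complex.Re (partial_sum k x))).
  under eq_fun do rewrite ImB; rewrite ImB; apply: cvgB; last exact: cvg_cst.
  by rewrite (cvg_shiftn n (fun k => complex.Im (partial_sum k x))).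
- move=> M; have := partial_sum_diff_le n M; rewrite -/C => h.
  have {}h : ((\int[m]_x (D M x `^ p)%:E) `^ p^-1 <= C)%E.
    by apply: le_trans h; rewrite -(LnormE m p (D0 M)).
  have I0 : (0 <= \int[m]_x (D M x `^ p)%:E)%E.
    by apply: integral_ge0 => x _; rewrite lee_fin powR_ge0.
  move: (\int[m]_x (D M x `^ p)%:E)%E I0 h => J J0 h.
  have -> : J = ((J `^ p^-1) `^ p)%E by rewrite -poweRrM mulVf ?gt_eqF// poweRe1.
  by apply: le_poweR => //; [exact: ltW|exact: poweR_ge0].
Qed.

Lemma st_besov_rep : besov_rep m G s p q f st_coefficient canonical_atom.
Proof.
split.
- split=> //; apply: (@le_lt_trans _ _ (\sum_(0 <= k <oo) cLnorm m p%:E (L k))%E); last exact: st_abs.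
  apply: le_trans (partial_sum_remainder_le 0).
  rewrite (_ : (fun x => f x - partial_sum 0 x) = f)//.
  by apply/funext => x; rewrite /partial_sum big_ord0 subr0.
- exact: atoms.
- exact: st_abs.
- apply: (squeeze_cvge (f := cst 0%E) (h := fun n => (\sum_(n <= k <oo) cLnorm m p%:E (L k))%E)).
  + by apply: nearW => n; rewrite Lnorm_ge0/=; exact: partial_sum_remainder_le.
  + exact: cvg_cst.
  + by apply: nneseries_tail_cvg st_abs _ => k _; exact: Lnorm_ge0.
- exact: le_lt_trans st_cost_le st_fin.
Qed.

End st_to_besov.

(** * Closing the cycle of inequalities *)

Section besov_norm_facts.
Context d (T : measurableType d) (R : realType).
Variable m : {finite_measure set T -> \bar R}.

(** When [N_st] is finite, the series built from the k_P is an admissible representation of f;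
    otherwise nothing is claimed. *)
Lemma besov_norm_le_N_st (lam1 lam2 : R) (G : nat -> set (set T)) (s p : R) (q : \bar R)
    ord pt (f : T -> R[i]) :
  [/\ 0 < lam1, lam1 < lam2 & lam2 < 1] -> good_grid m lam1 lam2 G ->
  0 < s -> 1 <= p -> (1 <= q)%E -> orderings G ord ->
  (forall k P, G k P -> P (pt P)) -> cmeasurable f ->
  m.-integrable setT (fun x => (Normc.normc (f x))%:E) ->
  (besov_norm m G s p q f <= N_st m G ord s p q pt f)%E.
Proof.
move=> hlam hG hs hp hq hord hpt mf fi.
have [->|] := eqVneq (N_st m G ord s p q pt f) +oo%E; first exact: leey.
rewrite -ltey => st_fin.
apply: (le_trans _ (st_cost_le hlam hG s hp hq ord pt f)).
apply: ereal_inf_lbound; eexists; eexists; split; last by [].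
exact: (st_besov_rep hlam hG hs hp hq hord hpt mf fi st_fin).
Qed.

Lemma besov_norm_lty G s p q f : (besov_norm m G s p q f < +oo)%E <-> besov m G s p q f.
Proof.
split=> [/ereal_inf_lt[_ [c [a [rep _]]] _]|[c [a rep]]]; first by exists c, a.
apply: le_lt_trans (rep_cost rep).
by apply: ereal_inf_lbound; exists c, a.
Qed.

End besov_norm_facts.

Theorem theorem15p1 (d : measure_display) (T : measurableType d) (R : realType)
    (m : {finite_measure set T -> \bar R}) (lam1 lam2 : R)
    (hlam : [/\ 0 < lam1, lam1 < lam2 & lam2 < 1])
    (G : nat -> set (set T)) (hG : good_grid m lam1 lam2 G)
    (s p : R) (q : \bar R) (hs : 0 < s) (hp : 1 <= p) (hq : (1 <= q)%E)
    (ord : set (set T) -> seq (set T)) (hord : orderings G ord)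
    (pt : set T -> T) (hpt : forall k P, G k P -> P (pt P)) :
  (forall (beta : \bar R) (f : T -> R[i]), (1 < beta)%E -> cLp m beta f ->
    [/\ (besov_norm m G s p q f < +oo)%E <-> besov m G s p q f,
        (N_st m G ord s p q pt f < +oo)%E <-> besov m G s p q f,
        (N_haar m G ord s p q f < +oo)%E <-> besov m G s p q f &
        (N_osc m G s p q f < +oo)%E <-> besov m G s p q f] /\
    [/\ (besov_norm m G s p q f <= N_st m G ord s p q pt f)%E,
        (N_st m G ord s p q pt f
           <= (C_e lam1 lam2 s p)%:E * N_haar m G ord s p q f)%E,
        (N_haar m G ord s p q f
           <= (C_H lam1 lam2)%:E * N_osc m G s p q f)%E &
        (N_osc m G s p q f
           <= C_o m G lam2 s q * besov_norm m G s p q f)%E]) /\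
  [/\ equivalent_norms (besov m G s p q)
        (besov_norm m G s p q) (N_st m G ord s p q pt),
      equivalent_norms (besov m G s p q)
        (besov_norm m G s p q) (N_haar m G ord s p q) &
      equivalent_norms (besov m G s p q)
        (besov_norm m G s p q) (N_osc m G s p q)].
Proof.
have CH1 : 1 <= C_H lam1 lam2 := C_H_ge1 lam1 lam2.
have Ce1 : 1 <= C_e lam1 lam2 s p.
  by rewrite /C_e lerDl !mulr_ge0 ?powR_ge0 ?le_max ?powR_ge0// (le_trans ler01).
have Co1 := C_o_ge1 m G hlam q hs.
have Cof := C_o_fin_num hlam hG hs hq.
set Co := fine (C_o m G lam2 s q).
have CoE : C_o m G lam2 s q = Co%:E by rewrite fineK.
have {Co1}Co1 : 1 <= Co by rewrite -lee_fin -CoE.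
rewrite CoE.
(* Stated for integrable f so as to serve twice: for f in L^beta, and for f in the Besov space in
   the equivalence of norms. *)
have chain (f : T -> R[i]) : cmeasurable f ->
    m.-integrable setT (fun x => (Normc.normc (f x))%:E) ->
    [/\ (besov_norm m G s p q f <= N_st m G ord s p q pt f)%E,
        (N_st m G ord s p q pt f
           <= (C_e lam1 lam2 s p)%:E * N_haar m G ord s p q f)%E,
        (N_haar m G ord s p q f
           <= (C_H lam1 lam2)%:E * N_osc m G s p q f)%E &
        (N_osc m G s p q f <= Co%:E * besov_norm m G s p q f)%E].
  move=> mf fi; split.
  - exact: (besov_norm_le_N_st hlam hG hs hp hq hord hpt mf fi).
  - exact: (N_st_le_N_haar hlam hG hord mf fi s hp hpt hq).
  - exact: (N_haar_le_N_osc hlam hG hord mf fi s hp hq).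
  - by rewrite -CoE; exact: (N_osc_le_besov_norm hlam hG hs hp hq f).
have besov_L1 (f : T -> R[i]) : besov m G s p q f -> cmeasurable f /\
    m.-integrable setT (fun x => (Normc.normc (f x))%:E).
  move=> [c [a rep]]; have fp := rep_Lp rep; split; first by case: fp.
  by apply: cLp_integrable fp; rewrite lee_fin.
have haar0 f : (0 <= N_haar m G ord s p q f)%E.
  by apply: adde_ge0; [rewrite lee_fin mulr_ge0 ?powR_ge0 ?normc_ge0|exact: mixed_norm_ge0].
have osc0 f : (0 <= N_osc m G s p q f)%E.
  apply: adde_ge0; last exact: mixed_norm_ge0.
  by apply: mule_ge0; [rewrite lee_fin powR_ge0|exact: Lnorm_ge0].
have besov0 f : (0 <= besov_norm m G s p q f)%E.
  by apply: le_ereal_inf_tmp => _ [c [a [_ ->]]]; exact: mixed_norm_ge0.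
have ltyM (C : R) (x : \bar R) : 1 <= C -> (x < +oo -> C%:E * x < +oo)%E.
  by move=> C1 xoo; apply: lte_mul_pinfty => //; rewrite lee_fin (le_trans ler01).
have leM (C D : R) (x : \bar R) : C <= D -> (0 <= x -> C%:E * x <= D%:E * x)%E.
  by move=> CD x0; apply: lee_wpmul2r => //; rewrite lee_fin.
have M_le (C : R) (x y z : \bar R) : 1 <= C -> (x <= C%:E * y -> y <= z -> x <= C%:E * z)%E.
  by move=> C1 xy yz; apply: (le_trans xy); apply: lee_wpmul2l => //; rewrite lee_fin (le_trans ler01).
have MM_le (C D : R) (x y z : \bar R) : 1 <= C ->
    (x <= C%:E * y -> y <= D%:E * z -> x <= (C * D)%:E * z)%E.
  by move=> C1 xy yz; rewrite EFinM -muleA; exact: M_le xy yz.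
have ge1 (C D : R) : 1 <= C -> 1 <= D -> 1 <= C * D by exact: mulr_ege1.
split.
  move=> beta f beta1 [mf fbeta].
  have fi := cLp_integrable (ltW beta1) (conj mf fbeta).
  have [h1 h2 h3 h4] := chain f mf fi; split; last by split.
  have Bf := besov_norm_lty m G s p q f.
  have o_lty : (besov_norm m G s p q f < +oo -> N_osc m G s p q f < +oo)%E.
    by move=> /(ltyM Co _ Co1); exact: le_lt_trans.
  have h_lty : (N_osc m G s p q f < +oo -> N_haar m G ord s p q f < +oo)%E.
    by move=> /(ltyM _ _ CH1); exact: le_lt_trans.
  have s_lty : (N_haar m G ord s p q f < +oo -> N_st m G ord s p q pt f < +oo)%E.
    by move=> /(ltyM _ _ Ce1); exact: le_lt_trans.
  have b_lty : (N_st m G ord s p q pt f < +oo -> besov_norm m G s p q f < +oo)%E.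
    exact: le_lt_trans.
  split=> //; split=> h.
  - exact/Bf/b_lty.
  - exact/s_lty/h_lty/o_lty/Bf.
  - exact/Bf/b_lty/s_lty.
  - exact/h_lty/o_lty/Bf.
  - exact/Bf/b_lty/s_lty/h_lty.
  - exact/o_lty/Bf.
(* The product along the whole cycle. All three factors are at least 1, so it dominates every
   partial product, and one constant serves the three equivalences. *)
pose C := C_e lam1 lam2 s p * (C_H lam1 lam2 * Co).
have C1 : 1 <= C by rewrite ge1// ge1.
have C0 : 0 < C by exact: lt_le_trans C1.
have Ce_C : C_e lam1 lam2 s p <= C by rewrite ler_peMr ?ge1// (le_trans ler01).
have CHCo_C : C_H lam1 lam2 * Co <= C by rewrite ler_peMl// (le_trans ler01)// ge1.
have CeCH_C : C_e lam1 lam2 s p * C_H lam1 lam2 <= C.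
  by rewrite /C mulrA ler_peMr// (le_trans ler01)// ge1.
have Co_C : Co <= C.
  by apply: le_trans CHCo_C; rewrite ler_peMl// (le_trans ler01).
split; exists C => // f /besov_L1[mf fi]; have [h1 h2 h3 h4] := chain f mf fi;
  have b0 := besov0 f; have o0 := osc0 f; have hh0 := haar0 f.
- split; last exact: (MM_le _ _ _ _ _ Ce1 h2 (MM_le _ _ _ _ _ CH1 h3 h4)).
  by apply: (le_trans h1); rewrite -[leLHS]mul1e leM// (le_trans b0).
- split; first by apply: (le_trans h1); apply: (le_trans h2); exact: leM.
  by apply: (le_trans (MM_le _ _ _ _ _ CH1 h3 h4)); exact: leM.
- split; last by apply: (le_trans h4); exact: leM.
  apply: (le_trans h1); apply: (le_trans (MM_le _ _ _ _ _ Ce1 h2 h3)); exact: leM.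
Qed.
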